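(* The set of isomorphism classes of finitely generated, rank 1, torsion-free right modules over the first Weyl algebra $\mathcal D_{\mathbf A^1}=\mathbf C\langle z,\partial\rangle/(\partial z-z\partial=1)$ is in natural bijective correspondence with the union, over all $n\ge0$, of the spaces $$\mathfrak{CM}_n=\{(X,Y)\in\mathfrak{gl}_n\times\mathfrak{gl}_n \;:\; [X,Y]\in\mathbb O\}/GL_n .$$
   Context: $\mathfrak{gl}_n$ is the space of complex $n\times n$ matrices, and $GL_n=GL_n(\mathbf C)$ acts by simultaneous conjugation. $\mathbb O\subset\mathfrak{gl}_n$ is the conjugacy class of traceless matrices of the form $\mathrm{Id}+A$ with $A$ a rank one matrix (the conjugacy class of $\mathrm{diag}(1-n,1,\dots,1)$). For $n=0$ the space $\mathfrak{CM}_0$ is a single point. The rank of a module is taken over the skew field of fractions of the Weyl algebra. *)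

(* Defs.v *)
From HB Require Import structures.
From mathcomp Require Import all_boot all_order all_algebra.
From mathcomp Require Import classical_sets.

Set Implicit Arguments.
Unset Strict Implicit.
Unset Printing Implicit Defensive.

Import GRing.Theory.
Local Open Scope ring_scope.
Local Open Scope classical_set_scope.

(* [D] with the elements [z], [d] is the algebra presented by the generators
   [z], [d] and the single relation [d z - z d = 1]: it satisfies the relation
   and is universal among algebras with two such elements. *)
Definition is_weyl_algebra (F : fieldType) (D : algType F) (z d : D) : Prop :=
  d * z - z * d = 1 /\
  forall (B : algType F) (u v : B), v * u - u * v = 1 ->
    exists f : {lrmorphism D -> B}, [/\ f z = u, f d = v &
      forall g : {lrmorphism D -> B}, g z = u -> g d = v -> g =1 f].

Definition is_skew_field_of_fractions (D : nzRingType) (K : unitRingType)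
    (iota : {rmorphism D -> K}) : Prop :=
  [/\ forall x : K, x != 0 -> x \is a GRing.unit,
      injective iota &
      forall x : K, exists a s : D, s != 0 /\ x = iota a * (iota s)^-1].

(* The library's [set_bij] is not available for the type of all modules over a
   ring, which lies in a larger universe than the one allowed for [set]. *)
Definition bijection_between (S T : Type) (P : S -> Prop) (Q : T -> Prop)
    (f : S -> T) : Prop :=
  [/\ forall x, P x -> Q (f x),
      forall x y, P x -> P y -> f x = f y -> x = y &
      forall y, Q y -> exists2 x, P x & f x = y].

(* Right modules over [D] are [lmodType]s over the converse ring [D^c]: for
   [a : D^c], the element [a *: m] is the product of [m] by [a] on the right. *)

Section RightModules.
Variable D : nzRingType.

Definition finitely_generated (M : lmodType D^c) : Prop :=
  exists (k : nat) (g : 'I_k -> M),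
    forall m : M, exists c : 'I_k -> D^c, m = \sum_(i < k) c i *: g i.

Definition torsion_free (M : lmodType D^c) : Prop :=
  forall (a : D^c) (m : M), a *: m = 0 -> a = 0 \/ m = 0.

Definition isomorphic (M N : lmodType D^c) : Prop :=
  exists f : {linear M -> N}, bijective f.

Definition iso_class (M : lmodType D^c) : lmodType D^c -> Prop :=
  fun N => isomorphic M N.

Variables (K : unitRingType) (iota : {rmorphism D -> K}).

Definition linear_along (M : lmodType D^c) (N : lmodType K^c) (f : M -> N) :=
  {morph f : x y / x + y} /\
  forall (a : D) (m : M), f ((a : D^c) *: m) = (iota a : K^c) *: f m.

(* [f] exhibits [N] as the extension of scalars of [M] from [D] to [K], that is
   as the tensor product of [M] and [K] over [D]. *)
Definition is_scalar_extension (M : lmodType D^c) (N : lmodType K^c)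
    (f : M -> N) : Prop :=
  linear_along f /\
  forall (N' : lmodType K^c) (g : M -> N'), linear_along g ->
    exists h : {linear N -> N'}, (forall m, h (f m) = g m) /\
      forall h' : {linear N -> N'}, (forall m, h' (f m) = g m) -> h' =1 h.

Definition has_rank (M : lmodType D^c) (r : nat) : Prop :=
  exists f : M -> 'rV[K^c]_r, is_scalar_extension f.

Definition rank1_torsion_free (M : lmodType D^c) : Prop :=
  [/\ finitely_generated M, has_rank M 1 & torsion_free M].

Definition rank1_torsion_free_class (c : lmodType D^c -> Prop) : Prop :=
  exists2 M : lmodType D^c, rank1_torsion_free M & c = iso_class M.

End RightModules.

Section CalogeroMoser.
Variable F : fieldType.

Definition rank_one_class (n : nat) : set 'M[F]_n :=
  [set B | \tr B = 0 /\ exists A : 'M[F]_n, \rank A = 1%N /\ B = 1%:M + A].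

Arguments rank_one_class : clear implicits.

(* [rank_one_class 0] is empty, whereas the space for [n = 0] is a point. *)
Definition cm_pairs (n : nat) : set ('M[F]_n * 'M[F]_n) :=
  [set p | n = 0%N \/ rank_one_class n (p.1 *m p.2 - p.2 *m p.1)].

Arguments cm_pairs : clear implicits.

Definition conj_orbit (n : nat) (p : 'M[F]_n * 'M[F]_n) :
    set ('M[F]_n * 'M[F]_n) :=
  [set q | exists g : 'M[F]_n, g \in unitmx /\
    q = (g *m p.1 *m invmx g, g *m p.2 *m invmx g)].

Definition cm_space (n : nat) : set (set ('M[F]_n * 'M[F]_n)) :=
  [set conj_orbit p | p in cm_pairs n].

Arguments cm_space : clear implicits.

(* The disjoint union, over all [n], of the types of sets of pairs: a
   dependent pair, as a record of its own since the universe of the library's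
   [{n : nat & _}] cannot accommodate these types. *)
Record sized_set : Type := SizedSet {
  sized_index : nat;
  sized_val : set ('M[F]_sized_index * 'M[F]_sized_index)
}.

Arguments sized_val : clear implicits.

Definition cm_union : set sized_set :=
  [set c | cm_space (sized_index c) (sized_val c)].

Definition cm_point (n : nat) (p : 'M[F]_n * 'M[F]_n) : sized_set :=
  SizedSet (conj_orbit p).

End CalogeroMoser.

(* The monad (Beilinson, ADHM) description of the module of a pair (X, Y) with
   [X, Y] = Id + i j: the cohomology of the complex of right modules
     D^n -> D^n (+) D^n (+) D -> D^n
   with the two maps below, acting on columns by multiplication on the left. *)
Section Monad.
Variables (F : fieldType) (D : algType F) (z d : D) (n : nat).

Definition scalars_mx p q (A : 'M[F]_(p, q)) : 'M[D]_(p, q) :=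
  map_mx (fun c : F => c%:A) A.

Definition monad_in (X Y : 'M[F]_n) (j : 'rV[F]_n) : 'M[D]_(n + n + 1, n) :=
  col_mx (col_mx (scalars_mx Y - d%:M) (scalars_mx X - z%:M)) (scalars_mx j).

Definition monad_out (X Y : 'M[F]_n) (i : 'cV[F]_n) : 'M[D]_(n, n + n + 1) :=
  row_mx (row_mx (scalars_mx X - z%:M) (d%:M - scalars_mx Y)) (- scalars_mx i).

(* [M] is isomorphic to ker (monad_out) / im (monad_in). *)
Definition is_monad_cohomology (X Y : 'M[F]_n) (i : 'cV[F]_n) (j : 'rV[F]_n)
    (M : lmodType D^c) : Prop :=
  let ker_out : set 'cV[D]_(n + n + 1) := [set v | monad_out X Y i *m v = 0] in
  exists f : 'cV[D^c]_(n + n + 1) -> M,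
    [/\ forall v w, ker_out v -> ker_out w -> f (v + w) = f v + f w,
        forall (a : D^c) v, ker_out v -> f (a *: v) = a *: f v,
        forall m, exists2 v, ker_out v & f v = m &
        forall v, ker_out v ->
          (f v = 0 <-> exists u : 'cV[D]_n, v = monad_in X Y j *m u)].

Lemma monad_complex (X Y : 'M[F]_n) (i : 'cV[F]_n) (j : 'rV[F]_n) :
  d * z - z * d = 1 -> X *m Y - Y *m X = 1%:M + i *m j ->
  monad_out X Y i *m monad_in X Y j = 0.
Proof.
move=> dz XY.
have sM p q r (A : 'M[F]_(p, q)) (B : 'M[F]_(q, r)) :
    scalars_mx (A *m B) = scalars_mx A *m scalars_mx B.
  apply/matrixP => k l; rewrite !mxE scaler_suml; apply: eq_bigr => h _.
  by rewrite !mxE mulr_algl scalerA.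
have sC (A : 'M[F]_n) (a : D) : scalars_mx A *m a%:M = a%:M *m scalars_mx A.
  apply/matrixP => k l; rewrite mul_scalar_mx !mxE (bigD1 l) //= big1 => [|h hl].
    by rewrite !mxE eqxx mulr1n addr0 mulr_algl mulr_algr.
  by rewrite !mxE (negPf hl) mulr0n mulr0.
have sB : scalars_mx X *m scalars_mx Y - scalars_mx Y *m scalars_mx X =
    1%:M + scalars_mx i *m scalars_mx j.
  rewrite -!sM; apply/matrixP => k l; move/matrixP/(_ k l): XY.
  rewrite !mxE => XY; rewrite -scalerBl XY scalerDl; congr (_ + _).
  by case: (k == l); rewrite ?mulr1n ?scale1r ?mulr0n ?scale0r.
have XYE : scalars_mx X *m scalars_mx Y =
    scalars_mx Y *m scalars_mx X + (1%:M + scalars_mx i *m scalars_mx j).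
  by rewrite -sB addrC subrK.
have dzE : (d * z)%:M = (z * d)%:M + 1%:M :> 'M[D]_n.
  by rewrite -raddfD /= -dz addrC subrK.
have cancel (V : zmodType) (a o b e f g : V) :
    a + (o + b) - e - (f - g) + (e - (g + o) - (a - f)) - b = 0.
  rewrite !opprB !opprD !addrA.
  rewrite [LHS](ACl ((1*11)*(2*9)*(3*12)*(7*4)*(5*8)*(10*6))%AC) /=.
  by rewrite !subrr !addr0.
rewrite /monad_out /monad_in !mul_row_col !mulmxBl !mulmxBr mulNmx !sC XYE.
by rewrite -!scalar_mxM dzE cancel.
Qed.

End Monad.

(* Main.v *)
Require Import Defs.
From HB Require Import structures.
From mathcomp Require Import all_boot all_order all_algebra.
From mathcomp Require Import ring zify.
From mathcomp Require Import classical_sets boolp reals complex.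

(* Write z-coefficients on the left, so that the Weyl algebra is F[z][d], and expand
   a right D-module embedded in F((1/z))[d] in powers of 1/z. It is determined by its
   polynomial part r and its 1/z-coefficient al in F[d], since
     r(m d) = r(m) d   and   r(m z) = r(m) z + al(m).
   A torsion-free module M of rank one is a right ideal meeting F[z], and after
   normalising leading coefficients in d the embedding is unique up to a scalar.
   Then r is injective, V = F[z][d] / r(M) is finite dimensional, and Y is right
   multiplication by d on V, while i is the class of 1. As V is killed by a polynomial
   in d, al extends F(d)-linearly from r(M) to F[z](d); its polynomial part h makes
   X = (right multiplication by z) + h well defined on V, its residue is a functional
   j on V, and [X, Y] = Id + i j.
   Conversely z^a d^b |-> Y^b X^a i and j Y^c X^a i recover r(M) and al from (X, Y, i, j).
   The right ideal { det(z - X) p + j adj(z - X) q(p) : p in r(M) } realises the pair,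
   and (a, b, c) |-> det(z - X) c + j adj(z - X) b identifies it with the cohomology
   of the monad. *)

(** The rank hypothesis is a universal property and the map of the theorem is defined by monads;
    neither is suited to comparing modules. Both are traded for the predicate [realizes]: the
    polynomial parts fill [ker pi] and the [1/z]-coefficient is given by [h]. The module built from
    a pair satisfies this predicate and is also the cohomology of the monad, so it is the bridge
    between the two descriptions. The polynomial part alone is no module map: its image is stable
    under [d], but [z] acts on it with a defect, which the [1/z]-coefficient records. Hence two maps
    are carried along, and [X] is multiplication by [z] only up to a correction. Left multiplication
    by elements of the skew field changes the embedding of a module; conditions on orders and
    leading coefficients in [d] remove this freedom, as the units of [F[z]] are scalars.
    Characteristic zero enters through [tr Id = n], nonzero for [n > 0]: it makes [i] a cyclic
    vector and [i j] nonzero. *)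

Set Implicit Arguments.
Unset Strict Implicit.
Unset Printing Implicit Defensive.

Import GRing.Theory.
Local Open Scope ring_scope.

(** * Normally ordered operators *)

Section PolySum.
Variables (A : nzRingType) (V : lmodType A).
Implicit Types (g : nat -> V) (p : {poly A}).

Definition poly_sum g p := \sum_(k < size p) p`_k *: g k.

Lemma poly_sum_wide g p n : (size p <= n)%N -> poly_sum g p = \sum_(k < n) p`_k *: g k.
Proof.
move=> le_pn; rewrite /poly_sum (big_ord_widen n (fun k => p`_k *: g k)) //.
rewrite big_mkcond /=; apply: eq_bigr => k _; case: ltnP => // le_pk.
by rewrite nth_default // scale0r.
Qed.

Lemma poly_sum_linear g : linear (poly_sum g).
Proof.
move=> c p q; pose n := maxn (size (c *: p + q)) (maxn (size p) (size q)).
rewrite !(@poly_sum_wide g _ n) /n ?leq_max ?leqnn ?orbT // scaler_sumr -big_split.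
by apply: eq_bigr => k _; rewrite coefD coefZ scalerDl scalerA.
Qed.

HB.instance Definition _ g :=
  GRing.isLinear.Build A {poly A} V *:%R (poly_sum g) (poly_sum_linear g).

Lemma poly_sumC g c : poly_sum g c%:P = c *: g 0%N.
Proof. by rewrite (@poly_sum_wide g _ 1) ?size_polyC_leq1 // big_ord1 coefC. Qed.

Lemma poly_sumMX g p : poly_sum g (p * 'X) = poly_sum (g \o S) p.
Proof.
rewrite (@poly_sum_wide g _ (size p).+1).
  by rewrite big_ord_recl coefMX scale0r add0r; apply: eq_bigr => k _; rewrite coefMX.
by rewrite (leq_trans (size_polyMleq _ _)) // size_polyX addn2.
Qed.

End PolySum.

Section WeylModel.
Variable F : fieldType.
Local Notation P := {poly {poly F}}.

(* Normally ordered operators: ['X] stands for [d] and the coefficients are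
   polynomials in [z]. *)
Definition weyl : Type := P.

(** Left multiplication by [d]: moving [d] to the right of a coefficient in [F[z]] costs the
    derivative of that coefficient. *)
Definition weyl_d (p : P) : P := p * 'X + map_poly (@deriv F) p.

Definition weyl_mul (p q : P) : P := poly_sum (fun k => iter k weyl_d q) p.

HB.instance Definition _ := GRing.Zmodule.copy weyl P.

Lemma map_derivD (p q : P) :
  map_poly (@deriv F) (p + q) = map_poly (@deriv F) p + map_poly (@deriv F) q.
Proof. by apply/polyP => k; rewrite !(coefD, coef_map) /= raddfD. Qed.

Lemma map_derivZ (c : {poly F}) (p : P) :
  map_poly (@deriv F) (c *: p) =
  c *: map_poly (@deriv F) p + c^`() *: p.
Proof. by apply/polyP => k; rewrite !(coefD, coefZ, coef_map) /= derivM addrC. Qed.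

Lemma map_derivMX (p : P) : map_poly (@deriv F) (p * 'X) = map_poly (@deriv F) p * 'X.
Proof. by apply/polyP => -[|k]; rewrite !(coefMX, coef_map) /= ?raddf0 // deriv0. Qed.

Lemma weyl_dD p q : weyl_d (p + q) = weyl_d p + weyl_d q.
Proof. by rewrite /weyl_d mulrDl map_derivD addrACA. Qed.

Lemma weyl_dZ c p : weyl_d (c *: p) = c *: weyl_d p + c^`() *: p.
Proof. by rewrite /weyl_d map_derivZ scalerDr addrA -scalerAl. Qed.

Lemma weyl_dMX p : weyl_d (p * 'X) = weyl_d p * 'X.
Proof. by rewrite /weyl_d map_derivMX mulrDl. Qed.

Lemma weyl_d0 : weyl_d 0 = 0.
Proof. by rewrite /weyl_d mul0r add0r; apply/polyP => k; rewrite coef_map coef0 /= deriv0. Qed.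

Lemma weyl_mul0 q : weyl_mul 0 q = 0.
Proof. exact: raddf0. Qed.

Lemma weyl_mulMX p q : weyl_mul (p * 'X) q = weyl_mul p (weyl_d q).
Proof.
rewrite /weyl_mul poly_sumMX; congr poly_sum; apply/funext => k /=.
by rewrite -iterS iterSr.
Qed.

Lemma weyl_mulC c q : weyl_mul c%:P q = c *: q.
Proof. exact: poly_sumC. Qed.

Lemma weyl_mulDl p1 p2 q : weyl_mul (p1 + p2) q = weyl_mul p1 q + weyl_mul p2 q.
Proof. exact: raddfD. Qed.

Lemma weyl_mulZl c p q : weyl_mul (c *: p) q = c *: weyl_mul p q.
Proof. exact: linearZ. Qed.

Lemma weyl_mulDr p q1 q2 : weyl_mul p (q1 + q2) = weyl_mul p q1 + weyl_mul p q2.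
Proof.
elim/poly_ind: p q1 q2 => [|p c IH] q1 q2; first by rewrite /weyl_mul !linear0 addr0.
by rewrite !(weyl_mulDl, weyl_mulMX, weyl_mulC) weyl_dD IH scalerDr addrACA.
Qed.

(** This is associativity for a first factor [d], to which induction on the first factor reduces the
    general case. *)
Lemma weyl_mul_d p q : weyl_mul (weyl_d p) q = weyl_d (weyl_mul p q).
Proof.
elim/poly_ind: p q => [|p c IH] q; first by rewrite weyl_mul0 weyl_d0 weyl_mul0.
rewrite weyl_dD weyl_dMX !weyl_mulDl !weyl_mulMX IH weyl_dD; congr (_ + _).
rewrite !weyl_mulC weyl_dZ; congr (_ + _).
by rewrite map_polyC weyl_mulC.
Qed.

Lemma weyl_mulA : associative weyl_mul.
Proof.
move=> p q r; elim/poly_ind: p q => [|p c IH] q; first by rewrite /weyl_mul !linear0.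
rewrite !weyl_mulDl !weyl_mulMX !weyl_mulC -weyl_mul_d IH; congr (_ + _).
by rewrite weyl_mulZl.
Qed.

Lemma weyl_mul1r : left_id 1 weyl_mul.
Proof. by move=> q; rewrite weyl_mulC scale1r. Qed.

Lemma weyl_mul_Xr p q : weyl_mul p (q * 'X) = weyl_mul p q * 'X.
Proof.
elim/poly_ind: p q => [|p c IH] q; first by rewrite /weyl_mul !linear0 mul0r.
by rewrite !(weyl_mulDl, weyl_mulMX, weyl_mulC) weyl_dMX IH mulrDl scalerAl.
Qed.

Lemma weyl_d_const (c : F) : weyl_d c%:P%:P = c%:P%:P * 'X.
Proof.
by rewrite /weyl_d map_polyC /= derivC addr0.
Qed.

Lemma weyl_mul_const p (c : F) : weyl_mul p c%:P%:P = c%:P *: p.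
Proof.
elim/poly_ind: p => [|p q IH]; first by rewrite /weyl_mul linear0 scaler0.
rewrite weyl_mulDl weyl_mulMX weyl_d_const weyl_mul_Xr IH weyl_mulC scalerDr scalerAl.
by congr (_ + _); rewrite -!mul_polyC mulrC.
Qed.

Lemma weyl_mulr1 : right_id 1 weyl_mul.
Proof. by move=> p; rewrite weyl_mul_const scale1r. Qed.

Lemma weyl_mul_dr p : weyl_mul p 'X = p * 'X.
Proof. by rewrite -[X in weyl_mul p X]mul1r weyl_mul_Xr weyl_mulr1. Qed.

(** Moving [z] leftwards past [d ^ k] leaves [k d ^ (k - 1)], so the correction is a derivative in
    [d], whereas [weyl_d] differentiates in [z]. *)
Lemma weyl_mul_zr p : weyl_mul p 'X%:P = 'X *: p + p^`().
Proof.
elim/poly_ind: p => [|p c IH].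
  by rewrite /weyl_mul linear0 scaler0 deriv0 addr0.
have dz : weyl_d 'X%:P = 'X%:P * 'X + 1 by rewrite /weyl_d map_polyC /= derivX.
rewrite weyl_mulDl weyl_mulMX dz weyl_mulDr weyl_mul_Xr IH weyl_mulr1 weyl_mulC.
rewrite derivD derivM derivX derivC mulr1 addr0 -!mul_polyC; ring.
Qed.

HB.instance Definition _ := GRing.Zmodule_isNzRing.Build weyl
  weyl_mulA weyl_mul1r weyl_mulr1 weyl_mulDl weyl_mulDr (oner_neq0 P).

Definition weyl_scale (c : F) (p : weyl) : weyl := c%:P *: (p : P).

Lemma weyl_scaleA a b v : weyl_scale a (weyl_scale b v) = weyl_scale (a * b) v.
Proof. by rewrite /weyl_scale scalerA polyCM. Qed.

Lemma weyl_scale1 : left_id 1 weyl_scale.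
Proof. by move=> v; rewrite /weyl_scale scale1r. Qed.

Lemma weyl_scaleDr : right_distributive weyl_scale +%R.
Proof. by move=> a u v; apply: scalerDr. Qed.

Lemma weyl_scaleDl v : {morph weyl_scale^~ v : a b / a + b}.
Proof. by move=> a b; rewrite /weyl_scale polyCD scalerDl. Qed.

HB.instance Definition _ := GRing.Zmodule_isLmodule.Build F weyl
  weyl_scaleA weyl_scale1 weyl_scaleDr weyl_scaleDl.

Lemma weyl_scaleAl (a : F) (u v : weyl) : a *: (u * v) = (a *: u) * v.
Proof. by rewrite [RHS]weyl_mulZl. Qed.

HB.instance Definition _ := GRing.Lmodule_isLalgebra.Build F weyl weyl_scaleAl.

Lemma weyl_scaleAr (a : F) (u v : weyl) : a *: (u * v) = u * (a *: v).
Proof.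
have E (w : weyl) : a *: w = w * (a%:P%:P : P) by rewrite [RHS]weyl_mul_const.
by rewrite !E mulrA.
Qed.

HB.instance Definition _ := GRing.Lalgebra_isAlgebra.Build F weyl weyl_scaleAr.

End WeylModel.

(** * Identification of [D] with the normally ordered operators *)

Section NormalOrder.
Variables (F : fieldType) (D : algType F) (z d : D).
Local Notation P := {poly {poly F}}.

(** The rest of the proof sees [D] through such a map. On symbols, right multiplication by [d] is
    the commutative product with ['X], and right multiplication by [z] has a derivative in [d] as
    its only correction. *)
Record normal_ordering (th : D -> P) : Prop := NormalOrdering {
  th_bij : bijective th;
  thD : {morph th : a b / a + b};
  thZ : forall (c : F) a, th (c *: a) = c%:P *: th a;
  th1 : th 1 = 1;
  th_zl : forall a, th (z * a) = 'X *: th a;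
  th_dr : forall a, th (a * d) = th a * 'X;
  th_zr : forall a, th (a * z) = 'X *: th a + (th a)^`()
}.

Hypothesis dz : d * z - z * d = 1.

Lemma commutator_d (c : {poly F}) :
  d * horner_alg z c = horner_alg z c * d + horner_alg z c^`().
Proof.
elim/poly_ind: c => [|c k IH]; first by rewrite deriv0 rmorph0 mulr0 mul0r addr0.
rewrite derivD derivM derivX derivC mulr1 addr0 !rmorphD !rmorphM /= !horner_algX !horner_algC.
rewrite mulrDr mulrDl mulr_algr mulr_algl addrAC; congr (_ + _).
rewrite mulrA IH mulrDl -!mulrA (_ : d * z = z * d + 1); last by rewrite -dz addrC subrK.
by rewrite mulrDr mulr1 -addrA; congr (_ + _); rewrite addrC.
Qed.

(** Evaluation of a symbol in [D]; it will be the inverse of the map given by the universal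
    property. *)
Definition normal_op (p : weyl F) : D := (map_poly (horner_alg z) (p : P)).[d].

Lemma normal_op_is_linear : linear normal_op.
Proof.
move=> c p q; rewrite /normal_op [c *: p]/(c%:P *: (p : P)).
by rewrite rmorphD /= linearZ /= hornerD hornerZ horner_algC mulr_algl.
Qed.

HB.instance Definition _ :=
  GRing.isLinear.Build F (weyl F) D *:%R normal_op normal_op_is_linear.

Lemma normal_opD (p q : P) : normal_op (p + q) = normal_op p + normal_op q.
Proof. exact: (raddfD normal_op). Qed.

Lemma normal_op0 : normal_op (0 : P) = 0.
Proof. exact: (raddf0 normal_op). Qed.

Lemma normal_opMX (p : P) : normal_op (p * 'X) = normal_op p * d.
Proof. by rewrite /normal_op rmorphM /= map_polyX hornerMX. Qed.

Lemma normal_opC (c : {poly F}) : normal_op (c%:P : P) = horner_alg z c.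
Proof. by rewrite /normal_op map_polyC hornerC. Qed.

Lemma normal_opZ (c : {poly F}) (p : P) :
  normal_op (c *: p : P) = horner_alg z c * normal_op p.
Proof. by rewrite /normal_op linearZ hornerZ. Qed.

Lemma normal_op_weyl_d (p : weyl F) : normal_op (weyl_d p) = d * normal_op p.
Proof.
elim/(@poly_ind {poly F}): p => [|p c IH]; first by rewrite weyl_d0 normal_op0 mulr0.
rewrite weyl_dD weyl_dMX !normal_opD !normal_opMX IH mulrDr mulrA; congr (_ + _).
by rewrite map_polyC !normal_opC -commutator_d.
Qed.

Lemma normal_op_is_monoid_morphism : monoid_morphism normal_op.
Proof.
split=> [|p q]; first by rewrite [LHS]normal_opC rmorph1.
elim/(@poly_ind {poly F}): p q => [|p c IH] q; first by rewrite normal_op0 !mul0r [LHS]normal_op0.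
have E : ((p * 'X : P) + c%:P : weyl F) * q = (p : weyl F) * weyl_d q + (c *: (q : P) : P).
  by rewrite [LHS]weyl_mulDl weyl_mulMX weyl_mulC.
rewrite E !normal_opD IH normal_op_weyl_d normal_opMX normal_opZ normal_opC.
by rewrite mulrDl mulrA.
Qed.

End NormalOrder.

Lemma normal_ordering_exists (F : fieldType) (D : algType F) (z d : D) :
  is_weyl_algebra z d -> exists th, normal_ordering z d th.
Proof.
case=> dz univ; have := univ (weyl F) ('X%:P : {poly {poly F}}) ('X : {poly {poly F}}).
case=> [|f [fz fd _]].
  have -> : ('X : weyl F) * ('X%:P : weyl F) = 'X * 'X%:P + 1.
    by rewrite [LHS]weyl_mul_zr derivX; congr (_ + _); rewrite -mul_polyC mulrC.
  have -> : ('X%:P : weyl F) * ('X : weyl F) = 'X * 'X%:P.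
    by rewrite [LHS]weyl_mul_dr mulrC.
  by rewrite addrC addKr.
have [h [_ _ h_uniq]] := univ D z d dz.
pose s : {lrmorphism weyl F -> D} := HB.pack (normal_op z d)
  (GRing.isLinear.Build F (weyl F) D *:%R _ (@normal_op_is_linear _ _ z d))
  (GRing.isMonoidMorphism.Build (weyl F) D _ (normal_op_is_monoid_morphism dz)).
(* Both [s \o f] and the identity fix [z] and [d], so uniqueness in the universal property of [D]
   identifies them. *)
have sf : cancel f s.
  move=> a; rewrite -[RHS]/(idfun a).
  have -> : s (f a) = h a.
    apply: (h_uniq (s \o f)) => /=.
      by rewrite fz [LHS]normal_opC horner_algX.
    rewrite fd; have := @normal_opMX F D z d 1; rewrite mul1r => ->.
    by rewrite -polyC1 normal_opC rmorph1 mul1r.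
  by symmetry; apply: (h_uniq idfun).
have fD : {morph f : a b / a + b} by exact: raddfD.
have fM : {morph f : a b / a * b} by exact: rmorphM.
have fC c : f (horner_alg z c) = (c%:P : {poly {poly F}}).
  elim/poly_ind: c => [|c k IH]; first by rewrite !raddf0.
  have -> : horner_alg z (c * 'X + k%:P) = horner_alg z c * z + k%:A.
    by rewrite rmorphD rmorphM /= horner_algX horner_algC.
  rewrite fD fM IH fz linearZ rmorph1 [_ * _]weyl_mulC scale_polyC.
  rewrite polyCD; congr (_ + _).
  by rewrite [LHS](_ : _ = k%:P *: (1 : {poly {poly F}})) // -mul_polyC mulr1.
have fs : cancel s f.
  move=> p; elim/(@poly_ind {poly F}): p => [|p c IH]; first by rewrite !raddf0.
  rewrite [s _]normal_opD normal_opMX normal_opC fD fM fC fd.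
  by rewrite -[normal_op z d p]/(s p) IH [_ * _]weyl_mul_dr.
exists f; split.
- by exists s.
- exact: fD.
- by move=> c a; rewrite linearZ.
- exact: (rmorph1 f).
- by move=> a; rewrite fM fz [LHS]weyl_mulC.
- by move=> a; rewrite fM fd [LHS]weyl_mul_dr.
- by move=> a; rewrite fM fz [LHS]weyl_mul_zr.
Qed.

Notation "m ** a" := (GRing.scale (a : _^c) m) (at level 40, left associativity).

Lemma size_poly_pred (A : nzRingType) (p : {poly A}) n :
  (size p <= n.+1)%N -> p`_n = 0 -> (size p <= n)%N.
Proof.
move=> le_pn pn0; apply/leq_sizeP => k; rewrite leq_eqVlt => /orP[/eqP<- //|lt_nk].
by rewrite nth_default // (leq_trans le_pn).
Qed.

Lemma size_MXaddC_pred (A : nzRingType) (p : {poly A}) c n :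
  (size (p * 'X + c%:P)%R <= n.+1)%N -> (size p <= n)%N.
Proof. by rewrite size_MXaddC; case: ifP => // /andP[/eqP-> _]; rewrite size_poly0. Qed.

Section RightAction.
Variables (D : nzRingType) (M : lmodType D^c).
Implicit Types (a b : D) (m : M).

Lemma actM m a b : m ** (a * b) = m ** a ** b.
Proof. by rewrite scalerA. Qed.

Lemma actD m a b : m ** (a + b) = m ** a + m ** b.
Proof. exact: scalerDl. Qed.

Lemma act1 m : m ** (1 : D) = m.
Proof. exact: scale1r. Qed.

Lemma act0 m : m ** (0 : D) = 0.
Proof. exact: scale0r. Qed.

End RightAction.

(** * Polynomial parts of right modules *)

Section Framing.
Variables (F : fieldType) (D : algType F) (z d : D).
Local Notation P := {poly {poly F}}.
Variable th : D -> P.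
Hypothesis ord : normal_ordering z d th.
Local Notation zp := (horner_alg z).

Let thD := thD ord.

Lemma th0 : th 0 = 0.
Proof. by apply: (addrI (th 0)); rewrite -thD !addr0. Qed.

Lemma thN a : th (- a) = - th a.
Proof. by apply: (addrI (th a)); rewrite -thD !subrr th0. Qed.

Lemma th_inj : injective th.
Proof. exact: bij_inj (th_bij ord). Qed.

Lemma th_eq0 a : th a = 0 -> a = 0.
Proof. by rewrite -th0 => /th_inj. Qed.

Lemma zpMX c k : zp (c * 'X + k%:P) = zp c * z + k%:A.
Proof. by rewrite rmorphD rmorphM /= horner_algX horner_algC. Qed.

Lemma zpMXl c k : zp (c * 'X + k%:P) = z * zp c + k%:A.
Proof. by rewrite mulrC rmorphD rmorphM /= horner_algX horner_algC. Qed.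

Lemma th_zpl c a : th (zp c * a) = c *: th a.
Proof.
elim/poly_ind: c => [|c k IH]; first by rewrite rmorph0 mul0r th0 scale0r.
rewrite zpMXl mulrDl thD -mulrA (th_zl ord) IH mulr_algl (thZ ord).
by rewrite scalerA -scalerDl mulrC.
Qed.

Lemma th_zp c : th (zp c) = c%:P.
Proof. by rewrite -[zp c]mulr1 th_zpl (th1 ord) alg_polyC. Qed.

Lemma zp_inj c : zp c = 0 -> c = 0.
Proof. by move=> c0; apply: polyC_inj; rewrite -th_zp c0 th0. Qed.

Lemma th_dXr a n : th (a * d ^+ n) = th a * 'X^n.
Proof.
elim: n => [|n IH]; first by rewrite !expr0 !mulr1.
by rewrite !exprSr !mulrA (th_dr ord) IH.
Qed.

Lemma th_dpr a (g : {poly F}) : th (a * horner_alg d g) = th a * g^:P.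
Proof.
elim/poly_ind: g a => [|g k IH] a; first by rewrite !rmorph0 !mulr0 th0.
rewrite !rmorphD !rmorphM /= horner_algX horner_algC map_polyX map_polyC /=.
by rewrite !mulrDr thD !mulrA (th_dr ord) IH mulr_algr (thZ ord) [_ * k%:P%:P]mulrC mul_polyC.
Qed.

Lemma normal_form_ind (K : D -> Prop) :
  K 0 -> (forall a c, K a -> K (a * d + zp c)) -> forall a, K a.
Proof.
move=> K0 KS a; have [p Ep] : exists p, th a = p by exists (th a).
elim/poly_ind: p a Ep => [|p c IH] a Ep; first by rewrite (th_eq0 Ep).
have [h th_h h_th] := th_bij ord.
have -> : a = h p * d + zp c.
  by apply: th_inj; rewrite thD (th_dr ord) h_th th_zp.
apply: KS; exact: IH.
Qed.

(** Statements about right multiplication by an arbitrary element are reduced to scalars, [z] and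
    [d] in this way. *)
Lemma generators_ind (K : D -> Prop) :
  (forall k : F, K k%:A) -> (forall a b, K a -> K b -> K (a + b)) ->
  (forall a, K a -> K (a * z)) -> (forall a, K a -> K (a * d)) -> forall a, K a.
Proof.
move=> Kc KD Kz Kd; have K0 : K 0 by rewrite -(scale0r 1).
apply: normal_form_ind => // a c Ka; apply: (KD); first exact: Kd.
elim/poly_ind: c => [|c k IH]; first by rewrite rmorph0.
by rewrite zpMX; apply: KD; [apply: Kz|].
Qed.

(* [r] is the polynomial part of a right [D]-linear map to [F((1/z))[d]], and
   [al] is its coefficient of [1/z], which lies in [F[d]]. *)
Record framed (M : lmodType D^c) (r : M -> P) (al : M -> {poly F}) : Prop := Framed {
  frD : {morph r : x y / x + y};
  frZ : forall (c : F) m, r (m ** c%:A) = c%:P *: r m;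
  fr_d : forall m, r (m ** d) = r m * 'X;
  fr_z : forall m, r (m ** z) = 'X *: r m + (r m)^`() + (al m)^:P
}.

Section Framed.
Variables (M : lmodType D^c) (r : M -> P) (al : M -> {poly F}).
Hypothesis fr : framed r al.
Let rD := frD fr.

Lemma fr0 : r 0 = 0.
Proof. by apply: (addrI (r 0)); rewrite -rD !addr0. Qed.

Lemma frN m : r (- m) = - r m.
Proof. by apply: (addrI (r m)); rewrite -rD !subrr fr0. Qed.

Lemma frB m n : r (m - n) = r m - r n.
Proof. by rewrite rD frN. Qed.

Lemma fr_dX m n : r (m ** d ^+ n) = r m * 'X^n.
Proof.
elim: n => [|n IH]; first by rewrite !expr0 act1 mulr1.
by rewrite !exprSr actM (fr_d fr) IH mulrA.
Qed.

Lemma fr_dp m (g : {poly F}) : r (m ** horner_alg d g) = r m * g^:P.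
Proof.
elim/poly_ind: g m => [|g k IH] m; first by rewrite !rmorph0 mulr0 act0 fr0.
rewrite !rmorphD !rmorphM /= horner_algX horner_algC map_polyX map_polyC /=.
by rewrite actD mulrDr rD actM (fr_d fr) IH mulrA (frZ fr) [_ * k%:P%:P]mulrC mul_polyC.
Qed.

(** Degrees in [z]: neither the derivative in [d] nor the term [al], constant in [z], raises them,
    so only the leading term of [f] reaches the top coefficient. *)
Lemma fr_zcoef k N (f : {poly F}) m :
  (forall b, (size (r m)`_b)%R <= k.+1)%N -> (size f <= N.+1)%N ->
  (forall b, (size (r (m ** zp f))`_b)%R <= (k + N).+1)%N /\
  (forall b, (r (m ** zp f))`_b`_(k + N) = f`_N * (r m)`_b`_k).
Proof.
move=> szm; elim/poly_ind: f N => [|f c IH] N szf.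
  rewrite rmorph0 act0 fr0; split=> b; first by rewrite coef0 size_poly0.
  by rewrite !coef0 mul0r.
have E b : (r (m ** zp (f * 'X + c%:P)))`_b = 'X * (r (m ** zp f))`_b +
    (r (m ** zp f))`_b.+1 *+ b.+1 + ((al (m ** zp f))`_b)%:P + c%:P * (r m)`_b.
  rewrite zpMX actD rD actM (frZ fr) (fr_z fr) !coefD !coefZ coef_deriv.
  by rewrite coef_map.
case: N szf => [|N] szf.
  have f0 : f = 0 by apply/eqP; rewrite -size_poly_leq0 (size_MXaddC_pred szf).
  rewrite f0 mul0r add0r horner_algC; split=> b; rewrite (frZ fr) coefZ.
    rewrite addn0 mul_polyC (leq_trans (size_scale_leq _ _)) //.
  by rewrite coefC eqxx addn0 mul_polyC coefZ.
have [sz co] := IH N (size_MXaddC_pred szf); rewrite addnS; split=> b; rewrite E; 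
  have szb := szm b; have sz1 := sz b.+1; have sz0 := sz b;
  have cob := co b; move: szb sz1 sz0 cob;
  set w := (r m)`_b; set y := _`_b.+1; set x := (r _)`_b => szb sz1 sz0 cob.
  apply/leq_sizeP => i lt_i; rewrite !coefD coefXM coefMn mul_polyC coefZ coefC.
  case: i lt_i => // i lt_i; rewrite /= addr0.
  by rewrite !nth_default ?mul0rn ?mulr0 ?addr0 //
    ?(leq_trans szb) ?(leq_trans sz1) ?(leq_trans sz0) //; lia.
rewrite !coefD coefXM coefMn mul_polyC coefZ !coefC coefMX /= addr0 cob addr0.
rewrite [X in X *+ _]nth_default //.
by rewrite [X in c * X]nth_default ?mul0rn ?mulr0 ?addr0 // (leq_trans szb) //; lia.
Qed.

Hypothesis al_lt : forall m, (size (al m) <= (size (r m)).-1)%N.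

(** By [al_lt] the [1/z]-coefficient has smaller order in [d] than the polynomial part. It therefore
    cannot disturb the top coefficient in [d], which [f(z)] simply multiplies. *)
Lemma fr_zp_coef S (f : {poly F}) m : (size (r m) <= S.+1)%N ->
  (size (r (m ** zp f)) <= S.+1)%N /\ (r (m ** zp f))`_S = f * (r m)`_S.
Proof.
move=> szm; elim/poly_ind: f => [|f c [sz co]].
  by rewrite rmorph0 act0 fr0 size_poly0 coef0 mul0r.
rewrite zpMX actD rD actM (frZ fr) (fr_z fr); set x := r (m ** zp f) in sz co *.
have sza : (size (al (m ** zp f)) <= S)%N.
  by apply: leq_trans (al_lt _) _; rewrite -ltnS (leq_trans _ (ltnSn S)) // -/x; lia.
split; first apply/leq_sizeP => i lt_i.
  rewrite !(coefD, coefZ, coef_deriv, coef_map) /=.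
  by rewrite !nth_default ?mulr0 ?mul0rn ?addr0 //
    ?(leq_trans szm) ?(leq_trans sz) ?(leq_trans sza) //; lia.
rewrite !(coefD, coefZ, coef_deriv, coef_map) /= co.
rewrite [X in X *+ _]nth_default // [X in _ + X%:P + _]nth_default // mul0rn !addr0.
by rewrite mulrDl [_ * 'X]mulrC !mulrA.
Qed.

(** Top terms in [d] multiply as commutative polynomials. [S] and [T] are only upper bounds for the
    orders, so that vanishing coefficients are covered. *)
Lemma fr_coef S T a m : (size (r m) <= S.+1)%N -> (size (th a) <= T.+1)%N ->
  (size (r (m ** a)) <= (S + T).+1)%N /\
  (r (m ** a))`_(S + T) = (th a)`_T * (r m)`_S.
Proof.
move=> szm; elim/normal_form_ind: a T => [|a c IH] T.
  by rewrite act0 fr0 th0 size_poly0 !coef0 mul0r.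
rewrite thD (th_dr ord) th_zp actD actM rD (fr_d fr) => sza.
have [szc coc] := fr_zp_coef c szm.
case: T sza => [|T] sza.
  have /th_eq0 -> : th a = 0 by apply/eqP; rewrite -size_poly_leq0 (size_MXaddC_pred sza).
  by rewrite act0 fr0 th0 !mul0r !add0r addn0 coefC eqxx.
have [sz co] := IH T (size_MXaddC_pred sza); rewrite addnS; split.
  rewrite (leq_trans (size_polyD _ _)) // geq_max (leq_trans (size_polyMleq _ _)).
    by rewrite (leq_trans szc) // ltnS; lia.
  by rewrite size_polyX addn2 /= ltnS.
rewrite !coefD !coefMX /= co coefC addr0 [X in _ + X]nth_default ?addr0 //.
by rewrite (leq_trans szc) //; lia.
Qed.

Lemma fr_size_act a m : r m != 0 -> a != 0 ->
  size (r (m ** a)) = (size (r m) + (size (th a)).-1)%N /\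
  lead_coef (r (m ** a)) = lead_coef (th a) * lead_coef (r m).
Proof.
move=> m0 a0; have ta0 : th a != 0 by apply: contra_neq a0 => /th_eq0.
have szm : (0 < size (r m))%N by rewrite size_poly_gt0.
have sza : (0 < size (th a))%N by rewrite size_poly_gt0.
have [||sz co] := @fr_coef (size (r m)).-1 (size (th a)).-1 a m; rewrite ?prednK //.
have nz : (r (m ** a))`_((size (r m)).-1 + (size (th a)).-1) != 0.
  by rewrite co mulf_neq0 // -/(lead_coef _) lead_coef_eq0.
have szE : size (r (m ** a)) = ((size (r m)).-1 + (size (th a)).-1).+1.
  by apply/eqP; rewrite eqn_leq sz ltnNge; apply: contra_neqN nz => /(nth_default 0).
by rewrite /lead_coef szE -co; split=> //; rewrite -addSn prednK.
Qed.

Hypothesis r_inj : forall m, r m = 0 -> m = 0.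

(** Pseudo-division by [m0] on the order in [d], with right factors in [F[z]] to match leading
    coefficients. As [m0] has minimal order, a nonzero remainder can always be divided again, so the
    process ends at zero. *)
Lemma fr_common_multiple m0 : m0 != 0 ->
  (forall m, m != 0 -> (size (r m0) <= size (r m))%N) ->
  forall m, exists f b, f != 0 /\ m ** zp f = m0 ** b.
Proof.
move=> m0n m0_min m; pose l0 := lead_coef (r m0); set k0 := size (r m0) in m0_min.
have r0 : r m0 != 0 by apply: contra_neq m0n => /r_inj.
have k0_gt0 : (0 < k0)%N by rewrite size_poly_gt0.
have l00 : l0 != 0 by rewrite lead_coef_eq0.
have [n le_n] := ubnP (size (r m)); elim: n m le_n => // n IH m le_n.
have [->|mn0] := eqVneq m 0.
  by exists 1, 0; rewrite oner_neq0 act0 scaler0.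
have szm := m0_min m mn0.
pose l := lead_coef (r m); pose S := (size (r m)).-1; pose T := (S - k0.-1)%N.
have [sz1 co1] : (size (r (m ** zp l0)) <= S.+1)%N /\ (r (m ** zp l0))`_S = l0 * l.
  by apply: fr_zp_coef; rewrite /S; lia.
have [||sz2 co2] := @fr_coef k0.-1 T (zp l * d ^+ T) m0.
- by rewrite prednK.
- by rewrite th_dXr th_zp mul_polyC (leq_trans (size_scale_leq _ _)) // size_polyXn.
have ST : (k0.-1 + T = S)%N by rewrite /T /S; lia.
rewrite ST in sz2 co2.
(* Both terms have coefficient [l0 * l] in order [S], so the difference has smaller order. *)
have [|f [b [f0 E]]] := IH (m ** zp l0 - m0 ** (zp l * d ^+ T)).
  apply: (@leq_ltn_trans S); last by rewrite /S; lia.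
  apply: size_poly_pred; rewrite frB.
    by rewrite (leq_trans (size_polyD _ _)) // size_polyN geq_max sz1.
  rewrite coefB co1 co2 th_dXr th_zp mul_polyC coefZ coefXn eqxx mulr1 /l0 /lead_coef.
  by rewrite mulrC subrr.
exists (l0 * f), (b + zp l * d ^+ T * zp f); rewrite mulf_neq0 //; split=> //.
by rewrite rmorphM /= actM actD -E scalerBr (actM m0 (_ * _)) subrK.
Qed.

End Framed.

Lemma framed_regular : framed (M := (D^c)^o) th (fun=> 0).
Proof.
split=> [||a|a]; first exact: thD.
- by move=> c a; rewrite -[a ** c%:A]/((a : D) * c%:A) mulr_algr (thZ ord).
- exact: (th_dr ord).
- by rewrite -[a ** z]/((a : D) * z) (th_zr ord) rmorph0 addr0.
Qed.

Lemma th_mul a b : a != 0 -> b != 0 ->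
  size (th (a * b)) = (size (th a) + (size (th b)).-1)%N /\
  lead_coef (th (a * b)) = lead_coef (th b) * lead_coef (th a).
Proof.
move=> a0 b0; apply: (fr_size_act framed_regular) => //= [m|]; first by rewrite size_poly0.
by apply: contra_neq a0 => /th_eq0.
Qed.

Lemma weyl_domain (a b : D) : a * b = 0 -> a = 0 \/ b = 0.
Proof.
move=> ab0; have [->|a0] := eqVneq a 0; first by left.
have [->|b0] := eqVneq b 0; first by right.
have [_ /esym/eqP] := th_mul a0 b0; rewrite ab0 th0 lead_coef0 mulf_eq0 !lead_coef_eq0.
by case/orP=> /eqP/th_eq0; [right | left].
Qed.

End Framing.

(** * Normalised framings and their uniqueness up to a scalar *)

Section FramingUnique.
Variables (F : fieldType) (D : algType F) (z d : D).
Local Notation P := {poly {poly F}}.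
Variable th : D -> P.
Hypothesis ord : normal_ordering z d th.
Local Notation zp := (horner_alg z).

(* The last two conditions normalise the embedding into [F((1/z))[d]]: the
   leading coefficients in [d] form a nonzero ideal of [F[z]] in order zero and
   all of [F[z]] in some order. *)
Record framing (M : lmodType D^c) (r : M -> P) (al : M -> {poly F}) : Prop := Framing {
  fg_framed : framed z d r al;
  fg_size : forall m, (size (al m) <= (size (r m)).-1)%N;
  fg_inj : forall m, r m = 0 -> m = 0;
  fg_const : exists m, size (r m) = 1%N;
  fg_top : exists n, forall c, exists m, (size (r m) <= n.+1)%N /\ (r m)`_n = c
}.

Section Framing.
Variables (M : lmodType D^c) (r : M -> P) (al : M -> {poly F}).
Hypothesis fr : framing r al.

Lemma fg_neq0 m : m != 0 -> r m != 0.
Proof. by apply: contra_neq => /(fg_inj fr). Qed.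

Lemma fg_common m0 : size (r m0) = 1%N -> forall m, exists f b, f != 0 /\ m ** zp f = m0 ** b.
Proof.
move=> sz0; apply: (fr_common_multiple ord (fg_framed fr) (fg_size fr) (@fg_inj _ _ _ fr)).
  by apply: contra_eq_neq sz0 => ->; rewrite (fr0 (fg_framed fr)) size_poly0.
by move=> m /fg_neq0; rewrite sz0 size_poly_gt0.
Qed.

Lemma fg_act m a : m != 0 -> a != 0 ->
  size (r (m ** a)) = (size (r m) + (size (th a)).-1)%N /\
  lead_coef (r (m ** a)) = lead_coef (th a) * lead_coef (r m).
Proof.
by move=> m0 a0; apply: (fr_size_act ord (fg_framed fr) (fg_size fr) (fg_neq0 m0) a0).
Qed.

End Framing.

(** In [m ** zp f = m0 ** b] the order and leading coefficient of [b] do not depend on the framing;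
    eliminating them compares the two framings. A size exceeds the order by one, hence the
    successor. *)
Lemma framing_sizes (M : lmodType D^c) r r' al al' m0 (m : M) : framing r al -> framing r' al' ->
  size (r m0) = 1%N -> m != 0 ->
  (size (r' m)).+1 = (size (r' m0) + size (r m))%N /\
  lead_coef (r m) * lead_coef (r' m0) = lead_coef (r' m) * lead_coef (r m0).
Proof.
move=> fr fr' sz0 mn0.
have m0n : m0 != 0.
  by apply: contra_eq_neq sz0 => ->; rewrite (fr0 (fg_framed fr)) size_poly0.
have [f [b [f0 E]]] := fg_common fr sz0 m.
have zf0 : zp f != 0 by apply: contra_neq f0 => /(zp_inj ord).
have szf : size (th (zp f)) = 1%N by rewrite (th_zp ord) size_polyC f0.
have lcf : lead_coef (th (zp f)) = f by rewrite (th_zp ord) lead_coefC.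
have b0 : b != 0.
  apply/eqP => b0; have [] := fg_act fr mn0 zf0.
  rewrite E b0 act0 (fr0 (fg_framed fr)) szf size_poly0 addn0 => /esym/eqP.
  by rewrite size_poly_eq0 (negPf (fg_neq0 fr mn0)).
have [s1 l1] := fg_act fr mn0 zf0; have [s2 l2] := fg_act fr m0n b0.
have [s3 l3] := fg_act fr' mn0 zf0; have [s4 l4] := fg_act fr' m0n b0.
rewrite szf /= addn0 in s1; rewrite szf /= addn0 in s3; rewrite -E s1 in s2; rewrite -E s3 in s4.
rewrite lcf in l1 l3; rewrite -E l1 in l2; rewrite -E l3 in l4.
split; first by rewrite s2 s4 sz0 add1n -addnS.
apply: (mulfI f0); rewrite !mulrA l2 l4; ring.
Qed.

(** An element with leading coefficient 1 in the first framing turns the proportionality of leading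
    coefficients into divisibility. *)
Lemma framing_top (M : lmodType D^c) r r' al al' : framing (M := M) r al -> framing r' al' ->
  forall m0, size (r m0) = 1%N -> exists u, lead_coef (r' m0) = u * lead_coef (r m0).
Proof.
move=> fr fr' m0 sz0; have [n /(_ 1)[m [sz lc]]] := fg_top fr.
have szm : size (r m) = n.+1.
  by apply/eqP; rewrite eqn_leq sz ltnNge; apply/negP => /(nth_default 0)/eqP; rewrite lc oner_eq0.
have mn0 : m != 0.
  by apply: contra_eq_neq szm => ->; rewrite (fr0 (fg_framed fr)) size_poly0.
have [_] := framing_sizes fr fr' sz0 mn0.
by rewrite {1}/lead_coef szm lc mul1r => ->; exists (lead_coef (r' m)).
Qed.

(* Comparing [m f(z) = m0 b] in the two framings gives equal orders and
   proportional leading coefficients. The difference [dl] of the rescaled framings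
   then kills [m0 D], and right multiplication by [f(z)] cannot lower its degree in
   [z], so it vanishes. *)
Lemma framing_unique (M : lmodType D^c) r r' al al' : framing (M := M) r al -> framing r' al' ->
  exists2 l : F, l != 0 & forall m, r' m = l%:P *: r m.
Proof.
move=> fr fr'; have frf := fg_framed fr; have frf' := fg_framed fr'.
have [m0 sz0] := fg_const fr; have [m1 sz1] := fg_const fr'.
have m0n : m0 != 0 by apply: contra_eq_neq sz0 => ->; rewrite (fr0 frf) size_poly0.
have m1n : m1 != 0 by apply: contra_eq_neq sz1 => ->; rewrite (fr0 frf') size_poly0.
(* Two positive sizes with sum 2 are both 1. *)
have sz0' : size (r' m0) = 1%N.
  have [+ _] := framing_sizes fr fr' sz0 m1n; rewrite sz1.
  have := fg_neq0 fr m1n; have := fg_neq0 fr' m0n; rewrite -!size_poly_gt0.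
  by move: (size (r' m0)) (size (r m1)); lia.
have szE m : m != 0 -> size (r' m) = size (r m).
  by move=> mn; have [+ _] := framing_sizes fr fr' sz0 mn; rewrite sz0' => -[].
have [u uE] := framing_top fr fr' sz0; have [v vE] := framing_top fr' fr sz0'.
have l0 : lead_coef (r m0) != 0 by rewrite lead_coef_eq0 (fg_neq0 fr).
have uv : u * v = 1 by apply: (mulIf l0); rewrite mul1r {2}vE uE; ring.
(* Divisibility holds both ways, so [u] is a unit of [F[z]], hence a scalar. *)
have /size_poly1P[l ln0 lE] : size u == 1%N.
  have un : u != 0 by apply: contra_eq_neq uv => ->; rewrite mul0r eq_sym oner_eq0.
  have vn : v != 0 by apply: contra_eq_neq uv => ->; rewrite mulr0 eq_sym oner_eq0.
  have := size_mul un vn; rewrite uv size_poly1; rewrite -size_poly_gt0 in un.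
  by rewrite -size_poly_gt0 in vn; move: (size u) (size v) un vn; lia.
have lcE m : lead_coef (r' m) = l%:P * lead_coef (r m).
  have [->|mn] := eqVneq m 0; first by rewrite (fr0 frf) (fr0 frf') !lead_coef0 mulr0.
  have [_] := framing_sizes fr fr' sz0 mn; rewrite uE lE => E.
  by apply: (mulIf l0); rewrite -E; ring.
exists l => // m; pose dl m := r' m - l%:P *: r m.
pose be m := al' m - l *: al m.
have frd : framed z d dl be.
  rewrite /dl /be; split=> [a b|c a|a|a].
  - by rewrite (frD frf) (frD frf') scalerDr opprD addrACA.
  - by rewrite (frZ frf) (frZ frf') -!mul_polyC; ring.
  - by rewrite (fr_d frf) (fr_d frf') mulrBl scalerAl.
  - rewrite (fr_z frf) (fr_z frf') rmorphB /= derivB derivZ map_polyZ /= -!mul_polyC; ring.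
have dl_lt a : a != 0 -> (size (dl a) < size (r a))%N.
  move=> an; have := fg_neq0 fr an; rewrite -size_poly_gt0 => sza.
  rewrite -(prednK sza) ltnS; apply: size_poly_pred.
    rewrite prednK // (leq_trans (size_polyD _ _)) // geq_max size_polyN szE // leqnn.
    by rewrite (leq_trans (size_scale_leq _ _)).
  rewrite coefB coefZ -[(r a)`__]/(lead_coef _) -lcE /lead_coef szE //.
  by rewrite subrr.
(* [m0 ** zp c] has order zero in [r], and [dl] strictly lowers the order. *)
have dl0 b : dl (m0 ** b) = 0.
  elim/(normal_form_ind ord): b => [|b c IH]; first by rewrite act0 (fr0 frd).
  rewrite actD actM (frD frd) (fr_d frd) IH mul0r add0r.
  have [->|an] := eqVneq (m0 ** zp c) 0; first by rewrite (fr0 frd).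
  have [sz _] : (size (r (m0 ** zp c)) <= 1)%N /\ (r (m0 ** zp c))`_0 = c * (r m0)`_0.
    by apply: (fr_zp_coef frf (fg_size fr)); rewrite sz0.
  by apply/eqP; rewrite -size_poly_leq0 -ltnS (leq_trans (dl_lt _ an)).
apply/eqP; rewrite -subr_eq0 -[_ - _]/(dl m); apply/negPn/negP => dln.
have [f [b [f0 E]]] := fg_common fr sz0 m.
have szY : (0 < sizeY (dl m))%N by rewrite lt0n sizeY_eq0.
have [||_ co] := @fr_zcoef _ _ _ _ _ _ _ frd (sizeY (dl m)).-1 (size f).-1 f m.
- by move=> k; rewrite prednK // max_size_coefXY.
- by rewrite prednK // size_poly_gt0.
suff : (sizeY (dl m) <= (sizeY (dl m)).-1)%N by lia.
apply/bigmax_leqP => k _; apply: size_poly_pred; first by rewrite prednK // max_size_coefXY.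
have := co k; rewrite E dl0 !coef0 => /esym/eqP; rewrite mulf_eq0 -[f`__]/(lead_coef f).
by rewrite lead_coef_eq0 (negPf f0) => /eqP.
Qed.

End FramingUnique.

(** * Rank one modules as right ideals *)

Section Rank.
Variables (D : nzRingType) (K : unitRingType) (iota : {rmorphism D -> K}).
Hypothesis frac : is_skew_field_of_fractions iota.

Lemma frac_unit (a : D) : a != 0 -> iota a \is a GRing.unit.
Proof.
case: frac => unitK inj _ a0; apply: unitK; apply: contra_neq a0 => ia0.
by apply: inj; rewrite rmorph0.
Qed.

Lemma frac_inj : injective iota.
Proof. by case: frac. Qed.

Lemma frac_mulf_neq0 (a b : D) : a != 0 -> b != 0 -> a * b != 0.
Proof.
move=> /frac_unit ua /frac_unit ub; apply/eqP => ab0.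
have : iota a * iota b = 0 by rewrite -rmorphM ab0 rmorph0.
by move/(canRL (mulKr ua)); rewrite mulr0 => b0; move: ub; rewrite b0 unitr0.
Qed.

(** The relation is obtained by writing [(iota b)^-1 * iota a] as a right fraction and clearing
    denominators. *)
Lemma right_ore (a b : D) : b != 0 -> exists s c, s != 0 /\ a * s = b * c.
Proof.
move=> /frac_unit ub; have [_ inj /(_ ((iota b)^-1 * iota a))[c [s [s0 E]]]] := frac.
exists s, c; split=> //; apply: inj; rewrite !rmorphM.
by apply: (canRL (mulVKr ub)); rewrite mulrA E mulrVK ?frac_unit.
Qed.

Section Family.
Variables (M : lmodType D^c) (r : nat) (g : 'I_r -> M).

Definition comb (b : 'I_r -> D) : M := \sum_i g i ** b i.

Lemma comb_act b (s : D) : comb b ** s = comb (fun i => b i * s).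
Proof. by rewrite /comb scaler_sumr; apply: eq_bigr => i _; rewrite actM. Qed.

Lemma combD b c : comb (fun i => b i + c i) = comb b + comb c.
Proof. by rewrite /comb -big_split; apply: eq_bigr => i _; rewrite actD. Qed.

Lemma combN b : comb (fun i => - b i) = - comb b.
Proof. by rewrite /comb -sumrN; apply: eq_bigr => i _; rewrite [LHS]scaleNr. Qed.

(** Membership in the [K]-span of the family, expressed inside [M] by means of a denominator. *)
Definition generically_spanned (m : M) := exists (s : D) b, s != 0 /\ m ** s = comb b.

Lemma gspanD m n : generically_spanned m -> generically_spanned n ->
  generically_spanned (m + n).
Proof.
move=> [s [b [s0 E]]] [t [c [t0 E']]]; have [u [v [u0 Euv]]] := right_ore s t0.
exists (s * u), (fun i => b i * u + c i * v); split; first exact: frac_mulf_neq0.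
have Em : m ** (s * u) = comb (fun i => b i * u) by rewrite actM E comb_act.
have En : n ** (s * u) = comb (fun i => c i * v) by rewrite Euv actM E' comb_act.
by rewrite scalerDr combD Em En.
Qed.

Lemma gspan_act m (a : D) : generically_spanned m -> generically_spanned (m ** a).
Proof.
move=> [s [b [s0 E]]]; have [u [v [u0 Euv]]] := right_ore a s0.
by exists u, (fun i => b i * v); split=> //; rewrite -actM Euv actM E comb_act.
Qed.

Lemma gspan0 : generically_spanned 0.
Proof.
exists 1, (fun=> 0); split; first exact: oner_neq0.
by rewrite scaler0 /comb big1 // => i _; rewrite act0.
Qed.

Hypothesis indep : forall b, comb b = 0 -> forall i, b i = 0.
Hypothesis gspan : forall m, generically_spanned m.

Definition coordinates (m : M) (v : 'rV[K^c]_r) := exists (s : D) b,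
  [/\ s != 0, m ** s = comb b & forall i, v 0 i = iota (b i) / iota s].

Lemma coordinates_ex m : exists v, coordinates m v.
Proof.
have [s [b [s0 E]]] := gspan m.
by exists (\row_i (iota (b i) / iota s : K^c)), s, b; split=> // i; rewrite mxE.
Qed.

(** Two denominators have a common right multiple by the Ore condition, and independence then forces
    the numerators to agree. *)
Lemma coordinatesP m v (s : D) b : coordinates m v -> s != 0 -> m ** s = comb b ->
  forall i, v 0 i = iota (b i) / iota s.
Proof.
move=> [t [c [t0 Et vE]]] s0 Es i; rewrite vE.
have [u [w [u0 E]]] := right_ore t s0.
have w0 : w != 0.
  apply/eqP => w0; have := frac_mulf_neq0 t0 u0; by rewrite E w0 mulr0 eqxx.
have cb : c i * u = b i * w.
  apply/eqP; rewrite -subr_eq0; apply/eqP.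
  have /indep/(_ i) : comb (fun i => c i * u - b i * w) = 0.
    by rewrite combD combN -!comb_act -Et -Es -!actM E subrr.
  by [].
have cancel a e f : e != 0 -> f != 0 -> iota a / iota e = iota (a * f) / iota (e * f).
  by move=> e0 f0; rewrite !rmorphM invrM ?frac_unit // mulrA mulrK ?frac_unit.
by rewrite (cancel _ _ u) // (cancel (b i) _ w) // cb E.
Qed.

Definition coord (m : M) : 'rV[K^c]_r := sval (cid (coordinates_ex m)).

Lemma coordE m (s : D) b : s != 0 -> m ** s = comb b ->
  forall i, coord m 0 i = iota (b i) / iota s.
Proof. exact: coordinatesP (svalP (cid (coordinates_ex m))). Qed.

Lemma coord_linear_along : linear_along iota coord.
Proof.
split=> [m n|a m].
  have [s [b [s0 E]]] := gspan m; have [t [c [t0 E']]] := gspan n.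
  have [u [v [u0 Euv]]] := right_ore s t0; have su0 := frac_mulf_neq0 s0 u0.
  have Em : m ** (s * u) = comb (fun i => b i * u) by rewrite actM E comb_act.
  have En : n ** (s * u) = comb (fun i => c i * v) by rewrite Euv actM E' comb_act.
  apply/rowP => i; rewrite mxE (coordE su0 Em) (coordE su0 En).
  rewrite (@coordE (m + n) (s * u) (fun i => b i * u + c i * v)) //.
    by rewrite rmorphD mulrDl.
  by rewrite scalerDr combD Em En.
have [s [b [s0 E]]] := gspan m; have [u [v [u0 Euv]]] := right_ore a s0.
apply/rowP => i; rewrite mxE (coordE s0 E).
rewrite (@coordE (m ** a) u (fun i => b i * v)) //.
  rewrite rmorphM -[RHS]/(iota (b i) / iota s * iota a) -!mulrA; congr (_ * _).
  apply: (canLR (mulrK (frac_unit u0))); rewrite -mulrA -rmorphM Euv rmorphM.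
  by rewrite mulKr ?frac_unit.
by rewrite -actM Euv actM E comb_act.
Qed.

Lemma coord_basis i : coord (g i) = delta_mx 0 i.
Proof.
apply/rowP => k; rewrite (@coordE _ 1 (fun k => (k == i)%:R)) ?oner_neq0 //.
  by rewrite rmorph1 divr1 rmorph_nat mxE.
rewrite act1 /comb (bigD1 i) //= eqxx act1 big1 ?addr0 // => j /negPf->.
by rewrite act0.
Qed.

Lemma coord_inj : torsion_free M -> forall m, coord m = 0 -> m = 0.
Proof.
move=> tf m m0; have [s [b [s0 E]]] := gspan m.
have b0 i : b i = 0.
  have := coordE s0 E i; rewrite m0 mxE => /esym/(canRL (mulrVK (frac_unit s0))).
  by rewrite mul0r => ib0; apply: frac_inj; rewrite rmorph0.
have := E; rewrite /comb big1 => [/tf[s1|//]|i _]; last by rewrite b0 act0.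
by rewrite s1 eqxx in s0.
Qed.

(** A denominator acts invertibly on every [K]-module, so a map along [iota] is determined by its
    values on the family, which becomes the standard basis. *)
Lemma coord_extension : is_scalar_extension iota coord.
Proof.
split=> [|N f [fD fZ]]; first exact: coord_linear_along.
have f0 : f 0 = 0 by apply: (addrI (f 0)); rewrite -fD !addr0.
have f_sum b : f (comb b) = \sum_i (iota (b i) : K^c) *: f (g i).
  rewrite /comb (big_morph f fD f0); apply: eq_bigr => i _; exact: fZ.
pose h (x : 'rV[K^c]_r) := \sum_i x 0 i *: f (g i).
have h_lin : linear h.
  move=> a x y; rewrite /h scaler_sumr -big_split; apply: eq_bigr => i _ /=.
  by rewrite !mxE scalerDl scalerA.
pose hl : {linear 'rV[K^c]_r -> N} := HB.pack h (GRing.isLinear.Build _ _ _ _ h h_lin).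
exists hl; split=> [m|h' h'E x]; rewrite -[hl _]/(h _) /h.
  have [s [b [s0 E]]] := gspan m.
  have us : (iota s : K^c) \is a GRing.unit by exact: frac_unit.
  have sI : injective ( *:%R (iota s : K^c) : N -> N).
    by move=> x y /(congr1 ( *:%R (iota s : K^c)^-1)); rewrite !scalerA (mulVr us) !scale1r.
  apply: sI; rewrite -[RHS]fZ E f_sum scaler_sumr.
  apply: eq_bigr => i _; rewrite scalerA (coordE s0 E); congr (_ *: _).
  by rewrite -[LHS]/(iota (b i) / iota s * iota s) mulrVK ?frac_unit.
rewrite [in LHS](row_sum_delta x) linear_sum; apply: eq_bigr => i _.
by rewrite linearZ -coord_basis h'E.
Qed.

End Family.

(** A generator is added only when those kept so far do not span it generically; a relation giving
    it a nonzero coefficient would span it. *)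
Lemma independent_subfamily (M : lmodType D^c) k (G : 'I_k -> M) :
  exists r (g : 'I_r -> M), (forall b, comb g b = 0 -> forall i, b i = 0) /\
    forall t, generically_spanned g (G t).
Proof.
elim: k G => [|k IH] G; first by exists 0%N, (fun=> 0); split=> [b _ []|[]].
have [r [g [indep sp]]] := IH (fun t => G (lift ord0 t)).
have [G0|G0] := pselect (generically_spanned g (G ord0)).
  by exists r, g; split=> // t; case: (unliftP ord0 t) => [j ->|->].
pose g' (i : 'I_r.+1) := if unlift ord0 i is Some j then g j else G ord0.
have comb' b : comb g' b = G ord0 ** b ord0 + comb g (fun j => b (lift ord0 j)).
  rewrite /comb big_ord_recl /g' unlift_none; congr (_ + _).
  by apply: eq_bigr => j _; rewrite liftK.
exists r.+1, g'; split=> [b|t].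
  rewrite comb' => E; have b0 : b ord0 = 0.
    apply/eqP/negPn/negP => b0; apply: G0; exists (b ord0), (fun j => - b (lift ord0 j)).
    by split=> //; apply/eqP; rewrite combN -addr_eq0 E.
  move=> i; case: (unliftP ord0 i) => [j ->|->//]; move: E.
  by rewrite b0 act0 add0r => /indep.
case: (unliftP ord0 t) => [j ->|->].
  have [s [b [s0 E]]] := sp j.
  exists s, (fun i => if unlift ord0 i is Some l then b l else 0); split=> //.
  rewrite comb' unlift_none act0 add0r E; apply: eq_bigr => l _.
  by rewrite liftK.
exists 1, (fun i => if unlift ord0 i is Some l then 0 else 1); rewrite oner_neq0; split=> //.
rewrite comb' unlift_none act1 /comb big1 ?addr0 // => l _; by rewrite liftK act0.
Qed.

(** The given extension to [K ^ 1] is compared with the coordinates in an independent family of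
    length [r]. This forces [r = 1], and the single coordinate is the embedding. *)
Lemma rank1_embeds (M : lmodType D^c) : rank1_torsion_free iota M ->
  exists k : M -> K, [/\ {morph k : x y / x + y},
    forall m (a : D), k (m ** a) = k m * iota a,
    forall m, k m = 0 -> m = 0 & exists m : M, m != 0].
Proof.
case=> -[n [G spanG]] [f [[fD fZ] f_univ]] tf.
have [r [g [indep spG]]] := independent_subfamily G.
have sp m : generically_spanned g m.
  have [c ->] := spanG m; apply: (big_ind (generically_spanned g)).
  - exact: gspan0.
  - exact: gspanD.
  - by move=> t _; apply: gspan_act.
pose co := coord sp; have colin := coord_linear_along indep sp.
have [h [hE _]] := f_univ _ co colin.
have row1 (x : 'rV[K^c]_1) : x = x 0 0 *: const_mx 1.
  by apply/rowP => i; rewrite !mxE mulr1 ord1.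
have hE' m i : co m 0 i = (h (const_mx 1) 0 i : K) * (f m 0 0 : K).
  by rewrite -hE {1}[f m]row1 linearZ [LHS]mxE.
(* The identity matrix of size [r] is a column times a row over [K], which excludes [r >= 2]. *)
have gE a b : (h (const_mx 1) 0 b : K) * (f (g a) 0 0 : K) = (b == a)%:R.
  by rewrite -hE' /co (coord_basis indep) mxE eqxx.
have r1 : r = 1%N.
  case: r => [|[//|r]] in g indep spG sp co colin h hE hE' gE *.
    (* For [r = 0] the module vanishes, and the identity and zero maps of [K ^ 1] would both solve
       the same universal problem. *)
    have M0 (m : M) : m = 0.
      have [s [b [s0]]] := sp m; rewrite /comb big_ord0 => /tf[s1|//].
      by rewrite s1 eqxx in s0.
    have f0 m : f m = 0 by rewrite (M0 m); apply: (addrI (f 0)); rewrite -fD !addr0.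
    have [h1 [_ h1_uniq]] := f_univ _ f (conj fD fZ).
    have zero_lin : linear (fun _ : 'rV[K^c]_1 => 0 : 'rV[K^c]_1).
      by move=> a x y; rewrite scaler0 addr0.
    pose zl : {linear 'rV[K^c]_1 -> 'rV[K^c]_1} :=
      HB.pack (fun _ : 'rV[K^c]_1 => 0 : 'rV[K^c]_1) (GRing.isLinear.Build _ _ _ _ _ zero_lin).
    have /rowP/(_ 0) : idfun (const_mx 1) = zl (const_mx 1).
      by rewrite (h1_uniq idfun) // (h1_uniq zl) // => m; rewrite f0.
    by rewrite !mxE => /eqP; rewrite oner_eq0.
  have i01 : (lift ord0 ord0 == ord0 :> 'I_r.+2) = false by [].
  have := gE (lift ord0 ord0) ord0; rewrite eq_sym i01.
  have := gE ord0 (lift ord0 ord0); rewrite i01.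
  have := gE ord0 ord0; have := gE (lift ord0 ord0) (lift ord0 ord0); rewrite !eqxx.
  set v0 := h _ 0 ord0; set v1 := h _ 0 (lift _ _).
  set x0 := f (g ord0) 0 0; set x1 := f (g (lift _ _)) 0 0.
  move=> v1x1 v0x0 v1x0 v0x1.
  have x00 : (x0 : K) != 0 by apply: contra_eq_neq v0x0 => ->; rewrite mulr0 eq_sym oner_eq0.
  have ux0 : (x0 : K) \is a GRing.unit by case: frac => + _ _; apply.
  have v10 : v1 = 0 :> K by rewrite -[v1](mulrK ux0) v1x0 mul0r.
  by move/eqP: v1x1; rewrite v10 mul0r eq_sym oner_eq0.
rewrite {}r1 in g indep spG sp co colin h hE hE' gE.
exists (fun m => co m 0 0); case: colin => coD coZ; split.
- by move=> x y; rewrite /co coD mxE.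
- by move=> m a; rewrite /co coZ mxE.
- move=> m m0; apply: (coord_inj indep tf (gspan := sp)); apply/rowP => i.
  by rewrite ord1 [LHS]m0 mxE.
- exists (g 0); apply/eqP => g0; have /eqP := gE 0 0; rewrite eqxx -hE' g0.
  have -> : co 0 = 0 by apply: (addrI (co 0)); rewrite -coD !addr0.
  by rewrite mxE eq_sym oner_eq0.
Qed.

(** By the Ore condition any single nonzero element generically spans a right ideal. *)
Lemma ideal_has_rank1 (M : lmodType D^c) (t : M -> D) :
  {morph t : x y / x + y} -> (forall m (a : D), t (m ** a) = t m * a) ->
  injective t -> (exists m : M, m != 0) -> has_rank iota M 1.
Proof.
move=> tD tZ t_inj [m0 m0n].
have t0 : t 0 = 0 by apply: (addrI (t 0)); rewrite -tD !addr0.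
have tm0 : t m0 != 0 by apply: contra_neq m0n => E; apply: t_inj; rewrite E t0.
pose g (_ : 'I_1) := m0.
have combE b : comb g b = m0 ** b ord0 by rewrite /comb big_ord1.
have indep b : comb g b = 0 -> forall i, b i = 0.
  rewrite combE => E i; rewrite (ord1 i); apply/eqP/negPn/negP => b0.
  by have := frac_mulf_neq0 tm0 b0; rewrite -tZ E t0 eqxx.
have sp m : generically_spanned g m.
  have [s [c [s0 E]]] := right_ore (t m) tm0.
  by exists s, (fun=> c); split=> //; rewrite combE; apply: t_inj; rewrite !tZ.
by exists (coord sp); apply: coord_extension.
Qed.

(** Elements of [K] are right fractions, but only left factors respect right linearity; the left Ore
    condition converts one kind of denominator into the other. *)
Lemma common_left_denominator (k : nat) (x : 'I_k -> K) :
  (forall a b : D, b != 0 -> exists c e, c != 0 /\ c * a = e * b) ->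
  exists2 c, c != 0 & forall t, exists e, iota c * x t = iota e.
Proof.
move=> left_ore; elim: k x => [|k IH] x; first by exists 1; rewrite ?oner_neq0 //; case.
have [c c0 cE] := IH (fun t => x (lift ord0 t)).
have [_ _ /(_ (iota c * x ord0))[a [s [s0 E]]]] := frac.
have [u [e [u0 Eu]]] := left_ore a s s0.
exists (u * c) => [|t]; first exact: frac_mulf_neq0.
rewrite rmorphM -mulrA; case: (unliftP ord0 t) => [j ->|->].
  by have [e' ->] := cE j; exists (u * e'); rewrite rmorphM.
by exists e; rewrite E mulrA -rmorphM Eu rmorphM mulrK ?frac_unit.
Qed.

Lemma integral_lift (M : lmodType D^c) (k : M -> K) n (G : 'I_n -> M) :
  {morph k : x y / x + y} -> (forall m (a : D), k (m ** a) = k m * iota a) ->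
  (forall m, exists c : 'I_n -> D^c, m = \sum_(i < n) c i *: G i) ->
  (forall i, exists e, k (G i) = iota e) ->
  exists t : M -> D, [/\ {morph t : x y / x + y},
    forall m (a : D), t (m ** a) = t m * a & forall m, k m = iota (t m)].
Proof.
move=> kD kZ span intG; have k0 : k 0 = 0 by apply: (addrI (k 0)); rewrite -kD !addr0.
have int m : exists e, k m = iota e.
  have [c ->] := span m; apply: (big_ind (fun m => exists e, k m = iota e)).
  - by exists 0; rewrite k0 rmorph0.
  - by move=> x y [a ka] [b kb]; exists (a + b); rewrite kD ka kb rmorphD.
  - by move=> i _; have [e E] := intG i; exists (e * c i); rewrite [LHS]kZ E rmorphM.
exists (fun m => sval (cid (int m))).
have tE m : k m = iota (sval (cid (int m))) by exact: (svalP (cid (int m))).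
split=> // [x y|m a]; apply: frac_inj; first by rewrite rmorphD -!tE kD.
by rewrite rmorphM -!tE kZ.
Qed.

End Rank.

(** * Residues and ideals in [F[z]] *)

Section PolyIdeal.
Variable F : fieldType.

(** [c %/ g] is the polynomial part of the rational function [c / g], and the added constant is its
    [1/X]-coefficient. The index [(size g).-2] is the degree of [g] minus one; for constant [g] the
    remainder is zero. Both [al] and the functional [j] will be such residues. *)
Lemma divp_Xl (g c : {poly F}) : g != 0 ->
  ('X * c) %/ g = 'X * (c %/ g) + ((c %% g)`_(size g).-2 / lead_coef g)%:P.
Proof.
move=> g0; set k := _ / _; have szg : (0 < size g)%N by rewrite size_poly_gt0.
have lg : lead_coef g != 0 by rewrite lead_coef_eq0.
have szr : (size (c %% g)%R < size g)%N by rewrite ltn_modp.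
have {1}-> : 'X * c = ('X * (c %/ g) + k%:P) * g + ('X * (c %% g) - k%:P * g).
  by rewrite {1}(divp_eq c g); ring.
rewrite divp_addl_mul_small //; case E: (size g) szg szr => [//|[|n]] _ szr.
  have -> : c %% g = 0 by apply/eqP; rewrite -size_poly_leq0.
  by rewrite /k (_ : c %% g = 0) ?coef0 ?mul0r ?mulr0 ?mul0r ?subr0 ?size_poly0 //;
     apply/eqP; rewrite -size_poly_leq0.
rewrite ltnS; apply: size_poly_pred.
  rewrite (leq_trans (size_polyD _ _)) // geq_max size_polyN mul_polyC.
  rewrite (leq_trans (size_scale_leq _ _)) ?E // andbT mulrC.
  by rewrite (leq_trans (size_polyMleq _ _)) // size_polyX addn2.
rewrite coefB coefXM /= mul_polyC coefZ /k E /= /lead_coef E /= mulrVK ?subrr //.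
by rewrite unitfE; move: lg; rewrite /lead_coef E.
Qed.

Lemma poly_ideal_principal (I : {poly F} -> Prop) :
  I 0 -> (forall p q, I p -> I q -> I (p + q)) -> (forall c p, I p -> I (c * p)) ->
  exists2 g, I g & forall p, I p -> exists q, p = q * g.
Proof.
move=> I0 ID IM; pose Q n := `[< exists p, [/\ p != 0, I p & size p = n] >].
have [[p [pn Ip]]|noI] := pselect (exists p, p != 0 /\ I p); last first.
  exists 0 => // p Ip; exists 0; rewrite mul0r; apply: contrapT => /eqP pn.
  by apply: noI; exists p.
have exQ : exists n, Q n by exists (size p); apply/asboolP; exists p.
have [n /asboolP[g [gn Ig szg]] n_min] := ex_minnP exQ.
exists g => // q Iq; exists (q %/ g); rewrite {1}(divp_eq q g).
suff -> : q %% g = 0 by rewrite addr0.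
apply: contrapT => /eqP rn; have : Q (size (q %% g)%R).
  apply/asboolP; exists (q %% g); split=> //.
  have -> : q %% g = q + (- (q %/ g)) * g by rewrite {2}(divp_eq q g) mulNr addrAC subrr add0r.
  by apply: ID => //; apply: IM.
by move/n_min; rewrite -szg leqNgt ltn_modp gn.
Qed.

End PolyIdeal.

(** * Right ideals of the Weyl algebra: left Ore condition, generators, framings *)

Section Ideals.
Variables (F : fieldType) (D : algType F) (z d : D).
Local Notation P := {poly {poly F}}.
Variable th : D -> P.
Hypothesis ord : normal_ordering z d th.
Local Notation zp := (horner_alg z).

Let th_coef (a b : D) S T : (size (th a) <= S.+1)%N -> (size (th b) <= T.+1)%N ->
  (size (th (a * b)%R) <= (S + T).+1)%N /\
  (th (a * b))`_(S + T) = (th b)`_T * (th a)`_S.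
Proof.
apply: (fr_coef ord (framed_regular ord)) => m; by rewrite size_poly0.
Qed.

Lemma left_pseudo_division (a b : D) : b != 0 ->
  exists c q s, [/\ c != 0, zp c * a = q * b + s & (size (th s) < size (th b))%N].
Proof.
move=> b0; have tb0 : th b != 0 by apply: contra_neq b0 => /(th_eq0 ord).
have szb : (0 < size (th b))%N by rewrite size_poly_gt0.
have [n le_n] := ubnP (size (th a)); elim: n a le_n => // n IH a le_n.
have [lt_ab|le_ba] := ltnP (size (th a)) (size (th b)).
  by exists 1, 0, a; rewrite oner_neq0 rmorph1 mul1r mul0r add0r.
pose la := lead_coef (th a); pose lb := lead_coef (th b).
pose S := (size (th a)).-1; pose T := (S - (size (th b)).-1)%N.
have sza : size (th a) = S.+1 by rewrite /S prednK // (leq_trans szb).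
have ST : (T + (size (th b)).-1 = S)%N by rewrite /T subnK // /S; lia.
have [||] := @th_coef (zp la * d ^+ T) b T (size (th b)).-1.
- by rewrite (th_dXr ord) (th_zp ord) mul_polyC (leq_trans (size_scale_leq _ _)) // size_polyXn.
- by rewrite prednK.
rewrite ST (th_dXr ord) (th_zp ord) mul_polyC coefZ coefXn eqxx mulr1 => sz1 co1.
have [|c [q [s [c0 E lt_s]]]] := IH (zp lb * a - zp la * d ^+ T * b).
  have ltSn : (S < n)%N by rewrite -ltnS -sza.
  apply: leq_ltn_trans ltSn; apply: size_poly_pred; rewrite (thD ord) (thN ord) (th_zpl ord).
    rewrite (leq_trans (size_polyD _ _)) // geq_max size_polyN sz1 andbT.
    by rewrite (leq_trans (size_scale_leq _ _)) // sza.
  by rewrite coefB coefZ co1 /la /lead_coef sza subrr.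
exists (c * lb), (q + zp c * zp la * d ^+ T), s; split=> //.
  by rewrite mulf_neq0 // lead_coef_eq0.
rewrite rmorphM /= -mulrA -[zp lb * a](subrK (zp la * d ^+ T * b)) mulrDr E mulrDl.
by rewrite !mulrA addrAC.
Qed.

(** Euclid's algorithm: if [u * b = e * s] for the remainder [s] of [zp c * a = q * b + s], then
    [e * zp c * a = (e * q + u) * b]. *)
Lemma left_ore (a b : D) : b != 0 -> exists c e, c != 0 /\ c * a = e * b.
Proof.
have [n le_n] := ubnP (size (th b)); elim: n a b le_n => // n IH a b le_n b0.
have [c [q [s [c0 E lt_s]]]] := left_pseudo_division a b0.
have zc0 : zp c != 0 by apply: contra_neq c0 => /(zp_inj ord).
have [s0|s0] := eqVneq s 0; first by exists (zp c), q; rewrite E s0 addr0.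
have [|u [e [u0 E']]] := IH b s _ s0; first exact: leq_trans lt_s le_n.
have domain (x y : D) : x != 0 -> y != 0 -> x * y != 0.
  by move=> x0 y0; apply/eqP => /(weyl_domain ord)[/eqP|/eqP]; apply/negP.
exists (e * zp c), (e * q + u); split; last by rewrite -mulrA E mulrDr mulrDl mulrA E'.
apply: (domain) => //; apply: contraNneq (domain _ _ u0 b0) => e0.
by rewrite E' e0 mul0r.
Qed.

Section Leading.
Variables (M : lmodType D^c) (r : M -> P) (al : M -> {poly F}).
Hypothesis fr : framed z d r al.
Hypothesis al_lt : forall m, (size (al m) <= (size (r m)).-1)%N.
Hypothesis r_inj : forall m, r m = 0 -> m = 0.

Definition leading k c := exists2 m, (size (r m) <= k.+1)%N & (r m)`_k = c.

Lemma leading0 k : leading k 0.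
Proof. by exists 0; rewrite (fr0 fr) ?size_poly0 ?coef0. Qed.

Lemma leadingD k p q : leading k p -> leading k q -> leading k (p + q).
Proof.
move=> [m szm <-] [n szn <-]; exists (m + n); rewrite (frD fr) ?coefD //.
by rewrite (leq_trans (size_polyD _ _)) // geq_max szm.
Qed.

Lemma leadingM k c p : leading k p -> leading k (c * p).
Proof.
by move=> [m szm <-]; have [sz co] := fr_zp_coef fr al_lt c szm; exists (m ** zp c).
Qed.

Lemma leading_d k j p : leading k p -> leading (k + j) p.
Proof.
move=> [m szm <-]; exists (m ** d ^+ j); rewrite (fr_dX fr).
  by rewrite (leq_trans (size_polyMleq _ _)) // size_polyXn addnS /= -addSn leq_add2r.
by rewrite coefMXn ltnNge leq_addl /= addnK.
Qed.

(** The ideals of leading coefficients grow with the order, because [d] raises it. Their union is an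
    ideal of [F[z]], whose generator already occurs in some order [N]. *)
Lemma leading_generator : exists N g,
  leading N g /\ forall k c, leading k c -> exists q, c = q * g.
Proof.
have [|||g [N Lg] g_gen] := @poly_ideal_principal F (fun c => exists k, leading k c).
- by exists 0%N; apply: leading0.
- move=> p q [j Lp] [k Lq]; exists (j + k)%N; apply: leadingD; first exact: leading_d.
  by rewrite addnC; apply: leading_d.
- by move=> c p [k Lp]; exists k; apply: leadingM.
by exists N, g; split=> // k c Lc; apply: g_gen; exists k.
Qed.

(** Hilbert's basis argument: one generator for each order up to [N], and multiples of [mN] by
    powers of [d] beyond. *)
Lemma framed_finitely_generated : finitely_generated M.
Proof.
have [N [g [[mN szN coN] g_gen]]] := leading_generator.
have gen k : exists m, (size (r m) <= k.+1)%N /\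
    forall c, leading k c -> exists q, c = q * (r m)`_k.
  have [c [m szm cE] cP] := poly_ideal_principal (leading0 k) (@leadingD k) (@leadingM k).
  by exists m; split=> //; rewrite cE.
pose G (i : 'I_N.+1) := sval (cid (gen i)).
have GP (i : 'I_N.+1) : (size (r (G i)) <= i.+1)%N /\
    forall c, leading i c -> exists q, c = q * (r (G i))`_i by exact: (svalP (cid (gen i))).
pose Sp m := exists c : 'I_N.+2 -> D^c,
  m = \sum_(i < N.+2) c i *: (if unlift ord_max i is Some j then G j else mN).
have SpD m n : Sp m -> Sp n -> Sp (m + n).
  move=> [b ->] [c ->]; exists (fun i => b i + c i); rewrite -big_split.
  by apply: eq_bigr => i _; rewrite scalerDl.
have SpG i (a : D) : Sp ((if unlift ord_max i is Some j then G j else mN) ** a).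
  exists (fun k => if k == i then a else 0); rewrite (bigD1 i) //= eqxx big1 ?addr0 //.
  by move=> k /negPf->; rewrite scale0r.
exists N.+2, (fun i => if unlift ord_max i is Some j then G j else mN) => m.
change (Sp m); have [n le_n] := ubnP (size (r m)); elim: n m le_n => // n IH m le_n.
have [rm0|rm0] := eqVneq (r m) 0.
  rewrite (r_inj rm0); exists (fun=> 0); rewrite big1 // => i _; exact: scale0r.
pose S := (size (r m)).-1.
have szm : size (r m) = S.+1 by rewrite prednK // size_poly_gt0.
have step x (a : D) : Sp (x ** a) -> (size (r (x ** a)) <= S.+1)%N ->
    (r (x ** a))`_S = (r m)`_S -> Sp m.
  move=> Sx sz co; rewrite -(subrK (x ** a) m); apply: SpD => //; apply: IH.
  rewrite -ltnS (leq_trans _ le_n) // szm !ltnS; apply: size_poly_pred.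
    by rewrite (frB fr) (leq_trans (size_polyD _ _)) // size_polyN geq_max sz szm leqnn.
  by rewrite (frB fr) coefB co subrr.
have Lm : leading S (r m)`_S by exists m; rewrite ?szm.
have [le_SN|lt_NS] := leqP S N.
  have lt_S : (S < N.+1)%N by [].
  have [szG /(_ _ Lm)[q qE]] := GP (Ordinal lt_S).
  have [sz co] := fr_zp_coef fr al_lt q szG.
  apply: (step (G (Ordinal lt_S)) (zp q)) => //; last by rewrite co qE.
  by have := SpG (lift ord_max (Ordinal lt_S)) (zp q); rewrite liftK.
have [q qE] := g_gen _ _ Lm.
have [||sz co] := @fr_coef _ _ _ _ _ ord _ _ _ fr al_lt N (S - N) (zp q * d ^+ (S - N)) mN => //.
  by rewrite (th_dXr ord) (th_zp ord) mul_polyC (leq_trans (size_scale_leq _ _)) // size_polyXn.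
rewrite (subnKC (ltnW lt_NS)) in sz co.
apply: (step mN (zp q * d ^+ (S - N))) => //.
  by have := SpG ord_max (zp q * d ^+ (S - N)); rewrite unlift_none.
by rewrite co qE coN (th_dXr ord) (th_zp ord) mul_polyC coefZ coefXn eqxx mulr1.
Qed.

End Leading.

Lemma framed_ideal (M : lmodType D^c) (t : M -> D) :
  {morph t : x y / x + y} -> (forall m (a : D), t (m ** a) = t m * a) ->
  framed z d (fun m => th (t m)) (fun=> 0).
Proof.
move=> tD tZ; have reg := framed_regular ord; split=> [x y|c m|m|m].
- by rewrite tD (thD ord).
- by rewrite tZ -(frZ reg).
- by rewrite tZ -(fr_d reg).
- by rewrite tZ -(fr_z reg).
Qed.

(** With [g] the generator of all leading coefficients, [r] and [al] are the polynomial part and the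
    [1/z]-coefficient of [g^-1 t(m)]. Since [g] divides the leading coefficients, [r] preserves
    orders and is injective. *)
Lemma ideal_framing (M : lmodType D^c) (t : M -> D) m0 f :
  {morph t : x y / x + y} -> (forall m (a : D), t (m ** a) = t m * a) ->
  (forall m, t m = 0 -> m = 0) -> t m0 = zp f -> f != 0 ->
  exists r al, framing z d (M := M) r al.
Proof.
move=> tD tZ t_inj tm0 f0; have fr := framed_ideal tD tZ.
have [|N [g [[mN szN coN] g_gen]]] := leading_generator fr.
  by move=> m; rewrite size_poly0.
have g0 : g != 0.
  apply: contraNneq f0 => g0; have [|q] := g_gen 0%N f; last by rewrite g0 mulr0 => ->.
  by exists m0; rewrite tm0 (th_zp ord) ?coefC // size_polyC_leq1.
have div0 : 0 %/ g = 0 by rewrite div0p.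
have divpMn (p : {poly F}) n : (p *+ n) %/ g = (p %/ g) *+ n.
  by elim: n => [|n IH]; rewrite ?mulr0n // !mulrS divpD IH.
pose a0 (c : {poly F}) := (c %% g)`_(size g).-2 / lead_coef g.
have a00 : a0 0 = 0 by rewrite /a0 mod0p coef0 mul0r.
pose r m := map_poly (fun c => c %/ g) (th (t m)).
pose al m := map_poly a0 (th (t m)).
have rE m b : (r m)`_b = (th (t m))`_b %/ g by rewrite coef_map_id0.
have alE m b : (al m)`_b = a0 (th (t m))`_b by rewrite coef_map_id0.
have top m : th (t m) != 0 -> size (r m) = size (th (t m)) /\
    (size (al m) <= (size (th (t m))).-1)%N.
  rewrite -size_poly_gt0 => szm; set S := (size (th (t m))).-1.
  have szS : size (th (t m)) = S.+1 by rewrite prednK.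
  have [|q qE] := g_gen S (th (t m))`_S; first by exists m; rewrite ?szS.
  have q0 : q != 0.
    apply: contraTneq szm => q0; rewrite -leqNgt leqn0 size_poly_eq0 -lead_coef_eq0.
    by rewrite /lead_coef -/S qE q0 mul0r.
  split; last first.
    apply: size_poly_pred; first by rewrite -szS size_poly.
    by rewrite alE qE /a0 modp_mull coef0 mul0r.
  apply/eqP; rewrite szS eqn_leq -{1}szS size_poly ltnNge; apply/negP => /(nth_default 0).
  by move/eqP; rewrite rE qE mulpK // (negPf q0).
exists r, al; split.
- split=> [x y|c m|m|m]; apply/polyP => b.
  + by rewrite coefD !rE tD (thD ord) coefD divpD.
  + by rewrite coefZ !rE (frZ fr) coefZ !mul_polyC divpZl.
  + by rewrite coefMX !rE (fr_d fr) coefMX; case: eqP.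
  + rewrite !(coefD, coefZ, coef_deriv) rE (fr_z fr) rmorph0 addr0 coef_map /= alE !rE.
    rewrite !(coefD, coefZ, coef_deriv) divpD divp_Xl // -addrA -addrA; congr (_ + _).
    rewrite addrC; congr (_ + _).
    by rewrite divpMn.
- move=> m; have [tm|/top[-> //]] := eqVneq (th (t m)) 0.
  by rewrite /al tm map_poly0 size_poly0.
- move=> m rm; have [/(th_eq0 ord)/t_inj //|tm] := eqVneq (th (t m)) 0.
  have [sz _] := top _ tm; have := size_poly_gt0 (th (t m)).
  by rewrite -sz rm size_poly0 tm.
- have tm0' : th (t m0) != 0 by rewrite tm0 (th_zp ord) polyC_eq0.
  by exists m0; have [-> _] := top _ tm0'; rewrite tm0 (th_zp ord) size_polyC f0.
- exists N => c; exists (mN ** zp c).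
  have [|sz co] := fr_zp_coef fr _ c szN; first by move=> m; rewrite size_poly0.
  by rewrite (leq_trans (size_poly _ _)) // rE co coN mulpK.
Qed.

Variables (K : unitRingType) (iota : {rmorphism D -> K}).
Hypothesis frac : is_skew_field_of_fractions iota.

(* A generator of minimal order [m0] satisfies [m f(z) = m0 b] for every [m], so
   left multiplication by [f(z) m0^-1], for a suitable common [f], stays in [D]. *)
Lemma rank1_ideal (M : lmodType D^c) : rank1_torsion_free iota M ->
  exists (t : M -> D), [/\ {morph t : x y / x + y},
    forall m (a : D), t (m ** a) = t m * a, forall m, t m = 0 -> m = 0 &
    exists m0 f, f != 0 /\ t m0 = zp f].
Proof.
move=> rkM; have [[n [G spanG]] _ _] := rkM.
have [k [kD kZ k_inj [m1 m1n]]] := rank1_embeds frac rkM.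
have iota_inj := frac_inj frac; have unit_iota := frac_unit frac.
have [c c0 cE] := common_left_denominator frac (fun i => k (G i)) left_ore.
have [||||t [tD tZ tE]] := @integral_lift _ _ _ frac M (fun m => iota c * k m) n G.
- by move=> x y; rewrite kD mulrDr.
- by move=> m a; rewrite kZ mulrA.
- exact: spanG.
- exact: cE.
have t_inj m : t m = 0 -> m = 0.
  move=> tm; apply: k_inj; apply: (can_inj (mulKr (unit_iota c c0))).
  by rewrite tE tm mulr0 rmorph0.
have fr := framed_ideal tD tZ.
have [m0 m0n m0_min] : exists2 m0, m0 != 0 &
    forall m, m != 0 -> (size (th (t m0)) <= size (th (t m)))%N.
  have exQ : exists n, `[< exists2 m, m != 0 & size (th (t m)) = n >].
    by exists (size (th (t m1))); apply/asboolP; exists m1.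
  have [s /asboolP[m mn szm] s_min] := ex_minnP exQ; exists m => // m' m'n.
  by rewrite szm; apply: s_min; apply/asboolP; exists m'.
have tm0 : t m0 != 0 by apply: contra_neq m0n => /t_inj.
have u0 := unit_iota _ tm0.
have [f f0 fE] : exists2 f : {poly F}, f != 0 &
    forall i, exists e, iota (zp f) * ((iota (t m0))^-1 * iota (t (G i))) = iota e.
  have den m : exists2 f : {poly F}, f != 0 &
      exists e, iota (zp f) * ((iota (t m0))^-1 * iota (t m)) = iota e.
    have [||h [b [h0 E]]] := fr_common_multiple ord fr _ _ m0n m0_min m.
    - by move=> x; rewrite size_poly0.
    - by move=> x /(th_eq0 ord)/t_inj.
    have zh0 : zp h != 0 by apply: contra_neq h0 => /(zp_inj ord).
    (* Division by the order-zero element [zp h] is exact: the remainder has size below 1. *)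
    have [f [q [s [f0 Ef]]]] := left_pseudo_division b zh0.
    rewrite (th_zp ord) size_polyC h0 ltnS size_poly_leq0 => /eqP/(th_eq0 ord) s0.
    exists f => //; exists q; apply: (mulIr (unit_iota _ zh0)).
    rewrite -!mulrA -!rmorphM -tZ E tZ [in LHS]rmorphM mulKr // -rmorphM.
    by rewrite Ef s0 addr0.
  have [|h hP] := @choice 'I_n {poly F} (fun i h => h != 0 /\
      exists e, iota (zp h) * ((iota (t m0))^-1 * iota (t (G i))) = iota e).
    by move=> i; have [f ? ?] := den (G i); exists f.
  exists (\prod_i h i); first by apply/prodf_neq0 => i _; have [] := hP i.
  move=> i; have [_ [e eE]] := hP i; exists (zp (\prod_(j < n | j != i) h j) * e).
  by rewrite (bigD1 i) //= mulrC !rmorphM /= -eE !mulrA.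
have [||||t2 [t2D t2Z t2E]] := @integral_lift _ _ _ frac M
    (fun m => iota (zp f) * ((iota (t m0))^-1 * iota (t m))) n G.
- by move=> x y; rewrite tD rmorphD !mulrDr.
- by move=> m a; rewrite tZ rmorphM !mulrA.
- exact: spanG.
- exact: fE.
have uf : iota (zp f) \is a GRing.unit.
  by apply: unit_iota; apply: contra_neq f0 => /(zp_inj ord).
exists t2; split=> // [m t2m|].
  apply: t_inj; apply: iota_inj; rewrite rmorph0.
  apply: (can_inj (mulVKr u0)); apply: (can_inj (mulKr uf)).
  by rewrite t2E t2m rmorph0 !mulr0.
exists m0, f; split=> //; apply: iota_inj.
by rewrite -t2E mulVr // mulr1.
Qed.

End Ideals.

(** * Pairs of matrices from framings *)

Section LinearAlgebra.
Variable F : fieldType.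

Section Codimension.
Variables (V : lmodType F) (U : V -> Prop).
Hypothesis U0 : U 0.
Hypothesis UD : forall x y, U x -> U y -> U (x + y).
Hypothesis UZ : forall a x, U x -> U (a *: x).

Definition spans_mod n (s : 'I_n -> V) := forall v, exists c : 'I_n -> F, U (v - \sum_k c k *: s k).

Let UB x y : U x -> U y -> U (x - y).
Proof. by move=> Ux Uy; apply: UD => //; rewrite -scaleN1r; apply: UZ. Qed.

Lemma spans_mod_shrink n (s : 'I_n.+1 -> V) c k :
  spans_mod s -> U (\sum_k c k *: s k) -> c k != 0 -> spans_mod (fun l => s (lift k l)).
Proof.
move=> span Uc ck v; have [b Ub] := span v.
exists (fun l => b (lift k l) - b k / c k * c (lift k l)).
have := UD Ub (UZ (b k / c k) Uc); congr U.
have lift_sum (f : 'I_n.+1 -> V) : \sum_l f l = f k + \sum_l f (lift k l).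
  by rewrite (bigD1_ord k).
rewrite !lift_sum scalerDr scalerA divfK //.
rewrite [in RHS](eq_bigr (fun l =>
  b (lift k l) *: s (lift k l) - (b k / c k) *: (c (lift k l) *: s (lift k l)))).
  rewrite sumrB -scaler_sumr -addrA opprD addrACA addNr add0r opprB.
  by rewrite [X in v + X]addrC.
by move=> l _; rewrite scalerBl scalerA.
Qed.

(** A family of minimal length spanning modulo [U] is independent modulo [U], so its coefficients
    are well defined; [pi] is the quotient by [U] written in this basis. *)
Lemma finite_codimension n (s : 'I_n -> V) : spans_mod s ->
  exists k (pi : V -> 'cV[F]_k), [/\ linear pi, forall v, pi v = 0 <-> U v &
    forall w, exists v, pi v = w].
Proof.
move=> span; have exQ : exists k, `[< exists s : 'I_k -> V, spans_mod s >].
  by exists n; apply/asboolP; exists s.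
have [k /asboolP[{}s {}span] k_min] := ex_minnP exQ; clear exQ n.
have indep c : U (\sum_l c l *: s l) -> forall l, c l = 0.
  move=> Uc l; apply/eqP/negPn/negP => cl.
  case: k s span k_min c Uc l cl => [|k] s span k_min c Uc l cl; first by case: l cl.
  have /k_min : `[< exists s : 'I_k -> V, spans_mod s >].
    by apply/asboolP; exists (fun j => s (lift l j)); apply: spans_mod_shrink Uc cl.
  by rewrite ltnn.
pose c v := sval (cid (span v)).
have cP v : U (v - \sum_l c v l *: s l) by exact: (svalP (cid (span v))).
have c_uniq v b : U (v - \sum_l b l *: s l) -> forall l, c v l = b l.
  move=> Ub l; apply/eqP; rewrite -subr_eq0; apply/eqP.
  apply: (indep (fun l => c v l - b l)); have := UB Ub (cP v); congr U.
  rewrite opprB addrC addrA subrK [RHS](eq_bigr (fun l => c v l *: s l - b l *: s l)).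
    by rewrite sumrB.
  by move=> m _; rewrite scalerBl.
exists k, (fun v => \col_l c v l); split=> [a u v|v|w].
- apply/colP => l; rewrite !mxE.
  apply: (c_uniq _ (fun l => a * c u l + c v l)).
  have := UD (UZ a (cP u)) (cP v); congr U.
  rewrite scalerBr addrACA -opprD scaler_sumr -big_split; congr (_ - _).
  by apply: eq_bigr => m _; rewrite scalerDl scalerA.
- split=> [/colP pv|Uv].
    have := cP v; rewrite big1 ?subr0 // => l _.
    by have := pv l; rewrite !mxE => ->; rewrite scale0r.
  apply/colP => l; rewrite !mxE; apply: (c_uniq _ (fun=> 0)).
  by rewrite big1 ?subr0 // => m _; rewrite scale0r.
- exists (\sum_l w l 0 *: s l); apply/colP => l; rewrite mxE.
  by apply: (c_uniq _ (fun l => w l 0)); rewrite subrr.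
Qed.

Lemma linear_factor n m (pi : V -> 'cV[F]_n) (T : V -> 'cV[F]_m) :
  linear pi -> linear T -> (forall w, exists v, pi v = w) ->
  (forall v, pi v = 0 -> T v = 0) -> exists A, forall v, T v = A *m pi v.
Proof.
move=> pi_lin T_lin surj ker.
pose p : {linear V -> 'cV[F]_n} := HB.pack pi (GRing.isLinear.Build _ _ _ _ pi pi_lin).
pose t : {linear V -> 'cV[F]_m} := HB.pack T (GRing.isLinear.Build _ _ _ _ T T_lin).
have [s sE] := choice (fun k : 'I_n => surj (delta_mx k 0)).
exists (\matrix_(a, b) T (s b) a 0) => v.
have piB u w : pi (u - w) = pi u - pi w by exact: (raddfB p).
have TB u w : T (u - w) = T u - T w by exact: (raddfB t).
have piS c : pi (\sum_k c k *: s k) = \sum_k c k *: delta_mx k 0.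
  rewrite -[LHS]/(p _) linear_sum; apply: eq_bigr => k _.
  by rewrite linearZ -sE.
have TS c : T (\sum_k c k *: s k) = \sum_k c k *: T (s k).
  by rewrite -[LHS]/(t _) linear_sum; apply: eq_bigr => k _; rewrite linearZ.
have -> : T v = T (\sum_k pi v k 0 *: s k).
  apply/eqP; rewrite -subr_eq0 -TB; apply/eqP; apply: ker.
  rewrite piB piS {1}[pi v]matrix_sum_delta; apply/eqP; rewrite subr_eq0; apply/eqP.
  by apply: eq_bigr => k _; rewrite big_ord1.
rewrite TS; apply/colP => a; rewrite summxE !mxE; apply: eq_bigr => k _.
by rewrite !mxE mulrC.
Qed.

End Codimension.

Lemma mulmx_ext m n (A B : 'M[F]_(m, n)) : (forall w : 'cV_n, A *m w = B *m w) -> A = B.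
Proof.
move=> E; apply/matrixP => a b; have := E (delta_mx b 0).
by rewrite -!colE => /colP/(_ a); rewrite !mxE.
Qed.

Hypothesis char0 : [pchar F] =i pred0.

(* A nonzero proper invariant quotient would carry matrices with
   [[X', Y'] = Id], which the trace forbids in characteristic zero. *)
Lemma cyclic_vector n (X Y : 'M[F]_n) (i : 'cV[F]_n) (j : 'rV[F]_n) (I : 'cV[F]_n -> Prop) :
  X *m Y - Y *m X = 1%:M + i *m j ->
  (forall a u v, I u -> I v -> I (a *: u + v)) -> I i ->
  (forall u, I u -> I (X *m u)) -> (forall u, I u -> I (Y *m u)) -> forall u, I u.
Proof.
move=> XY Ilin Ii IX IY.
have I0 : I 0 by rewrite -(subrr i) -scaleN1r addrC; apply: Ilin.
(* [I] is only a predicate; a matrix of maximal rank with rows in [I] has row space [I]. *)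
pose Q r := `[< exists k (A : 'M[F]_(k, n)), (forall l, I (row l A)^T) /\ \rank A = r >].
have exQ : exists r, Q r.
  by exists 0%N; apply/asboolP; exists 0%N, 0; rewrite mxrank0; split=> // -[].
have Qn r : Q r -> (r <= n)%N by move/asboolP => [k [A [_ <-]]]; apply: rank_leq_col.
have [r /asboolP[k [A [IA rA]]] r_max] := ex_maxnP exQ Qn.
have sub u : I u -> (u^T <= A)%MS.
  move=> Iu; have sAC : (A <= col_mx A u^T)%MS by rewrite -addsmxE addsmxSl.
  have : (\rank (col_mx A u^T) <= \rank A)%N.
    rewrite rA; apply: r_max; apply/asboolP; exists (k + 1)%N, (col_mx A u^T); split=> // l.
    case: (split_ordP l) => l' ->; first by rewrite rowKu.
    by rewrite rowKd (_ : row l' u^T = u^T) ?trmxK //; apply/rowP => a; rewrite !mxE ord1.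
  rewrite (geq_leqif (mxrank_leqif_sup sAC)) => sCA.
  by rewrite (submx_trans _ sCA) // -addsmxE addsmxSr.
have IA' w : I (w *m A)^T.
  rewrite mulmx_sum_row linear_sum /=; apply: (big_ind I) => // [u v Iu Iv|l _].
    by rewrite -[u]scale1r; apply: Ilin.
  by rewrite linearZ /= -[_ *: _]addr0; apply: Ilin.
(* The rows of [B] form a basis of the functionals vanishing on [I], so [B] is the projection onto
   the quotient. *)
have [B Bfree eqB] : exists2 B : 'M_(\rank (kermx A^T), n),
    row_free B & (B :=: kermx A^T)%MS.
  by exists (row_base (kermx A^T)); [apply: row_base_free | apply: eq_row_base].
have BA u : I u -> B *m u = 0.
  move=> /sub/submxP[w uE]; rewrite -[u]trmxK uE trmx_mul mulmxA.
  suff -> : B *m A^T = 0 by rewrite mul0mx.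
  by apply/eqP; rewrite -sub_kermx eqB.
have stable Z : (forall u, I u -> I (Z *m u)) -> exists Z', B *m Z = Z' *m B.
  move=> IZ; apply/submxP; rewrite eqB sub_kermx; apply/eqP.
  apply: mulmx_ext => w; rewrite mul0mx -!mulmxA. apply: BA; apply: IZ.
  by rewrite -[A^T *m w]trmxK trmx_mul trmxK.
have [X' BX] := stable X IX; have [Y' BY] := stable Y IY.
have XY' : X' *m Y' - Y' *m X' = 1%:M.
  apply: (row_free_inj Bfree); rewrite mul1mx mulmxBl -!mulmxA.
  by rewrite -BX -BY !mulmxA -BX -BY -!mulmxA -mulmxBr XY mulmxDr mulmx1 mulmxA BA // mul0mx addr0.
have : \tr (X' *m Y' - Y' *m X') = 0 by rewrite raddfB /= mxtrace_mulC subrr.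
rewrite XY' mxtrace1 => /eqP; rewrite (pcharf0P _).1 // mxrank_ker mxrank_tr subn_eq0 => rA'.
move=> u; have : (u^T <= A)%MS by apply: submx_full; rewrite -col_leq_rank.
by case/submxP=> w uE; rewrite -[u]trmxK uE; apply: IA'.
Qed.

End LinearAlgebra.

(** * The pair of maps ([pi], [h]) attached to matrices *)

Section Spread.
Variable F : fieldType.
Local Notation P := {poly {poly F}}.

Lemma scale_MXaddC (A : comNzRingType) (p : {poly A}) (a c : A) :
  a *: (p * 'X + c%:P) = a *: p * 'X + (a * c)%:P.
Proof. by rewrite -!mul_polyC polyCM; ring. Qed.

Lemma Cayley_Hamilton_iter n (A : 'M[F]_n) (v : 'cV[F]_n) :
  \sum_(k < size (char_poly A)) (char_poly A)`_k *: iter k (mulmx A) v = 0.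
Proof.
case: n A v => [|m] A v; first by apply/colP => -[].
have E (g : {poly F}) : \sum_(k < size g) g`_k *: iter k (mulmx A) v = horner_mx A g *m v.
  elim/poly_ind: g => [|g c IH]; first by rewrite size_poly0 big_ord0 rmorph0 mul0mx.
  have := @poly_sum_wide F _ (fun k => iter k (mulmx A) v) (g * 'X + c%:P) (size g).+1.
  rewrite /poly_sum => ->; last by rewrite size_MXaddC; case: ifP.
  have -> : horner_mx A (g * 'X + c%:P) = A *m horner_mx A g + c%:M.
    by rewrite mulrC rmorphD rmorphM /= horner_mx_X horner_mx_C.
  rewrite mulmxDl mul_scalar_mx.
  rewrite big_ord_recl coefD coefMX coefC add0r addrC; congr (_ + _).
  rewrite -mulmxA -IH mulmx_sumr; apply: eq_bigr => a _.
  by rewrite coefD coefMX coefC addr0 -scalemxAr.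
by rewrite E Cayley_Hamilton mul0mx.
Qed.

Lemma act_char_poly n (Y : 'M[F]_n) (pi : P -> 'cV[F]_n) p :
  {morph pi : p q / p + q} -> (forall (c : F) p, pi (c%:P *: p) = c *: pi p) ->
  (forall p, pi (p * 'X) = Y *m pi p) -> pi (p * (char_poly Y)^:P) = 0.
Proof.
move=> piD piZ pit; have pi0 : pi 0 = 0 by apply: (addrI (pi 0)); rewrite -piD !addr0.
suff E (g : {poly F}) : pi (p * g^:P : P) = \sum_(k < size g) g`_k *: iter k (mulmx Y) (pi p).
  by rewrite E Cayley_Hamilton_iter.
elim/poly_ind: g => [|g c IH]; first by rewrite rmorph0 mulr0 pi0 size_poly0 big_ord0.
have := @poly_sum_wide F _ (fun k => iter k (mulmx Y) (pi p)) (g * 'X + c%:P) (size g).+1.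
rewrite /poly_sum => ->; last by rewrite size_MXaddC; case: ifP.
rewrite big_ord_recl rmorphD rmorphM /= map_polyX map_polyC /= mulrDr mulrA piD.
rewrite pit IH [p * _]mulrC mul_polyC piZ addrC coefD coefMX coefC add0r.
congr (_ + _); rewrite mulmx_sumr; apply: eq_bigr => a _.
by rewrite coefD coefMX coefC addr0 -scalemxAr.
Qed.

(* [pi] sends [z^a t^b] to [Y^b X^a i], and the coefficient of [t^k] in
   [h p] is [j (pi (p div t^(k+1)))]. *)
Record spread n (X Y : 'M[F]_n) (i : 'cV[F]_n) (j : 'rV[F]_n)
    (pi : P -> 'cV[F]_n) (h : P -> {poly F}) : Prop := Spread {
  spD : {morph pi : p q / p + q};
  spZ : forall (c : F) p, pi (c%:P *: p) = c *: pi p;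
  sp_t : forall p, pi (p * 'X) = Y *m pi p;
  sp_z : forall c : {poly F}, pi (c * 'X)%:P = X *m pi c%:P;
  sp_1 : pi 1 = i;
  shD : {morph h : p q / p + q};
  shC : forall c : {poly F}, h c%:P = 0;
  sh_t : forall p, h (p * 'X) = h p * 'X + ((j *m pi p) 0 0)%:P
}.

Section Theory.
Variables (n : nat) (X Y : 'M[F]_n) (i : 'cV[F]_n) (j : 'rV[F]_n).
Variables (pi : P -> 'cV[F]_n) (h : P -> {poly F}).
Hypothesis sp : spread X Y i j pi h.

Lemma sp0 : pi 0 = 0.
Proof. by apply: (addrI (pi 0)); rewrite -(spD sp) !addr0. Qed.

Lemma sh0 : h 0 = 0.
Proof. exact: (shC sp). Qed.

Lemma spC (k : F) : pi k%:P%:P = k *: i.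
Proof. by rewrite -(sp_1 sp) -(spZ sp) -mul_polyC mulr1. Qed.

Lemma shZ (k : F) p : h (k%:P *: p) = k *: h p.
Proof.
elim/poly_ind: p => [|p c IH]; first by rewrite scaler0 sh0 scaler0.
rewrite scale_MXaddC !(shD sp) !(shC sp) !addr0 !(sh_t sp) IH.
by rewrite (spZ sp) -scalemxAr mxE scale_MXaddC.
Qed.

(** This becomes the order bound on [al] in a framing, when [al] is [h] composed with [r]. *)
Lemma sp_size p : (size (h p) <= (size p).-1)%N.
Proof.
elim/poly_ind: p => [|p c IH]; first by rewrite sh0 size_poly0.
rewrite (shD sp) (shC sp) addr0 (sh_t sp).
have [->|p0] := eqVneq p 0.
  by rewrite sh0 sp0 mulmx0 mxE mul0r addr0 size_poly0.
rewrite [size (p * _ + _)]size_MXaddC (negPf p0) /= size_MXaddC; case: ifP => // _.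
by rewrite (leq_ltn_trans IH) // prednK // size_poly_gt0.
Qed.

Lemma sp_polyC_iter (c : {poly F}) : pi c%:P = \sum_(k < size c) c`_k *: iter k (mulmx X) i.
Proof.
elim/poly_ind: c => [|c k IH]; first by rewrite sp0 size_poly0 big_ord0.
have := @poly_sum_wide F _ (fun k => iter k (mulmx X) i) (c * 'X + k%:P) (size c).+1.
rewrite /poly_sum => ->; last by rewrite size_MXaddC; case: ifP.
rewrite big_ord_recl polyCD (spD sp) (sp_z sp) IH spC addrC coefD coefMX coefC add0r.
congr (_ + _); rewrite mulmx_sumr; apply: eq_bigr => a _.
by rewrite coefD coefMX coefC addr0 -scalemxAr.
Qed.

Lemma sp_char_z : pi (char_poly X)%:P = 0.
Proof. by rewrite sp_polyC_iter Cayley_Hamilton_iter. Qed.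

Lemma sp_char_t p : pi (p * (char_poly Y)^:P) = 0.
Proof. exact: (act_char_poly _ (spD sp) (spZ sp) (sp_t sp)). Qed.

(** [h] is the polynomial part of an [F(d)]-linear map with residue [j *m pi p]. Multiplying by [g],
    of degree at most [N.+1], adds to [h p * g] the polynomial part [R] of [g] times the fractional
    part. *)
Lemma sh_mul p (g : {poly F}) N : (size g <= N.+2)%N ->
  exists R : {poly F}, [/\ h (p * g^:P) = h p * g + R, (size R <= N.+1)%N &
    R`_N = g`_N.+1 * (j *m pi p) 0 0].
Proof.
elim/poly_ind: g N => [|g c IH] N szg.
  by exists 0; rewrite rmorph0 mulr0 sh0 mulr0 addr0 size_poly0 !coef0 mul0r.
have {IH} [R [hR szR coR]] : exists R : {poly F}, [/\ h (p * g^:P) = h p * g + R,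
    (size R <= N)%N & N.-1.+1 = N -> R`_N.-1 = g`_N * (j *m pi p) 0 0].
  have szg' := size_MXaddC_pred szg; case: N szg szg' => [|N] szg szg'.
    exists 0; split=> //; last by rewrite size_poly0.
    rewrite (size1_polyC szg') map_polyC /= [p * _]mulrC mul_polyC shZ addr0.
    by rewrite [_ * _%:P]mulrC mul_polyC.
  by have [R [? ? ?]] := IH N szg'; exists R.
have E : p * (g * 'X + c%:P)^:P = p * g^:P * 'X + c%:P *: p.
  by rewrite rmorphD rmorphM /= map_polyX map_polyC /= mulrDr mulrA [p * c%:P%:P]mulrC mul_polyC.
exists (R * 'X + ((j *m pi (p * g^:P)) 0 0)%:P).
rewrite E (shD sp) (sh_t sp) shZ hR -mul_polyC; split.
- by ring.
- by rewrite size_MXaddC; case: ifP => // _; rewrite ltnS.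
rewrite !coefD !coefMX !coefC; case: N szg szR coR => [|N] szg szR coR /=.
  have szg' := size_MXaddC_pred szg; rewrite add0r addr0.
  rewrite {1}(size1_polyC szg') map_polyC /= [p * _]mulrC mul_polyC (spZ sp).
  by rewrite -scalemxAr mxE.
by rewrite !addr0 coR.
Qed.

Hypothesis XY : X *m Y - Y *m X = 1%:M + i *m j.

Let lift_act p : P := 'X *: p + p^`() + (h p)^:P.

Let ij_pi p : i *m (j *m pi p) = (j *m pi p) 0 0 *: i.
Proof. by rewrite {1}[j *m _]mx11_scalar mul_mx_scalar. Qed.

Let lift_actS p (c : {poly F}) : lift_act (p * 'X + c%:P) =
  lift_act p * 'X + p + ((j *m pi p) 0 0)%:P%:P + (c * 'X)%:P.
Proof.
rewrite /lift_act (shD sp) (shC sp) addr0 (sh_t sp) derivD derivM derivX derivC mulr1 addr0.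
rewrite rmorphD rmorphM /= map_polyX map_polyC /= -!mul_polyC; ring.
Qed.

(** Right multiplication by [z], corrected by [h], corresponds to [X]. Passing it across [d] leaves
    [p] and the residue, which match the terms [Id] and [i j] of the commutator. *)
Lemma sp_act_z p : pi ('X *: p + p^`() + (h p)^:P) = X *m pi p.
Proof.
rewrite -/(lift_act p); elim/poly_ind: p => [|p c IH].
  by rewrite /lift_act scaler0 deriv0 sh0 rmorph0 !addr0 sp0 mulmx0.
rewrite lift_actS !(spD sp) !(sp_t sp) (sp_z sp) IH spC mulmxDr; congr (_ + _).
have -> : X *m (Y *m pi p) = (Y *m X + (1%:M + i *m j)) *m pi p.
  by rewrite -XY addrC subrK mulmxA.
by rewrite !mulmxDl mul1mx -!mulmxA ij_pi addrA.
Qed.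

Hypothesis char0 : [pchar F] =i pred0.

Lemma sp_surj w : exists p, pi p = w.
Proof.
apply: (cyclic_vector char0 XY (I := fun u => exists p, pi p = u)).
- by move=> a u v [p <-] [q <-]; exists (a%:P *: p + q); rewrite (spD sp) (spZ sp).
- by exists 1; apply: (sp_1 sp).
- by move=> u [p <-]; exists (lift_act p); apply: sp_act_z.
- by move=> u [p <-]; exists (p * 'X); apply: (sp_t sp).
Qed.

End Theory.

Section Shift.
Variables (n : nat) (j : 'rV[F]_n) (pi : P -> 'cV[F]_n).
Hypothesis piD : {morph pi : p q / p + q}.

(** The closed solution of the recursion [sh_t]; coordinate functionals in place of [j] give the
    components of [shift_vector]. *)
Definition shift_functional (p : P) : {poly F} :=
  \poly_(k < size p) (j *m pi (drop_poly k.+1 p)) 0 0.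

Let pi0 : pi 0 = 0.
Proof. by apply: (addrI (pi 0)); rewrite -piD !addr0. Qed.

Lemma coef_shift_functional (p : P) k :
  (shift_functional p)`_k = (j *m pi (drop_poly k.+1 p)) 0 0.
Proof.
rewrite coef_poly; case: ltnP => // le_pk.
by rewrite drop_poly_eq0 ?(leq_trans le_pk) // pi0 mulmx0 mxE.
Qed.

Lemma shift_functionalD : {morph shift_functional : p q / p + q}.
Proof.
by move=> p q; apply/polyP => k; rewrite coefD !coef_shift_functional raddfD piD mulmxDr mxE.
Qed.

Lemma shift_functionalC (c : {poly F}) : shift_functional c%:P = 0.
Proof.
apply/polyP => k; rewrite coef_shift_functional coef0 drop_poly_eq0 ?pi0 ?mulmx0 ?mxE //.
by rewrite (leq_trans (size_polyC_leq1 _)).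
Qed.

Lemma shift_functional_t (p : P) :
  shift_functional (p * 'X) = shift_functional p * 'X + ((j *m pi p) 0 0)%:P.
Proof.
apply/polyP => k; rewrite coefD coefMX coefC !coef_shift_functional.
have -> : drop_poly k.+1 (p * 'X) = drop_poly k p.
  by apply/polyP => l; rewrite !coef_drop_poly coefMX addnS.
by case: k => [|k] /=; rewrite ?addr0 // drop_poly0l add0r.
Qed.

End Shift.

Lemma spread_exists n (X Y : 'M[F]_n) (i : 'cV[F]_n) (j : 'rV[F]_n) :
  exists pi h, spread X Y i j pi h.
Proof.
pose f c := poly_sum (fun k => iter k (mulmx X) i) c.
pose pi (p : P) := \sum_(k < size p) iter k (mulmx Y) (f p`_k).
have fD c e : f (c + e) = f c + f e by rewrite /f raddfD.
have f0 : f 0 = 0 by rewrite /f raddf0.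
have itD k (u v : 'cV[F]_n) : iter k (mulmx Y) (u + v) = iter k (mulmx Y) u + iter k (mulmx Y) v.
  by elim: k => //= k ->; rewrite mulmxDr.
have it0 k : iter k (mulmx Y) 0 = 0 :> 'cV[F]_n by elim: k => //= k ->; rewrite mulmx0.
have wide (p : P) N : (size p <= N)%N -> pi p = \sum_(k < N) iter k (mulmx Y) (f p`_k).
  move=> le_pN; rewrite /pi (big_ord_widen N (fun k => iter k (mulmx Y) (f p`_k))) //.
  rewrite big_mkcond; apply: eq_bigr => k _; case: ltnP => // le_pk.
  by rewrite nth_default // f0 it0.
have piD (p q : P) : pi (p + q) = pi p + pi q.
  pose N := maxn (size (p + q)) (maxn (size p) (size q)).
  rewrite !(wide _ N) /N ?leq_max ?leqnn ?orbT // -big_split.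
  by apply: eq_bigr => k _; rewrite coefD fD itD.
have pit (p : P) : pi (p * 'X) = Y *m pi p.
  rewrite (wide _ (size p).+1); last first.
    by rewrite (leq_trans (size_polyMleq _ _)) // size_polyX addn2.
  rewrite big_ord_recl coefMX /= f0 add0r mulmx_sumr; apply: eq_bigr => k _.
  by rewrite coefMX.
have piC (c : {poly F}) : pi c%:P = f c.
  by rewrite (wide _ 1%N) ?size_polyC_leq1 // big_ord1 coefC.
exists pi, (shift_functional j pi); split=> //; last exact: shift_functional_t.
- move=> c p; elim/poly_ind: p => [|p e IH].
    by rewrite scaler0 [pi 0]big1 ?scaler0 // => -[? /=]; rewrite size_poly0.
  rewrite scale_MXaddC !piD !pit !piC IH -scalemxAr scalerDr.
  by rewrite /f mul_polyC linearZ.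
- move=> c; rewrite !piC /f poly_sumMX /poly_sum mulmx_sumr; apply: eq_bigr => k _ /=.
  by rewrite -scalemxAr.
- by rewrite -polyC1 piC /f -polyC1 poly_sumC scale1r.
- exact: shift_functionalD.
- exact: shift_functionalC.
Qed.

Lemma spread_linear n (X Y : 'M[F]_n) i j pi h : spread X Y i j pi h ->
  linear (pi : weyl F -> 'cV[F]_n).
Proof. by move=> sp c p q; rewrite [LHS](spD sp) -(spZ sp). Qed.

Lemma invmxM n (A B : 'M[F]_n) : A \in unitmx -> B \in unitmx ->
  invmx (A *m B) = invmx B *m invmx A.
Proof.
move=> uA uB; have uAB : A *m B \in unitmx by rewrite unitmx_mul uA.
have E : A *m B *m (invmx B *m invmx A) = 1%:M by rewrite mulmxA mulmxK // mulmxV.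
by rewrite -[RHS](mulKmx uAB) E mulmx1.
Qed.

Lemma conj_orbit_conj n (g X Y : 'M[F]_n) : g \in unitmx ->
  conj_orbit (g *m X *m invmx g, g *m Y *m invmx g) = conj_orbit (X, Y).
Proof.
move=> ug; apply/predeqP => -[A B]; split=> -[/= k [uk E]].
  exists (k *m g); rewrite unitmx_mul uk; split=> //.
  by rewrite invmxM // E !mulmxA.
exists (k *m invmx g); rewrite unitmx_mul uk unitmx_inv; split=> //.
by rewrite invmxM ?unitmx_inv // invmxK E !mulmxA !(mulmxKV ug).
Qed.

(** Equal kernels make [pi] and [pi'] differ by an invertible [G], which conjugates [Y]. Conjugating
    [X] also requires [h = h'] off the kernel. *)
Lemma spread_conj n n' (X Y : 'M[F]_n) (X' Y' : 'M[F]_n') i j i' j' pi h pi' h' :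
  [pchar F] =i pred0 ->
  X *m Y - Y *m X = 1%:M + i *m j -> X' *m Y' - Y' *m X' = 1%:M + i' *m j' ->
  spread X Y i j pi h -> spread X' Y' i' j' pi' h' ->
  (forall p, pi p = 0 <-> pi' p = 0) -> (forall p, pi p = 0 -> h p = h' p) ->
  cm_point (X, Y) = cm_point (X', Y').
Proof.
move=> char0 XY XY' sp sp' ker hE.
have surj := sp_surj sp XY char0; have surj' := sp_surj sp' XY' char0.
have [G GE] := linear_factor (spread_linear sp) (spread_linear sp') surj
  (fun v => proj1 (ker v)).
have [G' GE'] := linear_factor (spread_linear sp') (spread_linear sp) surj'
  (fun v => proj2 (ker v)).
have GG' : G' *m G = 1%:M.
  by apply: mulmx_ext => w; have [p <-] := surj w; rewrite -mulmxA -GE -GE' mul1mx.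
have G'G : G *m G' = 1%:M.
  by apply: mulmx_ext => w; have [p <-] := surj' w; rewrite -mulmxA -GE' -GE mul1mx.
have nn' : n = n'.
  apply/eqP; rewrite eqn_leq -{1}(mxrank1 F n) -GG' -[X in _ && (X <= _)%N](mxrank1 F n') -G'G.
  by rewrite !(leq_trans (mxrankM_maxr _ _) (rank_leq_row _)).
subst n'.
(* Multiplication by [char_poly Y] moves any [p] into the kernel; the remainders from [sh_mul] have
   smaller degree, so division recovers [h p]. For [n = 0] every [p] is in the kernel already. *)
have hh p : h p = h' p.
  case: n X Y i j X' Y' i' j' pi pi' sp sp' XY XY' ker hE {surj surj' G GE G' GE' GG' G'G}
    => [|N] X Y i j X' Y' i' j' pi pi' sp sp' XY XY' ker hE.
    by apply: hE; apply/colP => -[].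
  have szc : (size (char_poly Y) <= N.+2)%N by rewrite size_char_poly.
  have [R [E szR _]] := sh_mul sp p szc; have [R' [E' szR' _]] := sh_mul sp' p szc.
  have := hE _ (sp_char_t sp p); rewrite E E' => /(congr1 (fun f => f %/ char_poly Y)).
  by rewrite !divp_addl_mul_small // size_char_poly ltnS.
have ug : G \in unitmx by case/mulmx1_unit: G'G.
have XE : G *m X = X' *m G.
  apply: mulmx_ext => w; have [p <-] := surj w.
  by rewrite -!mulmxA -GE -(sp_act_z sp XY) -(sp_act_z sp' XY') -GE hh.
have YE : G *m Y = Y' *m G.
  apply: mulmx_ext => w; have [p <-] := surj w.
  by rewrite -!mulmxA -GE -(sp_t sp) -(sp_t sp') -GE.
rewrite /cm_point -(conj_orbit_conj X Y ug) XE YE !mulmxK //.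
Qed.

End Spread.

(** * From a framing to a pair of matrices *)

Section Reconstruction.
Variables (F : fieldType) (D : algType F) (z d : D).
Local Notation P := {poly {poly F}}.
Variable th : D -> P.
Hypothesis ord : normal_ordering z d th.
Local Notation zp := (horner_alg z).

(** These conditions determine [M] from the matrices: its elements are those of [ker pi], and [h]
    supplies the action of [z]. *)
Definition realizes n (X Y : 'M[F]_n) (i : 'cV[F]_n) (j : 'rV[F]_n) (M : lmodType D^c) :=
  exists r pi h, [/\ spread X Y i j pi h, framed z d r (fun m : M => h (r m)),
    forall m, r m = 0 -> m = 0 & forall p, pi p = 0 <-> exists m, r m = p].

(** The normalisation comes from characteristic polynomials: that of [X], in [z], gives an element
    of order zero, and multiples of that of [Y], in [d], have any prescribed leading coefficient in
    order [n]. *)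
Lemma realizes_framing n (X Y : 'M[F]_n) i j (M : lmodType D^c) r pi h :
  spread X Y i j pi h -> framed z d r (fun m : M => h (r m)) ->
  (forall m, r m = 0 -> m = 0) -> (forall p, pi p = 0 <-> exists m, r m = p) ->
  framing z d r (fun m => h (r m)).
Proof.
move=> sp fr r_inj ker; split=> //.
- by move=> m; apply: sp_size sp _.
- have /ker[m rm] := sp_char_z sp; exists m.
  by rewrite rm size_polyC monic_neq0 // char_poly_monic.
- exists n => c; have /ker[m rm] := sp_char_t sp c%:P; exists m; rewrite rm mul_polyC.
  have szc : size (char_poly Y)^:P = n.+1 by rewrite size_map_polyC size_char_poly.
  rewrite (leq_trans (size_scale_leq _ _)) ?szc // coefZ coef_map /=.
  have /monicP : char_poly Y \is monic by apply: char_poly_monic.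
  by rewrite /lead_coef size_char_poly /= => ->; rewrite mulr1.
Qed.

Lemma weyl_relation : d * z = z * d + 1.
Proof.
have rel := fr_z (framed_regular ord) d; apply: (th_inj ord).
rewrite (thD ord) (th_zl ord) (th1 ord) [LHS]rel rmorph0 addr0; congr (_ + _).
by rewrite -[d]mul1r (th_dr ord) (th1 ord) mul1r derivX.
Qed.

Section Framed.
Variables (M : lmodType D^c) (r : M -> P) (al : M -> {poly F}).
Hypothesis fr : framed z d r al.

Let polyC_poly_inj : injective (fun p : {poly F} => p^:P).
Proof. exact: (map_inj_poly (@polyC_inj F) (rmorph0 _)). Qed.

Let alE m : (al m)^:P = r (m ** z) - ('X *: r m + (r m)^`()).
Proof. by rewrite (fr_z fr) addrC addKr. Qed.

Lemma fr_alD m n : al (m + n) = al m + al n.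
Proof.
apply: polyC_poly_inj; rewrite /= rmorphD /= !alE scalerDr !(frD fr) derivD scalerDr.
by rewrite -!mul_polyC; ring.
Qed.

Lemma fr_alZ (c : F) m : al (m ** c%:A) = c *: al m.
Proof.
apply: polyC_poly_inj; rewrite /= map_polyZ /= !alE (frZ fr).
have -> : m ** c%:A ** z = m ** z ** c%:A.
  by rewrite -!actM mulr_algl mulr_algr.
by rewrite (frZ fr) derivZ -!mul_polyC; ring.
Qed.

(** As [al] is recovered from [r], the relation [d * z = z * d + 1] gives linearity over [F[d]],
    which is what lets [al] be extended over [F(d)]. *)
Lemma fr_al_d m : al (m ** d) = al m * 'X.
Proof.
apply: polyC_poly_inj; rewrite /= rmorphM /= map_polyX !alE.
rewrite -(actM m d z) weyl_relation actD act1 actM (frD fr) !(fr_d fr) derivM derivX.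
by rewrite -!mul_polyC; ring.
Qed.

Lemma fr_al0 : al 0 = 0.
Proof. by apply: (addrI (al 0)); rewrite -fr_alD !addr0. Qed.

Lemma fr_al_dp m (g : {poly F}) : al (m ** horner_alg d g) = al m * g.
Proof.
elim/poly_ind: g m => [|g k IH] m; first by rewrite !rmorph0 mulr0 act0 fr_al0.
rewrite !rmorphD !rmorphM /= horner_algX horner_algC actD mulrDr fr_alD actM fr_al_d.
by rewrite IH fr_alZ mulrA [al m * k%:P]mulrC mul_polyC.
Qed.

End Framed.

(** Modulo the image of [r], orders from [N] on are removed by the condition [fg_top]; below [N],
    coefficients are reduced modulo the order-zero element [l0]. Finitely many monomials remain. *)
Lemma framing_finite_codimension (M : lmodType D^c) r al : framing z d (M := M) r al ->
  exists n (pi : weyl F -> 'cV[F]_n), [/\ linear pi,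
    forall v, pi v = 0 <-> exists m, r m = v & forall w, exists v, pi v = w].
Proof.
case=> fr al_lt r_inj [m0 sz0] [N top].
pose U (p : weyl F) := exists m, r m = p.
have U0 : U 0 by exists 0; apply: fr0 fr.
have UD x y : U x -> U y -> U (x + y) by move=> [m <-] [n <-]; exists (m + n); apply: frD fr _ _.
have UZ a x : U x -> U (a *: x) by move=> [m <-]; exists (m ** a%:A); rewrite (frZ fr).
pose l0 := (r m0)`_0.
have r0E : r m0 = l0%:P by apply: size1_polyC; rewrite sz0.
have l00 : l0 != 0 by apply/eqP => l00; move: sz0; rewrite r0E l00 size_poly0.
pose s (t : 'I_N * 'I_(size l0)) : weyl F := ('X^(t.2))%:P * 'X^(t.1) : P.
pose W (p : weyl F) := exists c : 'I_N * 'I_(size l0) -> F, U (p - \sum_t c t *: s t).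
have WD x y : W x -> W y -> W (x + y).
  move=> [b Ub] [c Uc]; exists (fun t => b t + c t); have := UD _ _ Ub Uc; congr U.
  by rewrite addrACA -opprD -big_split; congr (_ - _); apply: eq_bigr => t _; rewrite scalerDl.
have WU x : U x -> W x.
  by move=> Ux; exists (fun=> 0); rewrite big1 ?subr0 // => t _; rewrite scale0r.
have Ws a t : W (a *: s t).
  exists (fun t' => if t' == t then a else 0).
  rewrite (bigD1 t) //= eqxx big1 ?addr0 ?subrr // => t' /negPf->.
  by rewrite scale0r.
have Wt (c : {poly F}) (t : 'I_N) : (size c <= size l0)%N -> W (c%:P * 'X^t : P).
  move=> szc.
  have sE (a : 'I_(size l0)) : (c`_a *: 'X^a)%:P * 'X^t = (c`_a *: s (t, a) : weyl F) :> P.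
    rewrite [RHS](_ : _ = (c`_a)%:P *: (('X^a)%:P * 'X^t : P)) //.
    by rewrite -[in RHS]mul_polyC -mul_polyC polyCM mulrA.
  have -> : (c%:P * 'X^t : P) = \sum_(a < size l0) (c`_a *: s (t, a) : weyl F).
    rewrite -{1}(coefK c) poly_def (big_ord_widen (size l0) (fun a => c`_a *: 'X^a)) //.
    rewrite big_mkcond /= rmorph_sum mulr_suml; apply: eq_bigr => a _ /=.
    rewrite -sE; case: ltnP => // le_ca.
    by rewrite nth_default // scale0r.
  by apply: (big_ind W) => //; apply: WU.
have Wall p : W p.
  have [k le_k] := ubnP (size (p : P)); elim: k p le_k => // k IH p le_k.
  have [p0|p0] := eqVneq (p : P) 0; first by rewrite p0; apply: WU.
  have szp : (0 < size (p : P))%N by rewrite size_poly_gt0.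
  pose S := (size (p : P)).-1; have szS : size (p : P) = S.+1 by rewrite prednK.
  have ltSk : (S < k)%N by rewrite -ltnS -szS.
  have step (x : P) : W x -> (size x <= S.+1)%N -> x`_S = (p : P)`_S -> W p.
    move=> Wx szx co; rewrite -(subrK x p : _ = p :> P); apply: WD => //; apply: IH.
    apply: leq_ltn_trans ltSk; apply: size_poly_pred; last by rewrite coefB co subrr.
    by rewrite (leq_trans (size_polyD _ _)) // size_polyN geq_max szx szS leqnn.
  have [le_NS|lt_SN] := leqP N S.
    have [m [szm com]] := top (p : P)`_S.
    apply: (step (r m * 'X^(S - N))).
    - by apply: WU; exists (m ** d ^+ (S - N)); rewrite (fr_dX fr).
    - rewrite (leq_trans (size_polyMleq _ _)) // size_polyXn addnS /=.
      by rewrite (leq_trans (leq_add szm (leqnn _))) // addSn subnKC.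
    - by rewrite coefMXn ltnNge leq_subr /= subKn.
  pose q := (p : P)`_S %/ l0; pose e := (p : P)`_S %% l0.
  apply: (step ((q * l0 + e)%:P * 'X^S)).
  - rewrite polyCD mulrDl; apply: WD; last first.
      by apply: (Wt e (Ordinal lt_SN)); rewrite ltnW // ltn_modp.
    apply: WU; exists (m0 ** zp q ** d ^+ S); rewrite (fr_dX fr); congr (_ * _).
    have [sz co] := fr_zp_coef fr al_lt q (eq_leq sz0).
    by rewrite (size1_polyC sz) co.
  - by rewrite mul_polyC (leq_trans (size_scale_leq _ _)) // size_polyXn.
  - by rewrite mul_polyC coefZ coefXn eqxx mulr1 -divp_eq.
have span : spans_mod U (fun a : 'I_#|{: 'I_N * 'I_(size l0)}| => s (enum_val a)).
  move=> p; have [c Uc] := Wall p; exists (fun a => c (enum_val a)).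
  by rewrite -(big_enum_val (A := [pred _ : _ * _ | true]) (fun t => c t *: s t)).
have [n [pi [pi_lin ker surj]]] := finite_codimension U0 UD UZ span.
by exists n, pi.
Qed.

(* [X] is right multiplication by [z] corrected by [h], where [h] is the
   polynomial part of the extension of [al] to a [F(d)]-linear map on [F[z](d)];
   the residue of that extension is the functional [j]. *)
Lemma framing_realizes (M : lmodType D^c) r al : framing z d (M := M) r al ->
  exists n (X Y : 'M[F]_n) i j, X *m Y - Y *m X = 1%:M + i *m j /\
    realizes X Y i j M.
Proof.
move=> frm; have [n [pi [pi_lin ker surj]]] := framing_finite_codimension frm.
case: frm => fr al_lt r_inj _ _.
have piD (p q : P) : pi (p + q) = pi p + pi q.
  by have := pi_lin 1 p q; rewrite !scale1r.
have pi0 : pi 0 = 0 by apply: (addrI (pi 0)); rewrite -piD !addr0.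
have piZ (c : F) (p : P) : pi (c%:P *: p) = c *: pi p.
  by rewrite -[_ *: p]addr0 [LHS]pi_lin pi0 addr0.
have [||Y YE] := @linear_factor F _ n n pi (fun p => pi ((p : P) * 'X)) pi_lin _ surj.
- move=> a p q; have -> : ((a *: p + q : weyl F) : P) * 'X = a%:P *: ((p : P) * 'X) + (q : P) * 'X.
    by rewrite mulrDl scalerAl.
  by rewrite piD piZ.
- by move=> v /ker[m rm]; apply/ker; exists (m ** d); rewrite (fr_d fr) rm.
pose chi := char_poly Y; have chi_monic : chi \is monic by apply: char_poly_monic.
have chi0 : chi != 0 by apply: monic_neq0.
have chiX : (size chi).-1 = n by rewrite size_char_poly.
(* [chi] kills the quotient, so [p * chi] is the polynomial part of an element of [M]; applying [al]
   and dividing by [chi] extends [al] to [p]. *)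
have lift p : exists m, r m = p * chi^:P.
  by apply/ker; apply: act_char_poly.
pose lf p := sval (cid (lift p)).
have lfE p : r (lf p) = p * chi^:P by exact: (svalP (cid (lift p))).
have r_injective m n' : r m = r n' -> m = n'.
  by move=> E; apply/eqP; rewrite -subr_eq0; apply/eqP/r_inj; rewrite (frB fr) E subrr.
pose A p := al (lf p).
have AD p q : A (p + q) = A p + A q.
  rewrite /A -(fr_alD fr); congr al; apply: r_injective.
  by rewrite (frD fr) !lfE mulrDl.
have AZ (c : F) p : A (c%:P *: p) = c *: A p.
  rewrite /A -(fr_alZ fr); congr al; apply: r_injective.
  by rewrite (frZ fr) !lfE scalerAl.
have At p : A (p * 'X) = 'X * A p.
  rewrite /A [RHS]mulrC -(fr_al_d fr); congr al; apply: r_injective.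
  by rewrite (fr_d fr) !lfE mulrAC.
have Ar m : A (r m) = al m * chi.
  rewrite /A -(fr_al_dp fr); congr al; apply: r_injective.
  by rewrite (fr_dp fr) !lfE.
pose h p := A p %/ chi; pose jf p := (A p %% chi)`_(size chi).-2 / lead_coef chi.
have hD p q : h (p + q) = h p + h q by rewrite /h AD divpD.
have hZ (c : F) p : h (c%:P *: p) = c *: h p by rewrite /h AZ divpZl.
have ht p : h (p * 'X) = h p * 'X + (jf p)%:P by rewrite /h At divp_Xl // mulrC.
have hr m : h (r m) = al m by rewrite /h Ar mulpK.
(* The lift of [c] has order at most [n], so its [al] has degree below [n], the degree of [chi]. *)
have hC (c : {poly F}) : h c%:P = 0.
  rewrite /h divp_small //; apply: leq_ltn_trans (al_lt _) _; rewrite lfE mul_polyC.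
  have szc : (size (c *: chi^:P) <= n.+1)%N.
    by rewrite (leq_trans (size_scale_leq _ _)) // size_map_polyC size_char_poly.
  by rewrite size_char_poly ltnS -ltnS; case: size szc.
(* On [r m] the value of [A] is a multiple of [chi], so the residue vanishes there and passes to the
   quotient. *)
have [||j jE] := @linear_factor F _ n 1 pi (fun p => (jf p)%:M) pi_lin _ surj.
- move=> a p q; apply/colP => k; rewrite !mxE ord1 eqxx !mulr1n.
  rewrite /jf AD -[a *: p]/(a%:P *: (p : P)) AZ modpD modpZl coefD coefZ.
  by rewrite mulrDl mulrA.
- move=> v /ker[m <-]; apply/colP => k; rewrite !mxE /jf Ar modp_mull coef0 mul0r.
  by rewrite mul0rn.
have jE' p : jf p = (j *m pi p) 0 0 by rewrite -jE mxE eqxx mulr1n.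
pose act p : P := 'X *: p + p^`() + (h p)^:P.
have actD p q : act (p + q) = act p + act q.
  by rewrite /act hD rmorphD /= derivD -!mul_polyC; ring.
have actZ' (c : F) p : act (c%:P *: p) = c%:P *: act p.
  by rewrite /act hZ map_polyZ /= derivZ -!mul_polyC; ring.
have actt p : act (p * 'X) = act p * 'X + p + (jf p)%:P%:P.
  rewrite /act ht rmorphD rmorphM /= map_polyX map_polyC /= derivM derivX -!mul_polyC; ring.
have [||X XE] := @linear_factor F _ n n pi (fun p => pi (act p)) pi_lin _ surj.
- by move=> a p q; rewrite -[a *: p]/(a%:P *: (p : P)) actD actZ' piD piZ.
- by move=> v /ker[m <-]; apply/ker; exists (m ** z); rewrite (fr_z fr) /act hr.
have spr : spread X Y (pi (1 : P)) j pi h.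
  split=> //; last by move=> p; rewrite ht jE'.
  move=> c; rewrite -XE /act hC rmorph0 addr0 derivC addr0 mulrC polyCM.
  by rewrite mul_polyC.
exists n, X, Y, (pi (1 : P)), j; split; last first.
  exists r, pi, h; split=> //; case: fr => frD' frZ' fr_d' fr_z'.
  by split=> // m; rewrite fr_z' hr.
(* As [pi] is onto, the commutator is read off from [actt], whose two extra terms become [Id] and
   [i j]. *)
suff key (p : P) : (X *m Y - Y *m X) *m pi p = (1%:M + pi (1 : P) *m j) *m pi p.
  by apply: mulmx_ext => w; have [p <-] := surj w; apply: key.
have XYp : X *m Y *m pi p = pi (act (p * 'X)) by rewrite -mulmxA -YE -XE.
have YXp : Y *m X *m pi p = pi (act p * 'X : P) by rewrite -mulmxA -XE -YE.
have ijp : pi (1 : P) *m j *m pi p = pi ((jf p)%:P%:P).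
  by rewrite -mulmxA -jE mul_mx_scalar -piZ -mul_polyC mulr1.
rewrite mulmxBl mulmxDl mul1mx XYp YXp ijp actt !piD -!addrA addrC.
by rewrite addrA addrNK addrC.
Qed.

End Reconstruction.

(** * The module of a pair and its monad *)

Section AdjugateSize.
Variable F : fieldType.

(** A minor is a sum of products of [n - 1] entries of degree at most one. The result stays below
    the degree [n] of [char_poly A], which all later degree comparisons exploit. *)
Lemma size_adj_char_poly_mx n (A : 'M[F]_n) k l :
  (size (\adj (char_poly_mx A) k l) <= n)%N.
Proof.
rewrite mxE /cofactor; case: n A k l => [A [] //|n A k l].
rewrite size_Msign /determinant.
apply: leq_trans (size_sum _ _ _) _; apply/bigmax_leqP => s _.
rewrite size_Msign (leq_trans (size_prod_leq _ _)) //.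
rewrite leq_subLR card_ord addnS ltnS.
apply: (@leq_trans (\sum_(i < n) 2)%N); last by rewrite sum_nat_const card_ord muln2 -addnn.
apply: leq_sum => i _; rewrite !mxE (leq_trans (size_polyD _ _)) // geq_max size_polyN.
rewrite (leq_trans (size_polyC_leq1 _)) // andbT.
by case: (_ == _); rewrite ?mulr1n ?mulr0n ?size_polyX ?size_poly0.
Qed.

End AdjugateSize.

(** * The right ideal of a pair *)

Section IdealOfPair.
Variable F : fieldType.
Local Notation P := {poly {poly F}}.
Variables (n : nat) (X Y : 'M[F]_n) (i : 'cV[F]_n) (j : 'rV[F]_n).
Variables (pi : P -> 'cV[F]_n) (h : P -> {poly F}).
Hypothesis sp : spread X Y i j pi h.

(** As a vector of polynomials in [d], this is the quotient of [i p] on division by [d - Y], with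
    [z] acting through [X] and remainder [pi p]; [monad_lift] makes this precise. *)
Definition shift_vector (p : P) : 'cV[{poly F}]_n :=
  \col_k shift_functional (delta_mx 0 k) pi p.

Local Notation q := shift_vector.

Lemma shift_vectorD p p' : q (p + p') = q p + q p'.
Proof. by apply/colP => k; rewrite !mxE (shift_functionalD _ (spD sp)). Qed.

Lemma shift_vectorC (c : {poly F}) : q c%:P = 0.
Proof. by apply/colP => k; rewrite !mxE (shift_functionalC _ (spD sp)). Qed.

Lemma shift_vector_t (p : P) : q (p * 'X) = 'X *: q p + map_mx polyC (pi p).
Proof.
apply/colP => k; rewrite !mxE (shift_functional_t _ (spD sp)) mulrC.
by rewrite -rowE !mxE.
Qed.

Lemma sh_shift_vector p : h p = (map_mx polyC j *m q p) 0 0.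
Proof.
elim/poly_ind: p => [|p c IH]; first by rewrite (sh0 sp) -polyC0 shift_vectorC mulmx0 mxE.
rewrite (shD sp) (shC sp) (sh_t sp) IH shift_vectorD shift_vectorC !addr0 shift_vector_t.
by rewrite mulmxDr -scalemxAr -map_mxM !mxE mulrC.
Qed.

(** This is [j (z - X)^-1] multiplied by [char_poly X] to clear denominators. *)
Definition ideal_row : 'rV[{poly F}]_n := map_mx polyC j *m \adj (char_poly_mx X).

Lemma ideal_rowX : ideal_row *m char_poly_mx X = char_poly X *: map_mx polyC j.
Proof. by rewrite -mulmxA mul_adj_mx mul_mx_scalar. Qed.

Lemma size_ideal_row k : (size (ideal_row 0 k)%R <= n)%N.
Proof.
rewrite mxE; apply: leq_trans (size_sum _ _ _) _; apply/bigmax_leqP => l _.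
by rewrite mxE mul_polyC (leq_trans (size_scale_leq _ _)) // size_adj_char_poly_mx.
Qed.

(* Up to the factor [char_poly X], the Laurent series
   [p + j (z - X)^-1 (q p)] with polynomial part [p]. *)
Definition ideal_elt (p : P) : P :=
  char_poly X *: p + \sum_k ideal_row 0 k *: (q p k 0)^:P.

Lemma ideal_eltD p p' : ideal_elt (p + p') = ideal_elt p + ideal_elt p'.
Proof.
rewrite /ideal_elt scalerDr addrACA -big_split shift_vectorD; congr (_ + _).
by apply: eq_bigr => k _; rewrite [fun_of_matrix (_ + _) _ _]mxE rmorphD /= scalerDr.
Qed.

Lemma ideal_elt0 : ideal_elt 0 = 0.
Proof. by apply: (addrI (ideal_elt 0)); rewrite -ideal_eltD !addr0. Qed.

(** The row has smaller degree in [z] than [char_poly X], so the second summand contributes nothing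
    to the quotient. *)
Lemma ideal_eltK p : map_poly (fun c => c %/ char_poly X) (ideal_elt p) = p.
Proof.
apply/polyP => b; rewrite coef_map_id0 ?div0p // coefD coefZ mulrC.
rewrite divp_addl_mul_small // size_char_poly ltnS coef_sum.
apply: leq_trans (size_sum _ _ _) _; apply/bigmax_leqP => k _.
rewrite coefZ coef_map /= mulrC mul_polyC.
by rewrite (leq_trans (size_scale_leq _ _)) // size_ideal_row.
Qed.

Lemma ideal_elt_t p : pi p = 0 -> ideal_elt (p * 'X) = ideal_elt p * 'X.
Proof.
move=> p0; rewrite /ideal_elt mulrDl scalerAl mulr_suml; congr (_ + _).
apply: eq_bigr => k _; rewrite shift_vector_t p0 map_mx0 addr0.
rewrite [fun_of_matrix (_ *: _) _ _]mxE rmorphM /= map_polyX.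
by rewrite mulrC scalerAl.
Qed.

Hypothesis XY : X *m Y - Y *m X = 1%:M + i *m j.

Lemma shift_vectorZ (c : F) (p : P) : q (c%:P *: p) = c%:P *: q p.
Proof.
elim/poly_ind: p => [|p e IH]; first by rewrite scaler0 -polyC0 shift_vectorC scaler0.
rewrite scale_MXaddC !shift_vectorD !shift_vectorC !addr0 !shift_vector_t IH (spZ sp).
by rewrite map_mxZ scalerDr !scalerA mulrC.
Qed.

Lemma shift_vector_act p : q ('X *: p + p^`() + (h p)^:P) =
  map_mx polyC X *m q p + map_mx (@deriv F) (q p).
Proof.
elim/poly_ind: p => [|p c IH].
  rewrite (sh0 sp) rmorph0 scaler0 deriv0 !addr0 -polyC0 shift_vectorC mulmx0 add0r.
  by apply/colP => k; rewrite !mxE deriv0.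
have -> : 'X *: (p * 'X + c%:P) + (p * 'X + c%:P)^`() + (h (p * 'X + c%:P))^:P =
    ('X *: p + p^`() + (h p)^:P) * 'X + p + (((j *m pi p) 0 0)%:P + c * 'X)%:P.
  rewrite (shD sp) (shC sp) addr0 (sh_t sp) derivD derivM derivX derivC mulr1 addr0.
  by rewrite rmorphD rmorphM /= map_polyX map_polyC /= polyCD polyCM -!mul_polyC; ring.
rewrite !shift_vectorD !shift_vectorC !addr0 !shift_vector_t IH (sp_act_z sp XY).
have E : map_mx (@deriv F) ('X *: q p + map_mx polyC (pi p)) = 'X *: map_mx (@deriv F) (q p) + q p.
  by apply/colP => k; rewrite !mxE derivD derivM derivX derivC mul1r addr0 addrC.
by rewrite E map_mxM mulmxDr -scalemxAr scalerDr -addrA addrACA.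
Qed.

Lemma ideal_eltZ (c : F) p : ideal_elt (c%:P *: p) = c%:P *: ideal_elt p.
Proof.
rewrite /ideal_elt scalerDr !scalerA mulrC scaler_sumr; congr (_ + _).
apply: eq_bigr => k _; rewrite shift_vectorZ.
rewrite [fun_of_matrix (_ *: _) _ _]mxE rmorphM /= map_polyC /= mul_polyC.
by rewrite !scalerA mulrC.
Qed.

(** By [ideal_rowX], the row times [X] is [z] times the row minus [char_poly X] times [j]; the last
    term cancels the correction [h]. *)
Lemma ideal_elt_z p : ideal_elt ('X *: p + p^`() + (h p)^:P) =
  'X *: ideal_elt p + (ideal_elt p)^`().
Proof.
rewrite /ideal_elt shift_vector_act.
have rowX l : \sum_k ideal_row 0 k * (X k l)%:P =
    'X * ideal_row 0 l - char_poly X * (j 0 l)%:P.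
  have := ideal_rowX; move: ideal_row => W /rowP/(_ l).
  rewrite /char_poly_mx mulmxBr mul_mx_scalar !mxE => E.
  by rewrite -E opprB addrC subrK; apply: eq_bigr => k _; rewrite mxE.
have sumX : \sum_k ideal_row 0 k *: ((map_mx polyC X *m q p) k 0)^:P =
    'X *: (\sum_k ideal_row 0 k *: (q p k 0)^:P) - char_poly X *: (h p)^:P.
  move: ideal_row rowX => W rowX.
  transitivity (\sum_l (\sum_k W 0 k * (X k l)%:P) *: (q p l 0)^:P).
    rewrite (eq_bigr (fun k => \sum_l (W 0 k * (X k l)%:P) *: (q p l 0)^:P)).
      by rewrite exchange_big; apply: eq_bigr => l _; rewrite scaler_suml.
    move=> k _; rewrite [(_ *m q p) k 0]mxE rmorph_sum /= scaler_sumr; apply: eq_bigr => l _.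
    by rewrite [fun_of_matrix (map_mx _ _) _ _]mxE rmorphM /= map_polyC /= mul_polyC scalerA.
  rewrite sh_shift_vector [fun_of_matrix (_ *m _) _ _]mxE rmorph_sum /=.
  rewrite !scaler_sumr -sumrB; apply: eq_bigr => l _.
  rewrite rowX [fun_of_matrix (map_mx _ _) _ _]mxE rmorphM /= map_polyC /= mul_polyC.
  by rewrite !scalerA scalerBl.
have dS (f : 'I_n -> P) : (\sum_k f k)^`() = \sum_k (f k)^`() by exact: (raddf_sum (@deriv _)).
rewrite derivD derivZ dS scalerDr.
rewrite (eq_bigr (fun k => ideal_row 0 k *: ((map_mx polyC X *m q p) k 0)^:P +
    (ideal_row 0 k *: (q p k 0)^:P)^`())); last first.
  move=> k _; rewrite [fun_of_matrix (_ + _) _ _]mxE [fun_of_matrix (map_mx _ _) _ _]mxE.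
  by rewrite rmorphD /= scalerDr derivZ deriv_map.
rewrite big_split /= sumX.
move: (\sum_k _) (\sum_k _) => S1 S2; rewrite -!mul_polyC; ring.
Qed.

End IdealOfPair.

Section RightIdeal.
Variable D : nzRingType.

Definition right_ideal (I : D -> Prop) :=
  [/\ I 0, forall x y, I x -> I y -> I (x + y) & forall x a, I x -> I (x * a)].

Variable I : D -> Prop.

(** The proof [H] is an argument so that the closure instance can be attached to the predicate. *)
Definition ideal_of (H : right_ideal I) : {pred (D^c)^o} := fun x => `[< I x >].

Lemma ideal_of_submod_closed H : submod_closed (ideal_of H).
Proof.
case: (H) => I0 ID IM; split=> [|a u v /asboolP Iu /asboolP Iv]; apply/asboolP => //.
by apply: ID => //; apply: IM.
Qed.

HB.instance Definition _ H :=
  GRing.isSubmodClosed.Build D^c (D^c)^o (ideal_of H) (ideal_of_submod_closed H).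

Record ideal_type (H : right_ideal I) :=
  IdealElt { ideal_val :> (D^c)^o; _ : ideal_val \in ideal_of H }.

HB.instance Definition _ H := [isSub for @ideal_val H].
HB.instance Definition _ H := [Choice of ideal_type H by <:].
HB.instance Definition _ H := [SubChoice_isSubLmodule of ideal_type H by <:].

Variable H : right_ideal I.

Definition ideal_inj (x : ideal_type H) : D := \val x.

Lemma ideal_injP (x : ideal_type H) : I (ideal_inj x).
Proof. exact/asboolP/(valP x). Qed.

Lemma ideal_injD : {morph ideal_inj : x y / x + y}.
Proof. by []. Qed.

Lemma ideal_injM (x : ideal_type H) (a : D) : ideal_inj (x ** a) = ideal_inj x * a.
Proof. by []. Qed.

Lemma ideal_inj_inj : injective ideal_inj.
Proof. exact: val_inj. Qed.

Lemma ideal_inj_surj (x : D) : I x -> exists y, ideal_inj y = x.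
Proof. by move=> Ix; have Hx : x \in ideal_of H by [apply/asboolP]; exists (IdealElt Hx). Qed.

End RightIdeal.

(** * Division of vectors over [D] by [X - z] *)

Section MonadIdeal.
Variables (F : fieldType) (D : algType F) (z d : D).
Local Notation P := {poly {poly F}}.
Variable th : D -> P.
Hypothesis ord : normal_ordering z d th.
Local Notation zp := (horner_alg z).
Local Notation dp := (horner_alg d).
Local Notation sc := (scalars_mx D).

Lemma th_dp g : th (dp g) = g^:P.
Proof. by rewrite -[dp g]mul1r (th_dpr ord) (th1 ord) mul1r. Qed.

Lemma commutator_z (g : {poly F}) : dp g * z = z * dp g + dp g^`().
Proof.
apply: (th_inj ord).
by rewrite (th_zr ord) (thD ord) (th_zl ord) !th_dp deriv_map.
Qed.

Lemma scalars_mxM p q r (A : 'M[F]_(p, q)) (B : 'M[F]_(q, r)) : sc (A *m B) = sc A *m sc B.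
Proof. by rewrite /scalars_mx (map_mxM (in_alg D)). Qed.

Lemma scalars_mxD p q (A B : 'M[F]_(p, q)) : sc (A + B) = sc A + sc B.
Proof. by apply/matrixP => k l; rewrite !mxE scalerDl. Qed.

Lemma scalars_mxC p (A : 'cV[F]_p) (a : D) : sc A *m a%:M = a%:M *m sc A.
Proof.
apply/matrixP => k l; rewrite mul_scalar_mx !mxE big_ord1 !mxE (ord1 l) eqxx mulr1n.
by rewrite mulr_algl mulr_algr.
Qed.

Lemma horner_char_poly_mx n (A : 'M[F]_n) (a : D) :
  map_mx (horner_alg a) (char_poly_mx A) = a%:M - sc A.
Proof.
apply/matrixP => k l; rewrite !mxE rmorphB rmorphMn /= horner_algX horner_algC.
by [].
Qed.

Lemma horner_polyC_mx p q (A : 'M[F]_(p, q)) (a : D) :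
  map_mx (horner_alg a) (map_mx polyC A) = sc A.
Proof. by apply/matrixP => k l; rewrite !mxE horner_algC. Qed.

Lemma char_poly_mx_const_inj n (A : 'M[F]_n) (g : 'cV[{poly F}]_n) (v : 'cV[F]_n) :
  char_poly_mx A *m g = map_mx polyC v -> g = 0 /\ v = 0.
Proof.
move=> E; have g0 : g = 0.
  have := congr1 (mulmx (\adj (char_poly_mx A))) E; rewrite mulmxA mul_adj_mx mul_scalar_mx.
  move=> /colP Eg; apply/colP => k; have := Eg k; rewrite [LHS]mxE [RHS]mxE => Ek.
  rewrite [RHS]mxE; apply/eqP/negPn/negP => gk.
  have : (size (\det (char_poly_mx A) * g k 0)%R <= n)%N.
    rewrite Ek; apply: leq_trans (size_sum _ _ _) _; apply/bigmax_leqP => l _.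
    rewrite [fun_of_matrix (map_mx _ _) _ _]mxE mulrC mul_polyC (leq_trans (size_scale_leq _ _)) //.
    exact: size_adj_char_poly_mx.
  rewrite size_mul //; last by rewrite -[\det _]/(char_poly A) monic_neq0 // char_poly_monic.
  rewrite -[\det _]/(char_poly A) size_char_poly addSn /= leqNgt.
  by rewrite -[X in (X < _)%N]addn0 ltn_add2l lt0n size_poly_eq0 gk.
split=> //; apply/colP => k; have /colP/(_ k) := E; rewrite g0 mulmx0 !mxE.
by move/esym/eqP; rewrite polyC_eq0 => /eqP.
Qed.

Section Division.
Variables (n : nat) (X : 'M[F]_n).
Local Notation dv := (map_mx dp).

Lemma dv_mul_d m (g : 'cV[{poly F}]_m) : dv g *m d%:M = dv ('X *: g).
Proof.
apply/colP => k; rewrite !mxE big_ord1 !mxE eqxx mulr1n mulrC.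
by rewrite rmorphM /= horner_algX.
Qed.

Lemma dv_mul_z m (g : 'cV[{poly F}]_m) :
  dv g *m z%:M = z%:M *m dv g + dv (map_mx (@deriv F) g).
Proof.
apply/colP => k; rewrite mul_scalar_mx !mxE big_ord1 !mxE eqxx mulr1n.
exact: commutator_z.
Qed.

(** Remainders are free of [z], which can be traded for [X]. Decomposable vectors are closed under
    right multiplication by [z] and [d], so constant vectors suffice. *)
Lemma mx_division (b : 'cV[D]_n) :
  exists w (g : 'cV[{poly F}]_n), b = (sc X - z%:M) *m w + dv g.
Proof.
pose Dv b := exists w (g : 'cV[{poly F}]_n), b = (sc X - z%:M) *m w + dv g.
have DvD u v : Dv u -> Dv v -> Dv (u + v).
  move=> [w [g ->]] [w' [g' ->]]; exists (w + w'), (g + g').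
  by rewrite mulmxDr map_mxD addrACA.
have Dv0 v : Dv (sc v).
  by exists 0, (map_mx polyC v); rewrite mulmx0 add0r horner_polyC_mx.
have Dvd u : Dv u -> Dv (u *m d%:M).
  move=> [w [g ->]]; exists (w *m d%:M), ('X *: g).
  by rewrite mulmxDl mulmxA dv_mul_d.
have Dvz u : Dv u -> Dv (u *m z%:M).
  move=> [w [g ->]].
  (* [g z = z g + g'] by commutation, and [z g] equals [X g] minus [(X - z) g]. *)
  exists (w *m z%:M - dv g), (map_mx polyC X *m g + map_mx (@deriv F) g).
  rewrite mulmxDl dv_mul_z map_mxD map_mxM horner_polyC_mx mulmxBr mulmxA -addrA.
  congr (_ + _); rewrite mulmxBl opprB addrA; congr (_ + _).
  by rewrite subrK.
have Dva v a : Dv (sc v *m a%:M).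
  elim/(generators_ind ord): a => [k|a1 a2 Da Db|a Da|a Da].
  - rewrite (_ : _ *m _ = sc (k *: v)) //; apply/colP => l.
    by rewrite !mxE big_ord1 !mxE eqxx mulr1n mulr_algl scalerA mulrC.
  - by rewrite raddfD /= mulmxDr; apply: DvD.
  - by rewrite scalar_mxM mulmxA; apply: Dvz.
  - by rewrite scalar_mxM mulmxA; apply: Dvd.
have -> : b = \sum_k sc (delta_mx k 0) *m (b k 0)%:M.
  apply/colP => l; rewrite summxE (bigD1 l) //= big1 => [|k kl].
    by rewrite !mxE big_ord1 !mxE !eqxx mulr1n scale1r mul1r addr0.
  by rewrite !mxE big_ord1 !mxE eq_sym (negPf kl) scale0r mul0r.
by apply: (big_ind Dv) => // ; have := Dv0 0; rewrite /scalars_mx; congr Dv;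
   apply/colP => k; rewrite !mxE scale0r.
Qed.

(** Up to sign, the adjugate turns the left side into [char_poly X] times [w], of degree at least
    [n] in [z] unless [w = 0], while the right side has degree below [n]. *)
Lemma mx_division_inj (w : 'cV[D]_n) (g : 'cV[{poly F}]_n) :
  (sc X - z%:M) *m w = dv g -> w = 0 /\ g = 0.
Proof.
move=> E; have w0 : w = 0.
  have := congr1 (mulmx (map_mx zp (\adj (char_poly_mx X)))) E.
  rewrite mulmxA -[sc X - _]opprB mulmxN -horner_char_poly_mx -map_mxM mul_adj_mx.
  rewrite map_scalar_mx mulNmx mul_scalar_mx => /colP Ew; apply/colP => k.
  rewrite mxE; apply: (th_eq0 ord); apply/polyP => b; rewrite coef0.
  have := Ew k; rewrite [LHS]mxE [fun_of_matrix (_ *: _) _ _]mxE => /(congr1 th).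
  rewrite (thN ord) (th_zpl ord).
  have -> : th ((map_mx zp (\adj (char_poly_mx X)) *m dv g) k 0) =
      \sum_l \adj (char_poly_mx X) k l *: (g l 0)^:P.
    rewrite mxE (big_morph th (thD ord) (th0 ord)); apply: eq_bigr => l _.
    rewrite [fun_of_matrix (map_mx zp _) _ _]mxE [fun_of_matrix (dv g) _ _]mxE.
    by rewrite (th_zpl ord) th_dp.
  move=> /(congr1 (fun p : P => p`_b)); rewrite coefN coefZ coef_sum => /(canRL opprK) Ek.
  apply/eqP/negPn/negP => wk.
  have : (size (\det (char_poly_mx X) * (th (w k 0))`_b)%R <= n)%N.
    rewrite Ek size_polyN; apply: leq_trans (size_sum _ _ _) _; apply/bigmax_leqP => l _.
    rewrite coefZ coef_map /= mulrC mul_polyC (leq_trans (size_scale_leq _ _)) //.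
    exact: size_adj_char_poly_mx.
  rewrite size_mul //; last by rewrite -[\det _]/(char_poly X) monic_neq0 // char_poly_monic.
  rewrite -[\det _]/(char_poly X) size_char_poly addSn /= leqNgt.
  by rewrite -[X in (X < _)%N]addn0 ltn_add2l lt0n size_poly_eq0 wk.
split=> //; apply/colP => k; have /colP/(_ k) := E; rewrite w0 mulmx0 !mxE.
move/esym/(congr1 th); rewrite (th0 ord) th_dp => /eqP.
by rewrite map_polyC_eq0 => /eqP.
Qed.

End Division.
End MonadIdeal.

(** * The ideal of a pair as cohomology of the monad *)

Section PairModule.
Variables (F : fieldType) (D : algType F) (z d : D).
Local Notation P := {poly {poly F}}.
Variable th : D -> P.
Hypothesis ord : normal_ordering z d th.
Local Notation zp := (horner_alg z).
Local Notation dp := (horner_alg d).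
Local Notation sc := (scalars_mx D).
Local Notation dv := (map_mx dp).

Section Pair.
Variables (n : nat) (X Y : 'M[F]_n) (i : 'cV[F]_n) (j : 'rV[F]_n).
Variables (pi : P -> 'cV[F]_n) (h : P -> {poly F}).
Hypothesis sp : spread X Y i j pi h.
Hypothesis XY : X *m Y - Y *m X = 1%:M + i *m j.
Local Notation q := (shift_vector pi).
Local Notation elt := (ideal_elt X j pi).

Definition pair_ideal (x : D) := exists2 p, pi p = 0 & th x = elt p.

Lemma pair_ideal_right : right_ideal pair_ideal.
Proof.
have ID x y : pair_ideal x -> pair_ideal y -> pair_ideal (x + y).
  move=> [p p0 xE] [p' p'0 yE]; exists (p + p'); first by rewrite (spD sp) p0 p'0 addr0.
  by rewrite (thD ord) xE yE (ideal_eltD sp).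
split=> // [|x a]; first by exists 0; rewrite ?(sp0 sp) ?(th0 ord) ?(ideal_elt0 sp).
elim/(generators_ind ord): a x => [k|a b Ia Ib|a Ia|a Ia] x Ix.
- case: Ix => p p0 xE; exists (k%:P *: p); first by rewrite (spZ sp) p0 scaler0.
  by rewrite mulr_algr (thZ ord) xE (ideal_eltZ sp).
- by rewrite mulrDr; apply: ID; [apply: Ia|apply: Ib].
- have [p p0 xE] := Ia x Ix; exists ('X *: p + p^`() + (h p)^:P).
    by rewrite (sp_act_z sp XY) p0 mulmx0.
  by rewrite mulrA (th_zr ord) xE (ideal_elt_z sp XY).
- have [p p0 xE] := Ia x Ix; exists (p * 'X); first by rewrite (sp_t sp) p0 mulmx0.
  by rewrite mulrA (th_dr ord) xE (ideal_elt_t sp).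
Qed.

Definition pair_module : lmodType D^c := ideal_type pair_ideal_right.

Local Notation inj := (@ideal_inj D pair_ideal pair_ideal_right).

Lemma pair_module_realizes : realizes z d X Y i j pair_module.
Proof.
pose r (x : pair_module) := map_poly (fun c => c %/ char_poly X) (th (inj x)).
have rE x p : th (inj x) = elt p -> r x = p by move=> xE; rewrite /r xE ideal_eltK.
have rP x : pi (r x) = 0 /\ th (inj x) = elt (r x).
  by have [p p0 xE] := ideal_injP x; rewrite (rE x p xE).
exists r, pi, h; split=> // [|x rx|p].
- split=> [x y|c x|x|x]; apply: rE; have [px xE] := rP x.
  + by have [_ yE] := rP y; rewrite ideal_injD (thD ord) xE yE (ideal_eltD sp).
  + by rewrite ideal_injM mulr_algr (thZ ord) xE (ideal_eltZ sp).
  + by rewrite ideal_injM (th_dr ord) xE (ideal_elt_t sp).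
  + by rewrite ideal_injM (th_zr ord) xE (ideal_elt_z sp XY).
- have [_] := rP x; rewrite rx (ideal_elt0 sp) => /(th_eq0 ord) x0.
  by apply: ideal_inj_inj; rewrite x0.
- split=> [p0|[x <-]]; last by have [] := rP x.
  have [thi _ thiK] := th_bij ord.
  have [|x xE] := @ideal_inj_surj _ _ pair_ideal_right (thi (elt p)).
    by exists p; rewrite ?thiK.
  by exists x; apply: rE; rewrite xE thiK.
Qed.

Lemma pair_module_finitely_generated : finitely_generated pair_module.
Proof.
have fr := framed_ideal ord (@ideal_injD _ _ pair_ideal_right) (@ideal_injM _ _ pair_ideal_right).
apply: (framed_finitely_generated ord fr) => m; first by rewrite size_poly0.
by move/(th_eq0 ord) => m0; apply: ideal_inj_inj; rewrite m0.
Qed.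

Lemma pair_module_torsion_free : torsion_free pair_module.
Proof.
move=> a m /(congr1 inj); rewrite ideal_injM => /(weyl_domain ord)[m0|]; last by left.
by right; apply: ideal_inj_inj; rewrite m0.
Qed.

Lemma pair_module_neq0 : exists m : pair_module, m != 0.
Proof.
have [thi _ thiK] := th_bij ord.
have [|x xE] := @ideal_inj_surj _ _ pair_ideal_right (thi (elt (char_poly X)%:P)).
  by exists (char_poly X)%:P; rewrite ?thiK //; apply: (sp_char_z sp).
exists x; apply/eqP => x0; have := ideal_eltK X j pi (char_poly X)%:P.
rewrite -(thiK (elt _)) -xE x0 (th0 ord) map_poly0 => /esym/eqP.
by rewrite polyC_eq0 (negPf (monic_neq0 (char_poly_monic X))).
Qed.

Lemma pair_module_rank1 (K : unitRingType) (iota : {rmorphism D -> K}) :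
  is_skew_field_of_fractions iota -> rank1_torsion_free iota pair_module.
Proof.
move=> frac; split; first exact: pair_module_finitely_generated.
  exact: (ideal_has_rank1 frac (@ideal_injD _ _ pair_ideal_right)
    (@ideal_injM _ _ pair_ideal_right) (@ideal_inj_inj _ _ _) pair_module_neq0).
exact: pair_module_torsion_free.
Qed.

Let dz : d * z - z * d = 1.
Proof. by rewrite (weyl_relation ord) addrC addKr. Qed.

Lemma monad_lift_z (c : {poly F}) : exists a, (sc X - z%:M) *m a = sc i *m (zp c)%:M - sc (pi c%:P).
Proof.
elim/poly_ind: c => [|c k [a aE]].
  exists 0; rewrite mulmx0 rmorph0 raddf0 mulmx0 sub0r (sp0 sp).
  by apply/colP => k; rewrite !mxE scale0r oppr0.
have sE : sc i *m (zp c)%:M = (sc X - z%:M) *m a + sc (pi c%:P) by rewrite aE subrK.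
have kE : sc i *m (k%:A)%:M = sc (k *: i).
  by rewrite scalars_mxC; apply/colP => l; rewrite mul_scalar_mx !mxE mulr_algl scalerA.
exists (a *m z%:M - sc (pi c%:P)).
rewrite zpMX polyCD (spD sp) (sp_z sp) (spC sp) scalars_mxD scalars_mxM.
rewrite [(_ + _)%:M]raddfD /= [sc i *m (_ + _)]mulmxDr kE scalar_mxM (mulmxA (sc i)) sE.
rewrite mulmxBr mulmxA [in RHS]mulmxDl scalars_mxC [(_ - _) *m sc _]mulmxBl.
have zm (V : zmodType) (x y w e : V) : x - (y - w) = x + w + e - (y + e).
  by rewrite opprB opprD addrACA subrr addr0 addrA.
exact: zm.
Qed.

(** Modulo the image of [X - z], powers of [z] in [i u] become powers of [X]; dividing by [d - Y]
    then leaves quotient [q] and remainder [pi]. When the remainder vanishes, this gives an element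
    of the kernel. *)
Lemma monad_lift (u : D) : exists a, (sc X - z%:M) *m a =
  sc i *m u%:M - (d%:M - sc Y) *m dv (q (th u)) - sc (pi (th u)).
Proof.
elim/(normal_form_ind ord): u => [|u c [a aE]].
  exists 0; rewrite mulmx0 (th0 ord) (sp0 sp) raddf0 mulmx0 sub0r.
  rewrite -polyC0 (shift_vectorC sp) map_mx0 mulmx0 oppr0 sub0r.
  by apply/colP => k; rewrite !mxE scale0r oppr0.
have [b bE] := monad_lift_z c; exists (a *m d%:M + b).
rewrite mulmxDr mulmxA aE bE (thD ord) (th_dr ord) (th_zp ord).
rewrite (shift_vectorD sp) (shift_vectorC sp) addr0 (shift_vector_t sp).
rewrite (spD sp) (sp_t sp) map_mxD horner_polyC_mx -dv_mul_d mulmxDr (mulmxA (_ - _)).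
rewrite [(_ + _)%:M]raddfD /= [sc i *m (_ + _)]mulmxDr scalar_mxM (mulmxA (sc i)).
rewrite scalars_mxD scalars_mxM [(_ - _) *m sc _]mulmxBl 2!(mulmxBl _ _ d%:M) (scalars_mxC (pi _)).
have zm (V : zmodType) (x t e y k f : V) :
    x - t - e + (k - f) = x + k - (t + (e - y)) - (y + f).
  rewrite !opprD !opprK !addrA [RHS](ACl (1*3*4*2*7*(5*6))%AC) /=.
  by rewrite subrr addr0.
exact: zm.
Qed.

(** Subtracting an image vector makes the second component a polynomial in [d]. Uniqueness of
    division by [X - z], then by [d - Y], identifies it with [q (th u)] and kills the remainder. *)
Lemma monad_kernel (v : 'cV[D]_(n + n + 1)) : monad_out z d X Y i *m v = 0 ->
  exists w a u, [/\ pi (th u) = 0, v = monad_in z d X Y j *m w +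
    col_mx (col_mx a (dv (q (th u)))) u%:M &
    (sc X - z%:M) *m a = sc i *m u%:M - (d%:M - sc Y) *m dv (q (th u))].
Proof.
move=> v0; have [w [g bE]] := mx_division ord X (dsubmx (usubmx v)).
pose v' := v - monad_in z d X Y j *m w.
have v'0 : monad_out z d X Y i *m v' = 0.
  by rewrite mulmxBr v0 mulmxA (monad_complex dz XY) mul0mx subrr.
pose a := usubmx (usubmx v'); pose u := dsubmx v' 0 0.
have v'E : v' = col_mx (col_mx a (dv g)) u%:M.
  rewrite -[LHS]vsubmxK -[usubmx v']vsubmxK /u -mx11_scalar; congr (col_mx (col_mx _ _) _).
  rewrite /v' /monad_in !mul_col_mx -[v in v - _]vsubmxK -[usubmx v in LHS]vsubmxK.
  by rewrite !opp_col_mx !add_col_mx col_mxKu col_mxKd bE addrC addKr.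
have aE : (sc X - z%:M) *m a = sc i *m u%:M - (d%:M - sc Y) *m dv g.
  move: v'0; rewrite v'E /monad_out !mul_row_col mulNmx => /eqP.
  by rewrite subr_eq0 => /eqP <-; rewrite addrK.
have [a' a'E] := monad_lift u.
have : (sc X - z%:M) *m (a - a') =
    dv (char_poly_mx Y *m (q (th u) - g) + map_mx polyC (pi (th u))).
  rewrite mulmxBr aE a'E map_mxD map_mxM horner_char_poly_mx map_mxB horner_polyC_mx mulmxBr.
  have zm (V : zmodType) (x t e f : V) : x - t - (x - e - f) = e - t + f.
    by rewrite !opprD !opprK !addrA [LHS](ACl ((1*3)*(4*2*5))%AC) /= subrr add0r.
  exact: zm.
case/(mx_division_inj ord) => /eqP; rewrite subr_eq0 => /eqP aa' /eqP.
rewrite addr_eq0 => /eqP E.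
have {}E : char_poly_mx Y *m (g - q (th u)) = map_mx polyC (pi (th u)).
  by rewrite -opprB mulmxN E opprK.
have [/eqP + p0] := char_poly_mx_const_inj E; rewrite subr_eq0 => /eqP gE.
exists w, a, u; split; rewrite -?gE //.
by rewrite -v'E addrC subrK.
Qed.

(* On [monad_in w] the two terms cancel: [j adj(z - X) (z - X) = char_poly X j]. *)
Definition ideal_of_vector (v : 'cV[D]_(n + n + 1)) : D :=
  zp (char_poly X) * dsubmx v 0 0 +
  (map_mx zp (ideal_row X j) *m dsubmx (usubmx v)) 0 0.

Lemma ideal_of_vectorD u v : ideal_of_vector (u + v) = ideal_of_vector u + ideal_of_vector v.
Proof.
rewrite /ideal_of_vector.
have -> : dsubmx (u + v) = dsubmx u + dsubmx v by apply/matrixP => k l; rewrite !mxE.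
have -> : dsubmx (usubmx (u + v)) = dsubmx (usubmx u) + dsubmx (usubmx v).
  by apply/matrixP => k l; rewrite !mxE.
rewrite mulmxDr [fun_of_matrix (_ + _) _ _]mxE mulrDr.
by rewrite [X in _ + X]mxE addrACA.
Qed.

Lemma ideal_of_vectorM v (a : D) : ideal_of_vector (v *m a%:M) = ideal_of_vector v * a.
Proof.
rewrite /ideal_of_vector -{1 2}[v]vsubmxK mul_col_mx col_mxKd col_mxKu.
rewrite -[usubmx v in LHS]vsubmxK mul_col_mx col_mxKd mulmxA mulrDl.
have E (u : 'M[D]_1) : (u *m a%:M) 0 0 = u 0 0 * a by rewrite mxE big_ord1 !mxE eqxx mulr1n.
by rewrite !E mulrA.
Qed.

Lemma ideal_of_vector_in (w : 'cV[D]_n) : ideal_of_vector (monad_in z d X Y j *m w) = 0.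
Proof.
rewrite /ideal_of_vector /monad_in !mul_col_mx col_mxKd col_mxKu col_mxKd mulmxA.
have -> : map_mx zp (ideal_row X j) *m (sc X - z%:M) = - (zp (char_poly X) *: sc j).
  rewrite -opprB mulmxN -(horner_char_poly_mx X z) -map_mxM ideal_rowX map_mxZ.
  by rewrite horner_polyC_mx.
by rewrite mulNmx -scalemxAl !mxE subrr.
Qed.

Lemma ideal_of_vector_lift a (u : D) :
  th (ideal_of_vector (col_mx (col_mx a (dv (q (th u)))) u%:M)) = elt (th u).
Proof.
rewrite /ideal_of_vector col_mxKd col_mxKu col_mxKd (thD ord) mxE eqxx mulr1n (th_zpl ord).
congr (_ + _); rewrite mxE (big_morph th (thD ord) (th0 ord)); apply: eq_bigr => k _.
rewrite [fun_of_matrix (map_mx zp _) _ _]mxE [fun_of_matrix (dv _) _ _]mxE (th_zpl ord).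
by rewrite (th_dp ord).
Qed.

Lemma pair_module_monad : is_monad_cohomology z d X Y i j pair_module.
Proof.
pose ker (v : 'cV[D]_(n + n + 1)) := monad_out z d X Y i *m v = 0.
have lift_ker v : ker v -> pair_ideal (ideal_of_vector v).
  move=> /monad_kernel[w [a [u [u0 -> _]]]]; exists (th u) => //.
  by rewrite ideal_of_vectorD ideal_of_vector_in add0r ideal_of_vector_lift.
(* [f] is prescribed only on the kernel; elsewhere its value is 0 by default. *)
have [|f fE] := @choice 'cV[D]_(n + n + 1) pair_module
    (fun v y => ker v -> inj y = ideal_of_vector v).
  move=> v; have [/lift_ker kv|nkv] := pselect (ker v); last by exists 0.
  by have [y yE] := ideal_inj_surj pair_ideal_right kv; exists y.
have scaleE (a : D) (v : 'cV[D]_(n + n + 1)) :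
    ((a : D^c) *: (v : 'cV[D^c]_(n + n + 1)) : 'cV[D]_(n + n + 1)) = v *m a%:M.
  by apply/matrixP => k l; rewrite !mxE big_ord1 !mxE (ord1 l) eqxx mulr1n.
have inj_inj : injective inj by exact: ideal_inj_inj.
have kerD v w : ker v -> ker w -> ker (v + w).
  by rewrite /ker mulmxDr => -> ->; rewrite addr0.
have kerM v (a : D) : ker v -> ker (v *m a%:M) by rewrite /ker mulmxA => ->; rewrite mul0mx.
exists f; split=> [v w kv kw|a v kv|m|v kv].
- by apply: inj_inj; rewrite ideal_injD !fE ?ideal_of_vectorD //; apply: kerD.
- apply: inj_inj; rewrite [a *: v]scaleE ideal_injM !fE ?ideal_of_vectorM //.
  exact: kerM.
- have [p p0 mE] := ideal_injP m; have [thi _ thiK] := th_bij ord.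
  have [a aE] := monad_lift (thi p); rewrite thiK p0 in aE.
  have kv : ker (col_mx (col_mx a (dv (q p))) (thi p)%:M).
    rewrite /ker /monad_out !mul_row_col aE mulNmx (_ : sc 0 = 0) ?subr0 ?subrK ?subrr //.
    by apply/matrixP => k l; rewrite !mxE scale0r.
  exists (col_mx (col_mx a (dv (q p))) (thi p)%:M) => //; apply: inj_inj.
  rewrite fE //; apply: (th_inj ord); rewrite mE.
  by have := ideal_of_vector_lift a (thi p); rewrite thiK.
- split=> [fv0|[w ->]]; last first.
    apply: inj_inj; rewrite fE ?ideal_of_vector_in //.
    by rewrite /ker mulmxA (monad_complex dz XY) mul0mx.
  (* If the ideal element vanishes, [ideal_eltK] gives [u = 0], and then [a = 0] by uniqueness of
     division. *)
  have [w [a [u [u0 vE aE]]]] := monad_kernel kv; exists w.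
  have : th (inj (f v)) = elt (th u).
    by rewrite fE // vE ideal_of_vectorD ideal_of_vector_in add0r ideal_of_vector_lift.
  rewrite fv0 (th0 ord) => /(congr1 (map_poly (fun c => c %/ char_poly X))).
  rewrite ideal_eltK map_poly0 => /esym/(th_eq0 ord) u00.
  have q0 : q (th u) = 0 by rewrite u00 (th0 ord) -polyC0 (shift_vectorC sp).
  move: aE; rewrite q0 u00 raddf0 mulmx0 map_mx0 mulmx0 subr0 => aE.
  have [|a0 _] := @mx_division_inj _ _ _ _ _ ord _ X a 0; first by rewrite map_mx0.
  by rewrite vE q0 u00 a0 map_mx0 raddf0 !col_mx0 addr0.
Qed.

End Pair.
End PairModule.

(** * The bijection *)

Section Isomorphism.
Variable D : nzRingType.
Implicit Types M N L : lmodType D^c.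

Lemma isomorphic_bij M N (f : M -> N) : {morph f : x y / x + y} ->
  (forall m (a : D), f (m ** a) = f m ** a) -> injective f ->
  (forall y, exists x, f x = y) -> isomorphic M N.
Proof.
move=> fD fM f_inj f_surj.
have f_lin : linear f by move=> a x y; rewrite fD [f (_ *: _)]fM.
pose fl : {linear M -> N} := HB.pack f (GRing.isLinear.Build _ _ _ _ f f_lin).
have [g gE] := choice f_surj.
by exists fl, g => // x; apply: f_inj; rewrite gE.
Qed.

Lemma isomorphic_sym M N : isomorphic M N -> isomorphic N M.
Proof.
move=> [f [g gf fg]]; apply: (@isomorphic_bij _ _ g).
- by move=> x y; apply: (can_inj gf); rewrite raddfD /= !fg.
- by move=> x a; apply: (can_inj gf); rewrite linearZ /= !fg.
- exact: can_inj fg.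
- by move=> y; exists (f y).
Qed.

Lemma isomorphic_trans M N L : isomorphic M N -> isomorphic N L -> isomorphic M L.
Proof.
move=> [f [f' ff' f'f]] [g [g' gg' g'g]]; exists (g \o f); exists (f' \o g') => x /=.
  by rewrite gg' ff'.
by rewrite f'f g'g.
Qed.

End Isomorphism.

Section Monads.
Variables (F : fieldType) (D : algType F) (z d : D).
Variables (n : nat) (X Y : 'M[F]_n) (i : 'cV[F]_n) (j : 'rV[F]_n).
Implicit Types M N : lmodType D^c.

Lemma monad_isomorphic M N : is_monad_cohomology z d X Y i j M ->
  is_monad_cohomology z d X Y i j N -> isomorphic M N.
Proof.
move=> [f [fD fZ f_surj f_ker]] [g [gD gZ g_surj g_ker]].
pose ker (v : 'cV[D]_(n + n + 1)) := monad_out z d X Y i *m v = 0.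
have kerD v w : ker v -> ker w -> ker (v + w).
  by rewrite /ker mulmxDr => -> ->; rewrite addr0.
have kerZ (a : D) v : ker v -> ker ((a : D^c) *: (v : 'cV[D^c]_(n + n + 1))).
  have -> : ((a : D^c) *: (v : 'cV[D^c]_(n + n + 1)) : 'cV[D]_(n + n + 1)) = v *m a%:M.
    by apply/matrixP => k l; rewrite !mxE big_ord1 !mxE (ord1 l) eqxx mulr1n.
  by rewrite /ker mulmxA => ->; rewrite mul0mx.
have kerN v : ker v -> ker (- v) by rewrite /ker mulmxN => ->; rewrite oppr0.
have sub (M' : lmodType D^c) (f' : 'cV[D^c]_(n + n + 1) -> M') v w :
    (forall v w, ker v -> ker w -> f' (v + w) = f' v + f' w) -> ker v -> ker w ->
    f' (v - w) = f' v - f' w.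
  move=> f'D kv kw; apply: (addIr (f' w)); rewrite -f'D ?subrK //.
  by apply: kerD => //; apply: kerN.
have f_eq v w : ker v -> ker w -> f v = f w -> g v = g w.
  move=> kv kw E; have k0 : ker (v - w) by apply: kerD => //; apply: kerN.
  have /(f_ker _ k0)/(g_ker _ k0) : f (v - w) = 0 by rewrite (sub _ f) // E subrr.
  by rewrite (sub _ g) // => /eqP; rewrite subr_eq0 => /eqP.
have g_eq v w : ker v -> ker w -> g v = g w -> f v = f w.
  move=> kv kw E; have k0 : ker (v - w) by apply: kerD => //; apply: kerN.
  have /(g_ker _ k0)/(f_ker _ k0) : g (v - w) = 0 by rewrite (sub _ g) // E subrr.
  by rewrite (sub _ f) // => /eqP; rewrite subr_eq0 => /eqP.
have [|s sE] := @choice M 'cV[D]_(n + n + 1) (fun m v => ker v /\ f v = m).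
  by move=> m; have [v kv fv] := f_surj m; exists v.
have sk m : ker (s m) by have [] := sE m.
have fs m : f (s m) = m by have [] := sE m.
apply: (@isomorphic_bij _ _ _ (fun m => g (s m))).
- move=> x y; rewrite -(gD _ _ (sk x) (sk y)); apply: f_eq => //; first exact: kerD.
  by rewrite fs (fD _ _ (sk x) (sk y)) !fs.
- move=> x a; rewrite -(gZ _ _ (sk x)); apply: f_eq => //; first exact: kerZ.
  by rewrite fs (fZ _ _ (sk x)) fs.
- by move=> x y E; rewrite -(fs x) -(fs y); apply: g_eq.
- move=> y; have [v kv <-] := g_surj y; exists (f v); apply: f_eq => //.
Qed.

Lemma monad_transport M N : isomorphic M N ->
  is_monad_cohomology z d X Y i j M -> is_monad_cohomology z d X Y i j N.
Proof.
move=> [phi [psi phiK psiK]] [f [fD fZ f_surj f_ker]].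
exists (fun v => phi (f v)); split=> [v w kv kw|a v kv|m|v kv].
- by rewrite fD // raddfD.
- by rewrite fZ // linearZ.
- by have [v kv fv] := f_surj (psi m); exists v => //; rewrite fv psiK.
- rewrite -f_ker //; split=> [phi0|->]; last by rewrite raddf0.
  by apply: (can_inj phiK); rewrite phi0 raddf0.
Qed.

End Monads.

Section Realizes.
Variables (F : fieldType) (D : algType F) (z d : D).
Local Notation P := {poly {poly F}}.
Variable th : D -> P.
Hypothesis ord : normal_ordering z d th.
Hypothesis char0 : [pchar F] =i pred0.
Implicit Types M N : lmodType D^c.

Lemma spread_unique n (X Y : 'M[F]_n) i j pi h pi' h' :
  spread X Y i j pi h -> spread X Y i j pi' h' -> pi =1 pi' /\ h =1 h'.
Proof.
move=> sp sp'.
have C (c : {poly F}) : pi c%:P = pi' c%:P.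
  elim/poly_ind: c => [|c k IH]; first by rewrite (sp0 sp) (sp0 sp').
  by rewrite polyCD (spD sp) (spD sp') (sp_z sp) (sp_z sp') IH (spC sp) (spC sp').
have E : pi =1 pi'.
  elim/poly_ind => [|p c IH]; first by rewrite (sp0 sp) (sp0 sp').
  by rewrite (spD sp) (spD sp') (sp_t sp) (sp_t sp') IH C.
split=> //; elim/poly_ind => [|p c IH]; first by rewrite (sh0 sp) (sh0 sp').
by rewrite (shD sp) (shD sp') (sh_t sp) (sh_t sp') IH E (shC sp) (shC sp').
Qed.

Lemma realizes_isomorphic n (X Y : 'M[F]_n) i j M N :
  realizes z d X Y i j M -> realizes z d X Y i j N -> isomorphic M N.
Proof.
move=> [r [pi [h [sp fr r_inj ker]]]] [r' [pi' [h' [sp' fr' r'_inj ker']]]].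
have [piE hE] := spread_unique sp sp'.
have r_injective : injective r.
  by move=> x y E; apply/eqP; rewrite -subr_eq0; apply/eqP/r_inj; rewrite (frB fr) E subrr.
have r'_injective : injective r'.
  by move=> x y E; apply/eqP; rewrite -subr_eq0; apply/eqP/r'_inj; rewrite (frB fr') E subrr.
have [|f fE] := @choice M N (fun m m' => r' m' = r m).
  by move=> m; apply/ker'; rewrite -piE; apply/ker; exists m.
have fD x y : f (x + y) = f x + f y.
  by apply: r'_injective; rewrite (frD fr') !fE (frD fr).
apply: (@isomorphic_bij _ _ _ f) => //.
- move=> m a; elim/(generators_ind ord): a m => [k|a b Ia Ib|a Ia|a Ia] m.
  + by apply: r'_injective; rewrite (frZ fr') !fE (frZ fr).
  + by rewrite !actD fD Ia Ib.
  + rewrite !actM -Ia; apply: r'_injective.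
    by rewrite (fr_z fr') !fE (fr_z fr) hE.
  + by rewrite !actM -Ia; apply: r'_injective; rewrite (fr_d fr') !fE (fr_d fr).
- by move=> x y E; apply: r_injective; rewrite -!fE E.
- move=> y; have /ker[x xE] : pi (r' y) = 0 by rewrite piE; apply/ker'; exists y.
  by exists x; apply: r'_injective; rewrite fE.
Qed.

Lemma realizes_transport n (X Y : 'M[F]_n) i j M N : isomorphic M N ->
  realizes z d X Y i j M -> realizes z d X Y i j N.
Proof.
move=> /isomorphic_sym[f [g fK gK]] [r [pi [h [sp fr r_inj ker]]]].
exists (fun m => r (f m)), pi, h; split=> //.
- split=> [x y|c m|m|m]; first by rewrite raddfD (frD fr).
  + by rewrite linearZ -(frZ fr).
  + by rewrite linearZ -(fr_d fr).
  + by rewrite linearZ -(fr_z fr).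
- by move=> m /r_inj fm; apply: (can_inj fK); rewrite fm raddf0.
- move=> p; rewrite ker; split=> [[m <-]|[m <-]]; last by exists (f m).
  by exists (g m); rewrite gK.
Qed.

(** The scalar [l] accounts for the ambiguity in factoring a rank one matrix as [i j]. *)
Lemma realizes_conj n (X Y : 'M[F]_n) i j g (l : F) M : g \in unitmx -> l != 0 ->
  realizes z d X Y i j M ->
  realizes z d (g *m X *m invmx g) (g *m Y *m invmx g) (l *: (g *m i))
    (l^-1 *: (j *m invmx g)) M.
Proof.
move=> ug l0 [r [pi [h [sp fr r_inj ker]]]].
exists r, (fun p => l *: (g *m pi p)), h; split=> //.
- split=> [p q|c p|p|c||||].
  + by rewrite (spD sp) mulmxDr scalerDr.
  + by rewrite (spZ sp) -scalemxAr !scalerA mulrC.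
  + by rewrite (sp_t sp) -scalemxAr -!mulmxA (mulKmx ug).
  + by rewrite (sp_z sp) -scalemxAr -!mulmxA (mulKmx ug).
  + by rewrite (sp_1 sp).
  + exact: shD sp.
  + exact: shC sp.
  + move=> p; rewrite (sh_t sp) -scalemxAl -scalemxAr scalerA mulVf // scale1r.
    by rewrite mulmxA mulmxKV.
- move=> p; rewrite -ker; split=> [E|->]; last by rewrite mulmx0 scaler0.
  apply: (can_inj (mulKmx ug)); apply: (can_inj (scalerK l0)).
  by rewrite E mulmx0 scaler0.
Qed.

(** The two framings differ by a scalar, which leaves [ker pi] unchanged and rescales the
    [1/z]-coefficient in the same way, so [h] and [h'] agree there. *)
Lemma realizes_cm_point n n' (X Y : 'M[F]_n) (X' Y' : 'M[F]_n') i j i' j' M :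
  X *m Y - Y *m X = 1%:M + i *m j -> X' *m Y' - Y' *m X' = 1%:M + i' *m j' ->
  realizes z d X Y i j M -> realizes z d X' Y' i' j' M ->
  cm_point (X, Y) = cm_point (X', Y').
Proof.
move=> XY XY' [r [pi [h [sp fr r_inj ker]]]] [r' [pi' [h' [sp' fr' r'_inj ker']]]].
have fg := realizes_framing sp fr r_inj ker.
have fg' := realizes_framing sp' fr' r'_inj ker'.
have [l l0 rE] := framing_unique ord fg fg'.
apply: (spread_conj char0 XY XY' sp sp') => [p|_ /ker[m <-]].
  rewrite ker ker'; split=> [[m <-]|[m <-]].
    by exists (m ** l^-1%:A); rewrite rE (frZ fr) scalerA -polyCM mulfV // scale1r.
  by exists (m ** l%:A); rewrite rE (frZ fr).
have E : (h' (r' m))^:P = l%:P *: (h (r m))^:P.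
  apply: (addrI ('X *: r' m + (r' m)^`())); rewrite -(fr_z fr') !rE (fr_z fr).
  by rewrite derivZ -!mul_polyC; ring.
apply: (scalerI l0); rewrite -(shZ sp') -rE.
apply: (map_inj_poly (@polyC_inj F) (rmorph0 _)); rewrite E map_polyZ.
by [].
Qed.

Lemma pair_module_exists n (X Y : 'M[F]_n) i j :
  X *m Y - Y *m X = 1%:M + i *m j ->
  exists N : lmodType D^c, [/\ realizes z d X Y i j N, is_monad_cohomology z d X Y i j N &
    forall (K : unitRingType) (iota : {rmorphism D -> K}),
      is_skew_field_of_fractions iota -> rank1_torsion_free iota N].
Proof.
move=> XY; have [pi [h sp]] := spread_exists X Y i j.
exists (pair_module ord sp XY); split.
- exact: pair_module_realizes.
- exact: pair_module_monad.
- by move=> K iota; apply: pair_module_rank1.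
Qed.

Lemma rank_one_factors n (i i' : 'cV[F]_n) (j j' : 'rV[F]_n) :
  i *m j = i' *m j' -> i *m j != 0 ->
  exists2 l, l != 0 & i' = l *: i /\ j' = l^-1 *: j.
Proof.
move=> E ij0.
have i0 : i != 0 by apply: contra_neq ij0 => ->; rewrite mul0mx.
have [k jk] : exists k, j' 0 k != 0.
  apply/existsP; apply: contra_neqT ij0; rewrite negb_exists => /forallP j0.
  rewrite E; suff -> : j' = 0 by rewrite mulmx0.
  by apply/rowP => k; rewrite mxE; apply/eqP; have := j0 k; rewrite negbK.
have entry a b : i a 0 * j 0 b = i' a 0 * j' 0 b.
  by have /matrixP/(_ a b) := E; rewrite !mxE !big_ord1.
have i'E : i' = (j 0 k / j' 0 k) *: i.
  by apply/colP => a; rewrite mxE; apply: (mulIf jk); rewrite -entry; field.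
have l0 : j 0 k / j' 0 k != 0.
  by apply: contra_neq ij0 => l0; rewrite E i'E l0 scale0r mul0mx.
exists (j 0 k / j' 0 k) => //; split=> //.
have [a ia] : exists a, i a 0 != 0.
  apply/existsP; apply: contra_neqT i0; rewrite negb_exists => /forallP j0.
  by apply/colP => a; rewrite mxE; apply/eqP; have := j0 a; rewrite negbK.
apply/rowP => b; apply: (mulfI ia); apply: (mulfI l0); rewrite mxE.
by rewrite [X in _ = _ * X]mulrCA mulVKf // entry i'E mxE mulrA.
Qed.

(** For [n > 0] the trace of [Id] is nonzero, so [i *m j] has rank exactly one; for [n = 0] all
    matrices are empty. *)
Lemma cm_pairs_relation n (X Y : 'M[F]_n) : cm_pairs (X, Y) <->
  exists (i : 'cV[F]_n) (j : 'rV[F]_n), X *m Y - Y *m X = 1%:M + i *m j.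
Proof.
rewrite /cm_pairs /rank_one_class /=; split=> [[n0|[_ [A [rA ->]]]]|[i [j E]]].
- by subst n; exists 0, 0; apply/matrixP => -[].
- move: (col_base A) (row_base A) (mulmx_base A); rewrite rA => i j <-.
  by exists i, j.
have [n0|n0] := eqVneq n 0%N; [by left|right].
have tr0 : \tr (X *m Y - Y *m X) = 0 by rewrite raddfB /= mxtrace_mulC subrr.
split=> //; exists (i *m j); split=> //; apply/eqP.
rewrite eqn_leq (leq_trans (mxrankM_maxl _ _) (rank_leq_col _)) lt0n mxrank_eq0.
apply: contra_neq n0 => ij0; move: tr0; rewrite E ij0 addr0 mxtrace1 => /eqP.
by rewrite (pcharf0P _).1 // => /eqP.
Qed.

(** Instead of conjugating the complex, both pairs are given modules that realize them, and
    [realizes] is transported along the conjugation. *)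
Lemma monad_conj n (X Y X' Y' : 'M[F]_n) i j i' j' M :
  X *m Y - Y *m X = 1%:M + i *m j -> X' *m Y' - Y' *m X' = 1%:M + i' *m j' ->
  conj_orbit (X, Y) (X', Y') ->
  is_monad_cohomology z d X' Y' i' j' M -> is_monad_cohomology z d X Y i j M.
Proof.
move=> XY XY' [g [ug [XE YE]]] monM.
have [N [realN monN _]] := pair_module_exists XY.
have [N' [realN' monN' _]] := pair_module_exists XY'.
apply: (monad_transport _ monN).
apply: isomorphic_trans (monad_isomorphic monN' monM).
apply: realizes_isomorphic _ realN'.
have [n0|n0] := eqVneq n 0%N.
  subst n; have -> : X' = X by apply/matrixP => -[].
  have -> : Y' = Y by apply/matrixP => -[].
  have -> : i' = i by apply/matrixP => -[].
  by have -> : j' = j by apply/matrixP => ? -[].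
have [||l l0 [-> ->]] := @rank_one_factors n (g *m i) i' (j *m invmx g) j'.
- have : X' *m Y' - Y' *m X' = g *m (X *m Y - Y *m X) *m invmx g.
    by rewrite XE YE mulmxBr mulmxBl !mulmxA !(mulmxKV ug).
  rewrite XY XY' mulmxDr mulmx1 mulmxDl mulmxV // => /addrI ->.
  by rewrite !mulmxA.
- apply: contra_neq n0 => E; have ij0 : i *m j = 0.
    have ug' : invmx g \in unitmx by rewrite unitmx_inv.
    apply: (can_inj (mulKmx ug)); apply: (can_inj (mulmxK ug')).
    by rewrite mulmx0 mul0mx -E !mulmxA.
  have : \tr (X *m Y - Y *m X) = 0 by rewrite raddfB /= mxtrace_mulC subrr.
  by rewrite XY ij0 addr0 mxtrace1 => /eqP; rewrite (pcharf0P _).1 // => /eqP.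
by rewrite XE YE; apply: realizes_conj.
Qed.

End Realizes.

Local Open Scope classical_set_scope.

Lemma conj_orbit_refl (F : fieldType) n (p : 'M[F]_n * 'M[F]_n) : conj_orbit p p.
Proof.
case: p => X Y; exists 1%:M; split; first exact: unitmx1.
by rewrite invmx1 !mul1mx !mulmx1.
Qed.

Theorem corollary5p7 (R : realType) (D : algType R[i]) (z d : D)
    (K : unitRingType) (iota : {rmorphism D -> K}) :
  is_weyl_algebra z d ->
  is_skew_field_of_fractions iota ->
  exists Phi : sized_set R[i] -> (lmodType D^c -> Prop),
    bijection_between (@cm_union R[i]) (rank1_torsion_free_class iota) Phi /\
    forall (n : nat) (X Y : 'M[R[i]]_n) (i : 'cV[R[i]]_n) (j : 'rV[R[i]]_n),
      cm_pairs (X, Y) ->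
      X *m Y - Y *m X = 1%:M + i *m j ->
      forall M : lmodType D^c,
        Phi (cm_point (X, Y)) M <-> is_monad_cohomology z d X Y i j M.
Proof.
move=> weyl frac; have [th ord] := normal_ordering_exists weyl.
have char0 : [pchar R[i]] =i pred0 by exact: Num.Theory.pchar_num.
(* One representative of the orbit and one factorisation suffice for membership; [monad_conj] makes
   the choice immaterial. *)
pose Phi (c : sized_set R[i]) (M : lmodType D^c) := exists X Y i j,
  [/\ @sized_val _ c (X, Y), X *m Y - Y *m X = 1%:M + i *m j & is_monad_cohomology z d X Y i j M].
have PhiE n (X Y : 'M[R[i]]_n) i j M : X *m Y - Y *m X = 1%:M + i *m j ->
    Phi (cm_point (X, Y)) M <-> is_monad_cohomology z d X Y i j M.
  move=> XY; split=> [[X' [Y' [i' [j' [orb XY' mon]]]]]|mon].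
    exact: (monad_conj ord char0 XY XY' orb mon).
  by exists X, Y, i, j; split=> //; apply: conj_orbit_refl.
have PhiC n (X Y : 'M[R[i]]_n) i j N : X *m Y - Y *m X = 1%:M + i *m j ->
    is_monad_cohomology z d X Y i j N -> Phi (cm_point (X, Y)) = iso_class N.
  move=> XY monN; apply: funext => M; apply: propext; rewrite (PhiE _ _ _ _ _ _ XY).
  split=> [monM|isoNM]; first exact: monad_isomorphic monN monM.
  exact: monad_transport isoNM monN.
have unionE (c : sized_set R[i]) : cm_union c ->
    exists n (X Y : 'M[R[i]]_n) (i : 'cV[R[i]]_n) (j : 'rV[R[i]]_n),
    X *m Y - Y *m X = 1%:M + i *m j /\ c = cm_point (X, Y).
  case: c => n S [[X Y] /(cm_pairs_relation char0)[i [j XY]] /= <-].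
  by exists n, X, Y, i, j.
exists Phi; split=> [|n X Y i j _ XY M]; last exact: PhiE.
split=> [c /unionE[n [X [Y [i [j [XY ->]]]]]]|c c' |C [M rkM ->]].
- have [N [_ monN rkN]] := pair_module_exists ord XY.
  by exists N; [apply: rkN|apply: PhiC monN].
- move=> /unionE[n [X [Y [i [j [XY ->]]]]]] /unionE[n' [X' [Y' [i' [j' [XY' ->]]]]]] E.
  have [N [realN monN _]] := pair_module_exists ord XY.
  have [N' [realN' monN' _]] := pair_module_exists ord XY'.
  have monN2 : is_monad_cohomology z d X' Y' i' j' N.
    by apply/(PhiE _ _ _ _ _ _ XY'); rewrite -E; apply/(PhiE _ _ _ _ _ _ XY).
  have realN2 := realizes_transport (monad_isomorphic monN' monN2) realN'.
  exact: (realizes_cm_point ord char0 XY XY' realN realN2).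
(* A framing of [M] as an ideal yields a pair; the module built from that pair realizes it too,
   hence is isomorphic to [M] and passes its monad on. *)
- have [t [tD tZ t_inj [m0 [f [f0 tm0]]]]] := rank1_ideal ord frac rkM.
  have [r [al fr]] := ideal_framing ord tD tZ t_inj tm0 f0.
  have [n [X [Y [i [j [XY realM]]]]]] := framing_realizes ord fr.
  have [N [realN monN _]] := pair_module_exists ord XY.
  have monM := monad_transport (realizes_isomorphic ord realN realM) monN.
  exists (cm_point (X, Y)); last exact: PhiC monM.
  by exists (X, Y) => //; apply/(cm_pairs_relation char0); exists i, j.
Qed.
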